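(* Consider the linear transformation model $h^*(y)=\mathbf{x}^T\boldsymbol{\beta}^*+\epsilon$ (as specified in the context) with true slope vector $\boldsymbol{\beta}^*\in\mathbb{R}^p$ satisfying $0<\|\boldsymbol{\beta}^*\|_0\le s$, and let $(\mathbf{x}_1,y_1),\dots,(\mathbf{x}_n,y_n)$ be i.i.d. observations from it. Suppose that: (1) for each $j=1,\dots,p$, the pair $(x_j,h^*(y))$ has a bivariate elliptical distribution; (2) $\mathbf{x}$ is subgaussian with $\|\mathbf{x}\|_{\psi_2}:=\sup_{\|\mathbf{u}\|=1}\|\mathbf{u}^T\mathbf{x}\|_{\psi_2}\le K$, where $\|z\|_{\psi_2}=\sup_{q\ge1}q^{-1/2}(E|z|^q)^{1/q}$ for a scalar random variable $z$; (3) there is a constant $M>1$ such that $M^{-1}\le\lambda_{\min}(\boldsymbol{\Sigma}_{xx})<\lambda_{\max}(\boldsymbol{\Sigma}_{xx})\le M$, where $\boldsymbol{\Sigma}_{xx}=\mathrm{Cov}(\mathbf{x})$; (4) $n\ge C_1 s\log p$ for some sufficiently large constant $C_1>0$. Then for any constant $C'>0$ there exist positive constants $\gamma_1,\gamma_2$ and $C$ depending only on $C_1,C',K$ and $M$ such that, when the tuning parameters satisfy $\alpha_1=\gamma\sqrt{\log(p)/n}$ with $\gamma\in[\gamma_1,\gamma_2]$ and $\alpha_2\|\boldsymbol{\beta}^*\|_\infty\le\alpha_1$, the CENet estimator $\hat{\boldsymbol{\beta}}$ with tuning parameters $(\alpha_1,\alpha_2)$ satisfies $$\|\hat{\boldsymbol{\beta}}-\boldsymbol{\beta}^*\|^2\le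 C s\alpha_1^2$$ with probability at least $1-6\exp(-C'\log p)$.
   Context: Model. $\mathbf{x}=(x_1,\dots,x_p)\in\mathbb{R}^p$ is a random vector with $E(\mathbf{x})=\mathbf{0}$, $y$ is a real random variable, $h^*:\mathbb{R}\to\mathbb{R}$ is an unknown strictly increasing function, and $h^*(y)=\mathbf{x}^T\boldsymbol{\beta}^*+\epsilon$, where $\epsilon$ is independent of $\mathbf{x}$, $E(\epsilon)=0$, and $\mathrm{Var}(\epsilon)<\infty$. For identifiability, $\boldsymbol{\beta}^{*T}\boldsymbol{\Sigma}_{xx}\boldsymbol{\beta}^*=1$ with $\boldsymbol{\Sigma}_{xx}=\mathrm{Cov}(\mathbf{x})$. The data are $n$ i.i.d. copies $(\mathbf{x}_i,y_i)$, $\mathbf{x}_i=(x_{i1},\dots,x_{ip})$. Norms: $\|\mathbf{a}\|_0$ is the number of nonzero coordinates, and $\|\mathbf{a}\|_1,\|\mathbf{a}\|,\|\mathbf{a}\|_\infty$ are the $\ell_1,\ell_2,\ell_\infty$ norms. CENet estimator. Let $\hat{\boldsymbol{\Sigma}}_{xx}=\frac1n\sum_{i=1}^n\mathbf{x}_i\mathbf{x}_i^T$, $\hat\sigma_j=[(\hat{\boldsymbol{\Sigma}}_{xx})_{jj}]^{1/2}$, $\sigma_y=[\mathrm{Var}(h^*(y))]^{1/2}$, and let $$\hat\tau_j=\frac{2}{n(n-1)}\sum_{i<\ell}\mathrm{sign}(x_{ij}-x_{\ell j})\,\mathrm{sign}(y_i-y_\ell),\qquad \mathrm{sign}(a)=\mathbf{1}(a>0)-\mathbf{1}(a<0),$$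 be Kendall's tau. Let $\hat{\boldsymbol{\Sigma}}_{xy}\in\mathbb{R}^p$ have $j$th entry $\sigma_y\hat\sigma_j\sin(\frac{\pi}{2}\hat\tau_j)$. (Since $\boldsymbol{\beta}^*$ is only identifiable up to scale, the paper remarks that the factor $\sigma_y$ in this definition may without loss of generality be set to $1$.) For tuning parameters $\alpha_1,\alpha_2\ge0$, the CENet estimator $\hat{\boldsymbol{\beta}}$ is the solution of $$\min_{\boldsymbol{\beta}\in\mathbb{R}^p}\left\{-\boldsymbol{\beta}^T\hat{\boldsymbol{\Sigma}}_{xy}+\alpha_1\|\boldsymbol{\beta}\|_1+\alpha_2\|\boldsymbol{\beta}\|^2\right\}\quad\text{subject to}\quad\boldsymbol{\beta}^T\hat{\boldsymbol{\Sigma}}_{xx}\boldsymbol{\beta}\le1.$$ (The solution exists and is unique when $\alpha_2>0$.)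
   Formalization: The constants γ1, γ2, C may also depend on an arbitrary upper bound for σ_y (uniformity over all noise variances fails), and ''elliptical'' is taken with an almost surely positive radius, i.e. no atom at the centre (otherwise Kendall's tau loses its relation to correlation). *)

(* Defs.v *)
From HB Require Import structures.
From mathcomp Require Import all_boot all_order all_algebra.
From mathcomp Require Import all_classical all_reals all_analysis.

Set Implicit Arguments.
Unset Strict Implicit.
Unset Printing Implicit Defensive.

Import Order.TTheory GRing.Theory Num.Theory.
Import numFieldNormedType.Exports.

Local Open Scope classical_set_scope.
Local Open Scope ring_scope.

Section vectors.
Context {R : realType} {p : nat}.
Implicit Types (u v : 'cV[R]_p) (A : 'M[R]_p).

Definition l0norm u : nat := #|[set j : 'I_p | u j 0 != 0]%SET|.
Definition l1norm u : R := \sum_(j < p) `|u j 0|.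
Definition l2norm u : R := Num.sqrt (\sum_(j < p) u j 0 ^+ 2).
Definition linfnorm u : R := \big[Num.max/0]_(j < p) `|u j 0|.

Definition dotp u v : R := (u^T *m v) 0 0.
Definition qform A u : R := (u^T *m A *m u) 0 0.

Definition lambda_min A : R := inf [set a | eigenvalue A a].
Definition lambda_max A : R := sup [set a | eigenvalue A a].

Definition col_of_tuple (t : p.-tuple R) : 'cV[R]_p := \col_j tnth t j.

End vectors.

(* Random vectors of R^p are random variables with values in p.-tuple R, whose
   sigma-algebra is the one generated by the coordinates. *)
Section random_vectors.
Context {d : measure_display} {T : measurableType d} {R : realType}.
Variable P : probability T R.

Definition coordrv p (x : T -> p.-tuple R) (j : 'I_p) : T -> R :=
  fun w => tnth (x w) j.

Definition lincomb p (u : 'cV[R]_p) (x : T -> p.-tuple R) : T -> R :=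
  fun w => dotp u (col_of_tuple (x w)).

Definition cov_mx p (x : T -> p.-tuple R) : 'M[R]_p :=
  \matrix_(j, k) fine (covariance P (coordrv x j) (coordrv x k)).

Definition std_dev (X : T -> R) : R := Num.sqrt (fine 'V_P[X]).

Definition independent2 d1 (T1 : measurableType d1) d2 (T2 : measurableType d2)
    (X : T -> T1) (Y : T -> T2) : Prop :=
  forall (A : set T1) (B : set T2), measurable A -> measurable B ->
    P (X @^-1` A `&` Y @^-1` B) = (P (X @^-1` A) * P (Y @^-1` B))%E.

(* The product rule for subfamilies is the case where the other A i are setT. *)
Definition mutually_independent n d1 (T1 : measurableType d1)
    (X : 'I_n -> T -> T1) : Prop :=
  forall A : 'I_n -> set T1, (forall i, measurable (A i)) ->
    P (\bigcap_(i in [set: 'I_n]) (X i @^-1` A i)) =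
    (\prod_(i < n) P (X i @^-1` A i))%E.

Definition same_law d1 (T1 : measurableType d1) (X Y : T -> T1) : Prop :=
  forall A : set T1, measurable A -> P (X @^-1` A) = P (Y @^-1` A).

(* sup_{q >= 1} q^{-1/2} (E|z|^q)^{1/q}, possibly +oo *)
Definition psi2norm (z : T -> R) : \bar R :=
  ereal_sup [set ((q `^ (- 2^-1))%:E * 'N[P]_(q%:E)[EFin \o z])%E
            | q in [set q : R | 1 <= q]].

Definition psi2norm_vec p (x : T -> p.-tuple R) : \bar R :=
  ereal_sup [set psi2norm (lincomb u x)
            | u in [set u : 'cV[R]_p | l2norm u = 1]].

Lemma zero_lt_2pi : 0 < 2 * pi :> R.
Proof. by rewrite mulr_gt0 ?pi_gt0. Qed.

(* (X, Y) has the law of m + xi A U, with U = (cos theta, sin theta) uniform on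
   the unit circle and xi, of law nu, independent of U.  As usual for
   rank-based methods, the generating variate xi is almost surely positive, so
   that the law has no atom at its centre m: with such an atom, Kendall's tau
   would no longer be (2 / pi) arcsin of the correlation.  A may be singular and
   no density is required. *)
Definition bivariate_elliptical (X Y : T -> R) : Prop :=
  exists (m1 m2 a11 a12 a21 a22 : R) (nu : probability R R),
    nu `]0, +oo[%classic = 1%E /\
    forall B : set (R * R), measurable B ->
      P [set w | B (X w, Y w)] =
      (nu \x uniform_prob zero_lt_2pi)%E
        [set t : R * R |
          B (m1 + t.1 * (a11 * cos t.2 + a12 * sin t.2),
             m2 + t.1 * (a21 * cos t.2 + a22 * sin t.2))].

Record transformation_model p (x : {RV P >-> p.-tuple R}) (y eps : {RV P >-> R})
    (h : R -> R) (beta : 'cV[R]_p) : Prop := TransformationModel {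
  mean_x : forall j, ('E_P[coordrv x j] = 0)%E;
  h_increasing : {homo h : a b / a < b};
  h_model : forall w, h (y w) = lincomb beta x w + eps w;
  eps_indep : independent2 eps x;
  mean_eps : ('E_P[eps] = 0)%E;
  var_eps : ('V_P[eps] < +oo)%E;
  identifiable : qform (cov_mx x) beta = 1
}.

Definition iid_copies n d1 (T1 : measurableType d1) (Z : 'I_n -> T -> T1)
    (Z0 : T -> T1) : Prop :=
  mutually_independent Z /\ forall i, same_law (Z i) Z0.

(* The event {w | Q w} contains a measurable event of probability at least c. *)
Definition with_prob_at_least (c : R) (Q : T -> Prop) : Prop :=
  exists E : set T, [/\ measurable E, (c%:E <= P E)%E & E `<=` [set w | Q w]].

End random_vectors.

Section cenet.
Context {R : realType} {n p : nat}.
Variable D : 'I_n -> p.-tuple R * R.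

Definition obs_x (i : 'I_n) : 'cV[R]_p := col_of_tuple (D i).1.
Definition obs_y (i : 'I_n) : R := (D i).2.

Definition Sigma_hat_xx : 'M[R]_p :=
  n%:R^-1 *: \sum_(i < n) obs_x i *m (obs_x i)^T.

Definition sigma_hat (j : 'I_p) : R := Num.sqrt (Sigma_hat_xx j j).

Definition kendall_tau (j : 'I_p) : R :=
  2 / (n%:R * (n%:R - 1)) *
  \sum_(i < n) \sum_(l < n | (i < l)%N)
    Num.sg (obs_x i j 0 - obs_x l j 0) * Num.sg (obs_y i - obs_y l).

Definition Sigma_hat_xy (sigma_y : R) : 'cV[R]_p :=
  \col_j (sigma_y * sigma_hat j * sin (pi / 2 * kendall_tau j)).

(* sigma_y is the population standard deviation of h(y), treated as a known
   constant of the problem: it only fixes the scale of the cross-covariance. *)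
Definition cenet_objective (sigma_y alpha1 alpha2 : R) (b : 'cV[R]_p) : R :=
  - dotp b (Sigma_hat_xy sigma_y) + alpha1 * l1norm b + alpha2 * l2norm b ^+ 2.

Definition is_cenet (sigma_y alpha1 alpha2 : R) (b : 'cV[R]_p) : Prop :=
  qform Sigma_hat_xx b <= 1 /\
  forall b', qform Sigma_hat_xx b' <= 1 ->
    cenet_objective sigma_y alpha1 alpha2 b <=
    cenet_objective sigma_y alpha1 alpha2 b'.

End cenet.

(* Main.v *)
(** Let S be the covariance matrix, A its sample version and L = log p.

    If n >= C3 L, put r^2 = beta^T A beta, which is close to 1, and compare the
    CENet solution b with the feasible point beta / r. The first-order
    comparison puts b - beta / r in the usual cone as soon as the entries of
    Sigma_hat_xy - A beta are at most alpha1 / 2, and the rate then follows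
    from a restricted eigenvalue bound for A. The restricted eigenvalue bound
    comes from Maurey's empirical method: it suffices that A - S / 2 be
    nonnegative at all sums of O(s) signed basis vectors, a finite family to
    which a union bound applies.

    The entries of S beta are those of Sigma_hat_xy with sample quantities
    replaced by population ones, because sin (pi tau / 2) is the correlation of
    an elliptical pair. This is proved by conditioning on the radii: rotating
    one angle by the other makes the difference of two independent copies a
    uniformly rotated vector, whose signs agree with a probability depending
    only on the angle between the rows of the scatter matrix.

    If n < C3 L, then alpha1 is bounded below by a constant that can be chosen
    larger than all entries of Sigma_hat_xy, so b = 0 and
    |beta|^2 <= M <= M s alpha1^2. *)

Require Import Defs.
From HB Require Import structures.
From mathcomp Require Import all_boot all_order all_algebra.
From mathcomp Require Import all_classical all_reals all_analysis.
From mathcomp Require Import measurable_realfun.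
From mathcomp Require Import ring lra.

Set Implicit Arguments.
Unset Strict Implicit.
Unset Printing Implicit Defensive.

Import Order.TTheory GRing.Theory Num.Theory.
Import numFieldNormedType.Exports.

Local Open Scope classical_set_scope.
Local Open Scope ring_scope.

(** * Inner products and quadratic forms *)

Section linear_algebra.
Context {R : realType} {p : nat}.
Implicit Types (u v : 'cV[R]_p) (A Q : 'M[R]_p).

(** The split at [C3 L] is forced by the order of the constants: the threshold on [C1] is fixed
    before [C'], while accurate concentration with failure probability [p^-C'] costs a sample size
    that grows with [C']. Below [C3 L] the ratio [n / L] is bounded, and crude bounds on the entries
    suffice. The linear term and the l1 penalty supply no curvature in the sample covariance: it
    comes only from the constraint. As [beta] itself may violate the constraint, the comparison
    point is [beta / r], which lies on its boundary. The restricted eigenvalue bound asks only for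
    deviations of constant size, so a union over [p^O(s)] signed sums is affordable when
    [n >= C1 s L]. Deviations of size [sqrt (L / n)] are asked only of O(p) quadratic forms and of
    the [p] Kendall coefficients. The factor 6 counts six unions of bad events, each of probability
    at most [p^-C']. Means of sign products are carried as integrals of [1 + sg * sg], which is
    nonnegative, so that Tonelli's theorem applies without integrability conditions. *)

Lemma dotpE u v : dotp u v = \sum_j u j 0 * v j 0.
Proof. by rewrite /dotp mxE; apply: eq_bigr => j _; rewrite mxE. Qed.

Lemma dotpC u v : dotp u v = dotp v u.
Proof. by rewrite !dotpE; apply: eq_bigr => j _; rewrite mulrC. Qed.

Lemma dotpDl u v w : dotp (u + v) w = dotp u w + dotp v w.
Proof. by rewrite /dotp linearD mulmxDl mxE. Qed.

Lemma dotpZl a u v : dotp (a *: u) v = a * dotp u v.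
Proof. by rewrite /dotp linearZ -scalemxAl mxE. Qed.

Lemma dotpDr u v w : dotp u (v + w) = dotp u v + dotp u w.
Proof. by rewrite dotpC dotpDl !(dotpC u). Qed.

Lemma dotpZr a u v : dotp u (a *: v) = a * dotp u v.
Proof. by rewrite dotpC dotpZl dotpC. Qed.

Lemma dotpBl u v w : dotp (u - v) w = dotp u w - dotp v w.
Proof. by rewrite dotpDl -scaleN1r dotpZl mulN1r. Qed.

Lemma dotpBr u v w : dotp u (v - w) = dotp u v - dotp u w.
Proof. by rewrite dotpC dotpBl !(dotpC u). Qed.

Lemma dotp0l u : dotp 0 u = 0.
Proof. by rewrite -(scale0r 0) dotpZl mul0r. Qed.

Lemma l2normE u : l2norm u ^+ 2 = dotp u u.
Proof.
rewrite /l2norm sqr_sqrtr ?sumr_ge0// => [|i _]; last by rewrite sqr_ge0.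
by rewrite dotpE.
Qed.

Lemma l2norm_ge0 u : 0 <= l2norm u. Proof. exact: sqrtr_ge0. Qed.

Lemma dotp_ge0 u : 0 <= dotp u u.
Proof. by rewrite -l2normE sqr_ge0. Qed.

Lemma dotp_eq0 u : (dotp u u == 0) = (u == 0).
Proof.
apply/eqP/eqP => [|->]; last by rewrite dotp0l.
rewrite dotpE => /psumr_eq0P h; apply/colP => j; rewrite mxE.
by apply/eqP; rewrite -sqrf_eq0 expr2; apply/eqP/h => // i _; rewrite -expr2 sqr_ge0.
Qed.

Lemma qformE A u : qform A u = dotp u (A *m u).
Proof. by rewrite /qform /dotp mulmxA. Qed.

Lemma mulmx_delta A (j k : 'I_p) : dotp (delta_mx j 0) (A *m delta_mx k 0) = A j k.
Proof.
rewrite dotpE (bigD1 j)//= big1 ?addr0 => [|i ij]; last first.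
  by rewrite mxE eqxx andbT (negbTE ij) mul0r.
rewrite !mxE !eqxx mul1r (bigD1 k)//= big1 ?addr0 => [|i ij]; last first.
  by rewrite mxE eqxx andbT (negbTE ij) mulr0.
by rewrite mxE !eqxx mulr1.
Qed.

Lemma dotp_delta (j : 'I_p) u : dotp (delta_mx j 0) u = u j 0.
Proof.
rewrite dotpE (bigD1 j)//= big1 ?addr0 => [|i ij]; last first.
  by rewrite mxE eqxx andbT (negbTE ij) mul0r.
by rewrite mxE !eqxx mul1r.
Qed.

Lemma dotp_mulmx A u v : dotp u (A *m v) = dotp (A^T *m u) v.
Proof. by rewrite /dotp trmx_mul trmxK mulmxA. Qed.

Lemma qformD A u v : A^T = A ->
  qform A (u + v) = qform A u + 2 * dotp u (A *m v) + qform A v.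
Proof.
move=> As; rewrite !qformE mulmxDr !dotpDr !dotpDl.
rewrite (_ : dotp v (A *m u) = dotp u (A *m v)).
  by ring.
by rewrite dotp_mulmx As dotpC.
Qed.

Lemma qformZ A a u : qform A (a *: u) = a ^+ 2 * qform A u.
Proof. by rewrite !qformE -scalemxAr dotpZl dotpZr; ring. Qed.

Lemma qformDl A Q u : qform (A + Q) u = qform A u + qform Q u.
Proof. by rewrite !qformE mulmxDl dotpDr. Qed.

Lemma qformZl a A u : qform (a *: A) u = a * qform A u.
Proof. by rewrite !qformE -scalemxAl dotpZr. Qed.

Lemma qform0 A : qform A 0 = 0.
Proof. by rewrite qformE dotp0l. Qed.

Lemma qform1 u : qform 1%:M u = dotp u u.
Proof. by rewrite qformE mul1mx. Qed.

Lemma l1norm_ge0 u : 0 <= l1norm u.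
Proof. exact: sumr_ge0. Qed.

End linear_algebra.

(** * Maurey's empirical method *)
Section maurey.
Context {R : realType} {p : nat}.

Definition signed_basis (z : 'I_p * bool) : 'cV[R]_p :=
  (-1) ^+ z.2 *: delta_mx z.1 0.

Lemma qform_signed_basis (Q : 'M[R]_p) z : qform Q (signed_basis z) = Q z.1 z.1.
Proof. by rewrite qformZ sqrr_sign mul1r qformE mulmx_delta. Qed.

Definition sign_of (x : R) : bool := x < 0.

Lemma sign_of_norm x : x = `|x| * (-1) ^+ sign_of x.
Proof.
rewrite /sign_of; case: ltP => x0; first by rewrite ltr0_norm// mulrN1 opprK.
by rewrite ger0_norm// mulr1.
Qed.

(* [c j / L] is a probability on the coordinates and [w = v / L] is the mean of
   the corresponding random signed basis vector; some value of it does at least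
   as well as the average. *)
Lemma maurey_step (Q : 'M[R]_p) (B : R) (v a : 'cV[R]_p) : Q^T = Q ->
  (forall j, Q j j <= B) -> 0 < l1norm v ->
  exists z, qform Q (a + signed_basis z) <=
    qform Q (a + (l1norm v)^-1 *: v) + (B - qform Q ((l1norm v)^-1 *: v)).
Proof.
set L := l1norm v; set w := L^-1 *: v => Qs QB L0.
apply: contrapT => /forallNP h.
pose z j := (j, sign_of (v j 0)).
have zE : \sum_j (`|v j 0| / L) *: signed_basis (z j) = w.
  apply/colP => i; rewrite summxE (bigD1 i)//= big1 ?addr0 => [|j ji].
    rewrite !mxE !eqxx mulr1 /= mulrAC -sign_of_norm.
    by rewrite mulrC.
  by rewrite !mxE eq_sym (negbTE ji) !mulr0.
have c1 : \sum_j (`|v j 0| / L) = 1.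
  by rewrite -mulr_suml divff// gt_eqF.
set rhs := qform Q (a + w) + (B - qform Q w) in h.
have : \sum_j (`|v j 0| / L) * qform Q (a + signed_basis (z j)) <= rhs.
  have -> : \sum_j (`|v j 0| / L) * qform Q (a + signed_basis (z j)) =
     qform Q a + 2 * dotp a (Q *m w) + \sum_j (`|v j 0| / L) * Q j j.
    under eq_bigr do rewrite qformD// qform_signed_basis/= !mulrDr.
    rewrite !big_split/= -mulr_suml c1 mul1r; congr (_ + _ + _).
    rewrite -zE mulmx_sumr.
    rewrite (_ : dotp a _ = \sum_j dotp a (Q *m ((`|v j 0| / L) *: signed_basis (z j)))).
      rewrite mulr_sumr; apply: eq_bigr => j _.
      by rewrite -[in RHS]scalemxAr [in RHS]dotpZr mulrCA.
    rewrite dotpE; under [RHS]eq_bigr do rewrite dotpE.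
    rewrite exchange_big/=; apply: eq_bigr => i _.
    by rewrite summxE mulr_sumr.
  rewrite /rhs qformD//.
  have : \sum_j `|v j 0| / L * Q j j <= B.
    rewrite -[leRHS]mul1r -c1 mulr_suml; apply: ler_sum => j _.
    by rewrite ler_wpM2l// divr_ge0// ltW.
  by lra.
apply/negP; rewrite -ltNge.
have [j0 vj0] : exists j, v j 0 != 0.
  apply: contrapT => /forallNP v0; move: L0.
  rewrite /L /l1norm big1 ?ltxx// => j _.
  by apply/eqP; rewrite normr_eq0; apply/negPn/negP/v0.
have hj j : rhs < qform Q (a + signed_basis (z j)).
  by rewrite ltNge; apply/negP/h.
rewrite -[ltLHS]mul1r -c1 mulr_suml (bigD1 j0)//= [ltRHS](bigD1 j0)//=.
apply: ltr_leD; first by rewrite ltr_pM2l// divr_gt0 ?normr_gt0.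
by apply: ler_sum => j _; rewrite ler_wpM2l// ?divr_ge0// ltW.
Qed.

(** Iterating the step trades the [m] copies of the mean vector for signed basis vectors one by one;
    each trade costs at most [B] minus the value of [Q] at the mean. *)
Lemma maurey (Q : 'M[R]_p) (B : R) (v : 'cV[R]_p) : Q^T = Q ->
  (forall j, Q j j <= B) -> 0 < l1norm v ->
  forall (m : nat) (a : 'cV[R]_p),
  exists z : 'I_m -> 'I_p * bool,
    qform Q (a + \sum_l signed_basis (z l)) <=
    qform Q (a + m%:R *: ((l1norm v)^-1 *: v)) +
      m%:R * (B - qform Q ((l1norm v)^-1 *: v)).
Proof.
move=> Qs QB L0; set w := _ *: v; elim => [|m IHm] a.
  have z0 : 'I_0 -> 'I_p * bool by case.
  by exists z0; rewrite big_ord0 scale0r mul0r !addr0.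
have [z hz] := maurey_step (a + m%:R *: w) Qs QB L0.
have [f hf] := IHm (a + signed_basis z).
exists (fun l => if unlift ord0 l is Some l' then f l' else z).
rewrite big_ord_recl unlift_none.
under eq_bigr do rewrite liftK.
rewrite addrA (le_trans hf)//.
rewrite (addrAC a) mulrSr mulrDl mul1r scalerDl scale1r !addrA.
by move: hz; rewrite -/w; lra.
Qed.

(** With [m = k.+1], [a = 0] and [w = v / l1norm v], Maurey's bound reads [0 <= k.+1 ^ 2 * Q(w) +
    k.+1 * (B - Q(w)) = k.+1 * (k * Q(w) + B)]. This is why sums of [k.+1] vectors give a factor
    [k]. Homogeneity turns [w] back into [v]. *)
Lemma qform_ge_of_signed_sums (Q : 'M[R]_p) (B : R) (k : nat) (v : 'cV[R]_p) :
  Q^T = Q -> (forall j, Q j j <= B) ->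
  (forall z : 'I_k.+1 -> 'I_p * bool, 0 <= qform Q (\sum_l signed_basis (z l))) ->
  - (l1norm v ^+ 2 * B) <= k%:R * qform Q v.
Proof.
move=> Qs QB Q0.
have [L0|L0] := ltP 0 (l1norm v); last first.
  have : l1norm v == 0 by rewrite eq_le L0 l1norm_ge0.
  rewrite psumr_eq0// => /allP v0.
  suff -> : v = 0 by rewrite qform0 /l1norm big1 ?expr0n ?mul0r ?oppr0 ?mulr0//= => i; rewrite mxE normr0.
  apply/colP => j; rewrite mxE; apply/eqP; rewrite -normr_eq0.
  by apply: v0; rewrite mem_index_enum.
have [z hz] := maurey Qs QB L0 k.+1 0.
move: hz; rewrite !add0r => /(le_trans (Q0 z)).
rewrite 2!qformZ; set L := l1norm v in L0 *.
rewrite mulrBr addrA => h.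
have k0 : 0 < k.+1%:R :> R by rewrite ltr0n.
have : 0 <= k.+1%:R * (L ^- 2 * qform Q v) + (B - L ^- 2 * qform Q v).
  rewrite -(pmulr_rge0 _ k0); move: h; rewrite exprVn; lra.
rewrite -(pmulr_rge0 _ (exprn_gt0 2 L0)).
have L20 : L ^+ 2 != 0 by rewrite expf_neq0// gt_eqF.
have -> : L ^+ 2 * (k.+1%:R * (L ^- 2 * qform Q v) + (B - L ^- 2 * qform Q v)) =
   k%:R * qform Q v + L ^+ 2 * B.
  by rewrite mulrSr; field; rewrite gt_eqF.
lra.
Qed.

End maurey.

(** * The least eigenvalue as a minimum of the quadratic form *)

Section rayleigh.
Context {R : realType}.


Lemma continuous_sum_seq (T : topologicalType) I (r : seq I) (f : I -> T -> R) :
  (forall i, continuous (f i)) -> continuous (fun v => \sum_(i <- r) f i v).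
Proof.
move=> cf; elim: r => [|i r IH] v.
  rewrite (_ : (fun _ => _) = cst 0); first exact: cst_continuous.
  by apply/funext => x; rewrite big_nil.
rewrite (_ : (fun _ => _) = f i \+ (fun v => \sum_(i <- r) f i v)).
  by apply: continuousD; [exact: cf|exact: IH].
by apply/funext => x; rewrite big_cons.
Qed.

Lemma continuous_qform_tr p (A : 'M[R]_p) :
  continuous (fun v : 'rV[R]_p => qform A v^T).
Proof.
rewrite (_ : (fun _ => _) = fun v : 'rV[R]_p =>
    \sum_j v ord0 j * \sum_k A j k * v ord0 k).
  apply: continuous_sum_seq => j v.
  apply: continuousM; first exact: coord_continuous.
  apply: continuous_sum_seq => k {}v.
  by apply: continuousM; [exact: cst_continuous|exact: coord_continuous].
apply/funext => v; rewrite qformE dotpE; apply: eq_bigr => j _.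
by rewrite !mxE; congr (_ * _); apply: eq_bigr => k _; rewrite mxE.
Qed.

Lemma qform_scalar p (a : R) (u : 'cV[R]_p) : qform a%:M u = a * dotp u u.
Proof. by rewrite qformE mul_scalar_mx dotpZr. Qed.

(** A continuous function attains its minimum on the compact unit sphere, and homogeneity extends
    the bound to all vectors. The size [p.+1] makes the sphere nonempty. *)
Lemma qform_min p (A : 'M[R]_p.+1) : exists2 c, dotp c c = 1 &
  forall u, qform A c * dotp u u <= qform A u.
Proof.
pose S := [set v : 'rV[R]_p.+1 | qform 1%:M v^T = 1].
have S0 : S !=set0.
  exists (delta_mx 0 0); rewrite /S /= qform1 trmx_delta.
  by rewrite dotp_delta mxE !eqxx.
have Scomp : compact S.
  apply: bounded_closed_compact; last first.
    apply: (preimage_closed _ (@closed_eq _ 1)).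
    by move=> x _; exact: continuous_qform_tr.
  exists 1; split => // M M1 v /=; rewrite /S/= qform1 dotpE => vS.
  rewrite /Num.norm/= mx_normrE; apply: bigmax_le => [|[i j] _ /=].
    by rewrite (le_trans _ (ltW M1)).
  apply: le_trans (ltW M1); rewrite -(@expr_le1 _ 2)// real_normK ?num_real//.
  rewrite -vS (bigD1 j)//= !mxE ord1 -expr2 lerDl sumr_ge0// => k _.
  by rewrite -expr2 sqr_ge0.
have [c cS cmin] := compact_EVT_min S0 Scomp
  (continuous_subspaceT (@continuous_qform_tr _ A)).
exists c^T; first by move: cS; rewrite inE /S/= qform1.
move=> u; have [->|u0] := eqVneq u 0; first by rewrite dotp0l qform0 mulr0.
have uu0 : 0 < dotp u u by rewrite lt_neqAle dotp_ge0 eq_sym dotp_eq0 u0.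
pose r := Num.sqrt (dotp u u).
have r2 : r ^+ 2 = dotp u u by rewrite sqr_sqrtr// ltW.
have r0 : r != 0 by rewrite gt_eqF// sqrtr_gt0.
have /cmin : (r^-1 *: u)^T \in S.
  by rewrite inE /S/= trmxK qform1 dotpZl dotpZr -r2; field.
rewrite trmxK qformZ -r2 => h.
have -> : qform A u = r ^+ 2 * ((r^-1) ^+ 2 * qform A u) by field.
by rewrite mulrC ler_wpM2l// sqr_ge0.
Qed.

(** The minimum [a] of the form on the sphere bounds all eigenvalues from below and is itself an
    eigenvalue: [A - a] is positive semidefinite and its form vanishes at the minimiser [c], which
    forces [(A - a) c = 0]. *)
Lemma lambda_min_le_qform p (A : 'M[R]_p) u : A^T = A ->
  lambda_min A * dotp u u <= qform A u.
Proof.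
case: p A u => [|p] A u As.
  by rewrite [u]flatmx0 dotp0l qform0 mulr0.
have [c c1 cmin] := qform_min A; set a := qform A c in cmin.
apply: le_trans (cmin u); rewrite ler_wpM2r ?dotp_ge0//.
have lbA : lbound [set a | eigenvalue A a] a.
  move=> e /= /eigenvalueP[v vA v0].
  have := cmin v^T; rewrite qformE dotp_mulmx -trmx_mul vA linearZ/= dotpZl.
  rewrite ler_pM2r// lt_neqAle dotp_ge0 eq_sym dotp_eq0 andbT.
  by apply: contra v0 => /eqP v0; rewrite -[v]trmxK v0 linear0.
apply: ge_inf; first by exists a.
apply/eigenvalueP; exists c^T; last first.
  apply/eqP => /(congr1 trmx); rewrite trmxK linear0 => c0.
  by move/eqP: c1; rewrite c0 dotp0l eq_sym oner_eq0.
suff h : A *m c = a *: c by rewrite -[A]As -trmx_mul h linearZ.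
pose B := A - a%:M.
have Bs : B^T = B by rewrite /B linearB/= As tr_scalar_mx.
have Bge w : 0 <= qform B w.
  by rewrite /B qformDl -scaleN1r qformZl qform_scalar; have := cmin w; lra.
have Bc : qform B c = 0.
  by rewrite /B qformDl -scaleN1r qformZl qform_scalar c1 -/a; ring.
suff : B *m c = 0 by rewrite /B mulmxBl mul_scalar_mx => /eqP; rewrite subr_eq0 => /eqP.
apply/eqP; rewrite -dotp_eq0; set w := B *m c; set b := dotp w w; set q := qform B w.
have q0 : 0 <= q := Bge _.
(* Moving from [c] against [w = B c] decreases the form to first order. Dividing by [q + 1] instead
   of [q] keeps the step meaningful when [q = 0]; the value becomes [- (b / (q + 1)) ^ 2 * (q + 2)],
   so [b = 0]. *)
have := Bge (c + (- (b / (q + 1))) *: w).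
rewrite qformD// qformZ Bc -scalemxAr dotpZr dotp_mulmx Bs -/w -/b -/q add0r.
have q1 : q + 1 != 0 by rewrite gt_eqF// ltr_wpDl.
have -> : 2 * (- (b / (q + 1)) * b) + (- (b / (q + 1))) ^+ 2 * q =
  - ((b / (q + 1)) ^+ 2 * (q + 2)) by field.
rewrite oppr_ge0 pmulr_lle0; last by rewrite ltr_wpDl.
move=> h; have : (b / (q + 1)) ^+ 2 == 0 by rewrite eq_le h sqr_ge0.
by rewrite sqrf_eq0 mulf_eq0 invr_eq0 (negbTE q1) orbF.
Qed.

End rayleigh.

(** * Deterministic analysis of the CENet program *)

Section cenet_deterministic.
Context {R : realType} {p : nat}.
Implicit Types (b beta g : 'cV[R]_p) (A : 'M[R]_p).

(** Cauchy-Schwarz against the constant 1, read off from the nonnegative sum of the squares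
    [(N * a j - x) ^+ 2]. *)
Lemma sqr_sum_le_card (P : pred 'I_p) (a : 'I_p -> R) :
  (\sum_(j | P j) a j) ^+ 2 <= #|P|%:R * \sum_(j | P j) a j ^+ 2.
Proof.
set x := \sum_(j | P j) a j; set y := \sum_(j | P j) a j ^+ 2; set N : R := #|P|%:R.
have [P0|P0] := posnP #|P|.
  suff -> : x = 0 by rewrite expr0n/= /N P0 mul0r.
  by rewrite /x big_pred0// => j; have /card0_eq/(_ j) := P0.
have N0 : 0 < N by rewrite ltr0n.
have : 0 <= \sum_(j | P j) (N * a j - x) ^+ 2.
  by apply: sumr_ge0 => j _; exact: sqr_ge0.
have -> : \sum_(j | P j) (N * a j - x) ^+ 2 = N * (N * y - x ^+ 2).
  transitivity (\sum_(j | P j) (N ^+ 2 * a j ^+ 2 + (- (2 * N * x) * a j + x ^+ 2))).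
    by apply: eq_bigr => j _; ring.
  rewrite !big_split/= -!mulr_sumr -/y -/x sumr_const -mulr_natl -/N; ring.
by rewrite pmulr_rge0// subr_ge0.
Qed.

(** The factor [11 / 2] is [1] from the l1 penalty, [1 / 2] from the error in [g] and [4] from the
    ridge term; off the support these leave [- 1 + 1 / 2]. The last term keeps the inequality valid
    for any symmetric [A]; it is nonpositive once [A] is semidefinite, because [r >= 1 / 2]. *)
Lemma cenet_basic_inequality A g beta b (alpha1 alpha2 r : R) :
  A^T = A -> 0 <= alpha1 -> 0 <= alpha2 -> alpha2 * linfnorm beta <= alpha1 ->
  (forall j, `|(g - A *m beta) j 0| <= alpha1 / 2) ->
  2^-1 <= r -> r ^+ 2 = qform A beta ->
  qform A b <= 1 ->
  (forall b', qform A b' <= 1 ->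
    - dotp b g + alpha1 * l1norm b + alpha2 * l2norm b ^+ 2 <=
    - dotp b' g + alpha1 * l1norm b' + alpha2 * l2norm b' ^+ 2) ->
  forall D, D = b - r^-1 *: beta ->
  4^-1 * qform A D <= (11 / 2) * alpha1 * (\sum_(j | beta j 0 != 0) `|D j 0|)
      - (alpha1 / 2) * \sum_(j | beta j 0 == 0) `|D j 0| 
      + (4^-1 - r / 2) * qform A D.
Proof.
move=> As a1 a2 a12 err r2 rE Ab opt D DE.
have r0 : 0 < r by apply: lt_le_trans r2; rewrite invr_gt0.
set t := r^-1 *: beta in DE.
have bE : b = t + D by rewrite DE addrC subrK.
have At : qform A t = 1 by rewrite /t qformZ -rE -exprMn mulVf ?expr1n// gt_eqF.
(* The source of curvature: [t] lies on the boundary of the ellipsoid and [t + D] inside it, so the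
   linear term in [D] pays for the quadratic one. *)
have DAt : dotp D (A *m t) <= - (qform A D / 2).
  have : qform A t + 2 * dotp t (A *m D) + qform A D <= 1 by rewrite -qformD// -bE.
  by rewrite At (dotp_mulmx A t D) As (dotpC (A *m t)); lra.
have := opt t; rewrite At lexx => /(_ erefl) /=.
rewrite !l2normE.
have -> : dotp b b = dotp t t + 2 * dotp t D + dotp D D.
  by rewrite {1 2}bE -qform1 qformD ?trmx1// mul1mx !qform1.
set NS := \sum_(j | beta j 0 != 0) _; set NC := \sum_(j | beta j 0 == 0) _.
have split1 (F : 'I_p -> R) : \sum_j F j =
    \sum_(j | beta j 0 != 0) F j + \sum_(j | beta j 0 == 0) F j.
  by rewrite (bigID (fun j => beta j 0 != 0))/=; congr (_ + _); apply: eq_bigl => j; rewrite negbK.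
have l1 : NC - NS <= l1norm b - l1norm t.
  rewrite /l1norm -sumrB split1 addrC lerD// /NC /NS.
    rewrite -sumrN; apply: ler_sum => j _.
    rewrite bE mxE; have := ler_normB (t j 0 + D j 0) (D j 0).
    by rewrite addrK; lra.
  apply: ler_sum => j /eqP bj.
  by rewrite bE !mxE bj mulr0 normr0 !add0r subr0.
have errD : dotp D (g - A *m beta) <= alpha1 / 2 * (NS + NC).
  rewrite /NS /NC -split1 dotpE mulr_sumr; apply: ler_sum => j _.
  rewrite mulrC (le_trans (ler_norm _))// normrM ler_wpM2r//; exact: err.
have dg : dotp D g = dotp D (g - A *m beta) + r * dotp D (A *m t).
  rewrite dotpBr /t -scalemxAr dotpZr mulrA divff ?gt_eqF// mul1r.
  by rewrite subrK.
have dD : dotp b g = dotp t g + dotp D g by rewrite {1}bE dotpDl.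
(* The ridge term acts through its gradient at [t], supported where [beta] is. As [r >= 1 / 2], each
   [|t j|] is at most twice [|beta j|], and [alpha2 * linfnorm beta <= alpha1] makes this a multiple
   of the l1 penalty. *)
have a2t : - (4 * alpha1 * NS) <= alpha2 * (2 * dotp t D).
  rewrite dotpE split1 [X in _ + X]big1 ?addr0 => [|j /eqP bj]; last first.
    by rewrite !mxE bj mulr0 mul0r.
  rewrite /NS !mulr_sumr -sumrN; apply: ler_sum => j _.
  rewrite lerNl.
  rewrite (_ : - _ = 2 * alpha2 * - (t j 0 * D j 0)); last by ring.
  have: `|t j 0 * D j 0| <= 2 * linfnorm beta * `|D j 0|.
    rewrite normrM ler_wpM2r// mxE normrM ger0_norm ?invr_ge0 ?(ltW r0)//.
    apply: ler_pM => //; first by rewrite invr_ge0 ltW.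
      by rewrite -[leRHS]invrK lef_pV2// posrE invr_gt0.
    exact: (le_bigmax _ (fun j => `|beta j 0|)).
  rewrite ler_norml => /andP[h _].
  have : 2 * alpha2 * - (t j 0 * D j 0) <= 2 * alpha2 * (2 * linfnorm beta * `|D j 0|).
    by rewrite ler_wpM2l ?mulr_ge0// lerNl.
  move/le_trans; apply.
  rewrite (_ : _ * _ = 4 * ((alpha2 * linfnorm beta) * `|D j 0|)); last by ring.
  by rewrite -[leRHS]mulrA ler_pM2l// ler_wpM2r.
have DD : 0 <= alpha2 * dotp D D by rewrite mulr_ge0// dotp_ge0.
have a1l1 : alpha1 * (NC - NS) <= alpha1 * (l1norm b - l1norm t).
  by rewrite ler_wpM2l.
have rDAt : r * dotp D (A *m t) <= r * - (qform A D / 2).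
  by rewrite ler_pM2l.
move=> h; nra.
Qed.

(** On the cone [NC <= 11 * NS] the l1 norm is at most [12 * NS], so its square is at most
    [144 * s * dd]; the hypothesis with [288 = 2 * 144] lets the [eta] term use up half of [kappa].
    What remains is [kappa * dd <= 44 * alpha1 * NS], and [1936 = 44 ^ 2] after squaring and
    cancelling one [dd]. *)
Lemma cenet_error_bound A g beta b (alpha1 alpha2 r kappa eta : R) (s : nat) :
  A^T = A -> 0 < alpha1 -> 0 <= alpha2 -> alpha2 * linfnorm beta <= alpha1 ->
  (forall j, `|(g - A *m beta) j 0| <= alpha1 / 2) ->
  2^-1 <= r -> r ^+ 2 = qform A beta ->
  (l0norm beta <= s)%N -> 0 < kappa -> 0 <= eta -> 288 * eta * s%:R <= kappa ->
  (forall v, 0 <= qform A v) ->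
  (forall v, kappa * dotp v v - eta * l1norm v ^+ 2 <= qform A v) ->
  qform A b <= 1 ->
  (forall b', qform A b' <= 1 ->
    - dotp b g + alpha1 * l1norm b + alpha2 * l2norm b ^+ 2 <=
    - dotp b' g + alpha1 * l1norm b' + alpha2 * l2norm b' ^+ 2) ->
  kappa ^+ 2 * l2norm (b - r^-1 *: beta) ^+ 2 <= 1936 * s%:R * alpha1 ^+ 2.
Proof.
move=> As a1 a2 a12 err r2 rE bs k0 eta0 ks A0 RE Ab opt.
have := cenet_basic_inequality As (ltW a1) a2 a12 err r2 rE Ab opt erefl.
set D := b - _; set NS := \sum_(j | beta j 0 != 0) _; set NC := \sum_(j | beta j 0 == 0) _.
move=> basic.
have NC0 : 0 <= NC by exact: sumr_ge0.
have NS0 : 0 <= NS by exact: sumr_ge0.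
have qD : 4^-1 * qform A D <= r / 2 * qform A D by rewrite ler_wpM2r//; lra.
have cone : NC <= 11 * NS.
  rewrite -(ler_pM2l a1); have := A0 D; nra.
have l1D : l1norm D = NS + NC.
  by rewrite /l1norm (bigID (fun j => beta j 0 != 0))/=; congr (_ + _); apply: eq_bigl => j; rewrite negbK.
rewrite l2normE; set dd := dotp D D.
have dd0 : 0 <= dd by exact: dotp_ge0.
have NSs : NS ^+ 2 <= s%:R * dd.
  apply: le_trans (sqr_sum_le_card _ _) _.
  apply: ler_pM => //.
  - by apply: sumr_ge0 => j _; exact: sqr_ge0.
  - rewrite ler_nat (leq_trans _ bs)// /l0norm.
    by rewrite leq_eqVlt; apply/orP; left; apply/eqP; apply: eq_card => j; rewrite inE.
  rewrite /dd dotpE [leRHS](bigID (fun j => beta j 0 != 0))/= ler_wpDr//.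
    by apply: sumr_ge0 => j _; rewrite -expr2 sqr_ge0.
  by apply: ler_sum => j _; rewrite real_normK ?num_real// expr2.
have l1D2 : l1norm D ^+ 2 <= 144 * (s%:R * dd).
  apply: (@le_trans _ _ ((12 * NS) ^+ 2)).
    by rewrite ler_sqr ?nnegrE ?l1norm_ge0 ?mulr_ge0// l1D; lra.
  by rewrite exprMn -natrX ler_pM2l// ltr0n.
have lowq : kappa / 2 * dd <= qform A D.
  have := RE D; rewrite -/dd.
  have : eta * l1norm D ^+ 2 <= eta * (144 * (s%:R * dd)) by rewrite ler_wpM2l.
  have : 288 * eta * s%:R * dd <= kappa * dd by rewrite ler_wpM2r.
  lra.
have kdd : kappa * dd <= 44 * alpha1 * NS.
  have : 0 <= alpha1 / 2 * NC by rewrite mulr_ge0// ltW// divr_gt0.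
  lra.
have sq : (kappa * dd) ^+ 2 <= (44 * alpha1 * NS) ^+ 2.
  rewrite ler_sqr// nnegrE; first by rewrite mulr_ge0// ltW.
  by rewrite !mulr_ge0// ltW.
have rhs0 : 0 <= 1936 * s%:R * alpha1 ^+ 2.
  by apply: mulr_ge0; [apply: mulr_ge0; exact: ler0n|exact: sqr_ge0].
have [dd00|ddn] := eqVneq dd 0.
  have -> : kappa ^+ 2 * dd = 0 by rewrite dd00 mulr0.
  exact: rhs0.
have ddp : 0 < dd by rewrite lt_neqAle eq_sym ddn.
rewrite -(ler_pM2r ddp).
apply: (@le_trans _ _ ((kappa * dd) ^+ 2)); first by rewrite exprMn expr2 (expr2 dd) !mulrA.
apply: (le_trans sq); rewrite !exprMn.
have : alpha1 ^+ 2 * NS ^+ 2 <= alpha1 ^+ 2 * (s%:R * dd) by rewrite ler_wpM2l// sqr_ge0.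
lra.
Qed.

End cenet_deterministic.

(** * Integrals with a weight that decouples from a variable *)

Section weighted_integral.
Context d (T : measurableType d) d1 (T1 : measurableType d1) (R : realType).
Variable P : {measure set T -> \bar R}.
Variables (W : T -> R) (Y : T -> T1) (c : R).
Hypotheses (mW : measurable_fun setT W) (W0 : forall w, 0 <= W w)
  (mY : measurable_fun setT Y) (c0 : 0 <= c).
Hypothesis WY : forall B, measurable B ->
  (\int[P]_w (W w * \1_B (Y w))%:E = c%:E * P (Y @^-1` B))%E.

Import HBNNSimple.

Let int_nnsfun (f : {nnsfun T1 >-> R}) :
  (\int[P]_w (W w * f (Y w))%:E = c%:E * \int[P]_w (f (Y w))%:E)%E.
Proof.
have mf r : measurable (f @^-1` [set r]) by exact: measurable_sfunP.
have mfY r : measurable_fun setT (fun w => (r * \1_(f @^-1` [set r]) (Y w))%R).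
  apply: measurable_funM; first exact: measurable_cst.
  by apply: measurableT_comp => //; exact: measurable_indic.
have f0 r y : 0 <= r * \1_(f @^-1` [set r]) y.
  by rewrite -lee_fin EFinM nnfun_muleindic_ge0.
rewrite (eq_integral (fun w => (\sum_(r \in range f)
    (r * (W w * \1_(f @^-1` [set r]) (Y w)))%:E)%E)); last first.
  move=> w _; rewrite fimfunE mulr_fsumr ?fsumEFin//; congr EFin.
  by apply: eq_fsbigr => r _; rewrite mulrCA.
rewrite (@eq_integral _ _ _ P setT (fun w => (\sum_(r \in range f)
    (r * \1_(f @^-1` [set r]) (Y w))%:E)%E) (fun w => (f (Y w))%:E)); last first.
  by move=> w _; rewrite [in LHS]fimfunE -fsumEFin.
rewrite !ge0_integral_fsum//; last 4 first.
- by move=> r; exact/measurable_EFinP.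
- by move=> r w _; rewrite lee_fin.
- move=> r; apply/measurable_EFinP.
  rewrite (_ : (fun _ => _) = (fun w => W w * (r * \1_(f @^-1` [set r]) (Y w)))).
    exact: measurable_funM.
  by apply/funext => w; rewrite mulrCA.
- by move=> r w _; rewrite lee_fin mulrCA mulr_ge0.
rewrite ge0_mule_fsumr; last first.
  by move=> r; apply: integral_ge0 => w _; rewrite lee_fin.
apply: eq_fsbigr => r /set_mem[y _ fy].
have r0 : 0 <= r by rewrite -fy.
rewrite (eq_integral (fun w => r%:E * (W w * \1_(f @^-1` [set r]) (Y w))%:E)%E)//.
rewrite (@eq_integral _ _ _ P setT (fun w => r%:E * (\1_(f @^-1` [set r]) (Y w))%:E)%E (fun w => (r * \1_(f @^-1` [set r]) (Y w))%:E))//.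
rewrite !ge0_integralZl//; last 3 first.
- apply/measurable_EFinP; apply: measurableT_comp => //; exact: measurable_indic.
- apply/measurable_EFinP; apply: measurable_funM => //.
  by apply: measurableT_comp => //; exact: measurable_indic.
- by move=> w _; rewrite lee_fin mulr_ge0.
rewrite WY// muleCA; congr (_ * (_ * _))%E.
rewrite (eq_integral (fun w => (\1_(Y @^-1` (f @^-1` [set r])) w)%:E))//.
rewrite integral_indic ?setIT//.
by rewrite -[_ @^-1` _]setTI; exact: mY.
Qed.

(** Passage from indicators to nonnegative functions of [Y] by simple functions and monotone
    convergence, the weight [W] staying fixed. In the product formula for independent variables [W]
    is the product of all other factors. *)
Lemma ge0_integral_weight (g : T1 -> R) :
  measurable_fun setT g -> (forall y, 0 <= g y) ->
  (\int[P]_w (W w * g (Y w))%:E = c%:E * \int[P]_w (g (Y w))%:E)%E.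
Proof.
move=> mg g0.
have mEg : measurable_fun setT (EFin \o g) by exact/measurable_EFinP.
pose f := nnsfun_approx measurableT mEg.
have fg y : EFin \o (f ^~ y) @ \oo --> (g y)%:E.
  by apply: cvg_nnsfun_approx => // x _; rewrite lee_fin.
have mfY n : measurable_fun setT (f n \o Y) by exact: measurableT_comp.
have ndf y : {homo (fun n => f n y) : m n / (m <= n)%N >-> m <= n}.
  by move=> m n mn; have /lefP := nd_nnsfun_approx measurableT mEg mn; exact.
transitivity (limn (fun n => \int[P]_w (W w * f n (Y w))%:E)%E).
  rewrite -monotone_convergence//=; last 3 first.
  - by move=> n; apply/measurable_EFinP; exact: (measurable_funM mW (mfY n)).
  - by move=> n w _; rewrite lee_fin mulr_ge0// fun_ge0.
  - by move=> w _ m n mn; rewrite lee_fin ler_wpM2l// ndf.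
  apply: eq_integral => w _; apply/esym/cvg_lim => //.
  under eq_fun do rewrite EFinM.
  by rewrite EFinM; apply: cvgeZl => //; exact: fg.
under eq_fun do rewrite int_nnsfun.
rewrite limeMl//; last first.
  apply/ereal_nondecreasing_is_cvgn => m n mn; apply: ge0_le_integral => //=.
  - by move=> ? _; rewrite lee_fin.
  - exact/measurable_EFinP/(mfY m).
  - exact/measurable_EFinP/(mfY n).
  - by move=> w _; rewrite lee_fin ndf.
congr (_ * _)%E; rewrite -monotone_convergence//=; last 3 first.
- by move=> n; exact/measurable_EFinP/(mfY n).
- by move=> n w _; rewrite lee_fin.
- by move=> w _ m n mn; rewrite lee_fin ndf.
by apply: eq_integral => w _; apply/cvg_lim => //; exact: fg.
Qed.

End weighted_integral.

(** * Product formula for independent families *)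

Section independence.
Context d (T : measurableType d) (R : realType) (P : probability T R).

(** The index is an arbitrary finite type because the independent pairs behind a U-statistic are
    indexed by a subset of ['I_N * 'I_N]. *)
Definition indep_family (I : finType) d1 (T1 : measurableType d1)
    (Y : I -> T -> T1) : Prop :=
  forall A : I -> set T1, (forall i, measurable (A i)) ->
    P [set w | forall i, A i (Y i w)] = (\prod_i P (Y i @^-1` A i))%E.

Lemma prod_indic (I : finType) (b : I -> bool) :
  \prod_i (b i)%:R = [forall i, b i]%:R :> R.
Proof.
have [/forallP h|/forallPn[i ni]] := boolP [forall i, b i].
  by rewrite big1// => i _; rewrite h.
by rewrite (bigD1 i)//= (negbTE ni) mul0r.
Qed.

Lemma measurable_forall (I : finType) (F : I -> set T) :
  (forall i, measurable (F i)) -> measurable [set w | forall i, F i w].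
Proof.
move=> mF; rewrite (_ : mkset _ = \big[setI/setT]_i F i).
  exact: bigsetI_measurable.
rewrite -bigcap_seq; apply/seteqP; split => w /= h i; first by move=> _; exact: h.
by apply: h; rewrite /= mem_index_enum.
Qed.

Lemma ge0_prod_fin_num (I : Type) (s : seq I) (Q : pred I) (F : I -> \bar R) :
  (forall i, F i \is a fin_num) ->
  (\prod_(i <- s | Q i) F i)%E \is a fin_num.
Proof. by move=> hF; elim/big_ind : _ => // x y; exact: fin_numM. Qed.

(** Induction on a list [J] containing every index whose factor is not known to be an indicator.
    With [J] empty this is the definition of independence; removing an index replaces its factor by
    an indicator, and [ge0_integral_weight] restores the general factor. *)
Lemma indep_integral_prod (I : finType) d1 (T1 : measurableType d1)
    (Y : I -> T -> T1) (g : I -> T1 -> R) :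
  (forall i, measurable_fun setT (Y i)) -> indep_family Y ->
  (forall i, measurable_fun setT (g i)) -> (forall i y, 0 <= g i y) ->
  (forall i, \int[P]_w (g i (Y i w))%:E \is a fin_num)%E ->
  (\int[P]_w (\prod_i g i (Y i w))%:E = \prod_i \int[P]_w (g i (Y i w))%:E)%E.
Proof.
move=> mY indY; move: g.
have mYi i B : measurable B -> measurable (Y i @^-1` B).
  by move=> mB; rewrite -[_ @^-1` _]setTI; exact: mY.
suff H (J : seq I) (g : I -> T1 -> R) :
    (forall i, i \notin J -> exists2 A, measurable A & g i = \1_A) ->
    (forall i, measurable_fun setT (g i)) -> (forall i y, 0 <= g i y) ->
    (forall i, \int[P]_w (g i (Y i w))%:E \is a fin_num)%E ->
    (\int[P]_w (\prod_i g i (Y i w))%:E = \prod_i \int[P]_w (g i (Y i w))%:E)%E.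
  by move=> g; apply: (H (enum I)) => i; rewrite mem_enum.
elim: J g => [|j J IHJ] g gJ mg g0 gfin.
  have /choice[A hA] : forall i, exists A, measurable A /\ g i = \1_A.
    by move=> i; have [A mA gA] := gJ i erefl; exists A.
  have mA i : measurable (A i) by have [] := hA i.
  have gA i : g i = \1_(A i) by have [] := hA i.
  rewrite (eq_integral (fun w => (\1_[set w | forall i, A i (Y i w)] w)%:E)); last first.
    move=> w _; congr EFin; under eq_bigr do rewrite gA indicE.
    rewrite prod_indic indicE; congr (_%:R); congr nat_of_bool.
    apply/forallP/idP => [h|]; last by rewrite inE => h i; apply/mem_set/h.
    by rewrite inE/= => i; apply/set_mem/h.
  rewrite integral_indic//; last first.
    by apply: (@measurable_forall _ (fun i => Y i @^-1` A i)) => i; exact: mYi.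
  rewrite setIT; apply: etrans (indY A mA) _; apply: eq_bigr => i _.
  rewrite gA (eq_integral (fun w => (\1_(Y i @^-1` A i) w)%:E))//.
  by rewrite integral_indic ?setIT//; exact: mYi.
pose c := (\prod_(i | i != j) \int[P]_w (g i (Y i w))%:E)%E.
have cfin : c \is a fin_num by exact: ge0_prod_fin_num.
have c0 : (0 <= c)%E.
  by apply: prode_ge0 => i _; apply: integral_ge0 => w _; rewrite lee_fin.
pose W w := \prod_(i | i != j) g i (Y i w).
rewrite [RHS](bigD1 j)//= -/c.
rewrite (eq_integral (fun w => (W w * g j (Y j w))%:E)%E); last first.
  by move=> w _; rewrite (bigD1 j)//= mulrC.
rewrite muleC -(fineK cfin); apply: ge0_integral_weight => //.
- rewrite (_ : W = fun w => \prod_i (if i != j then g i (Y i w) else 1)).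
    by apply: measurable_prod => i _; case: (i != j) => //; exact: measurableT_comp.
  by apply/funext => w; rewrite /W big_mkcond.
- by move=> w; apply: prodr_ge0.
move=> B mB; rewrite fineK//.
pose g' i := if i == j then \1_B else g i : T1 -> R.
have g'j : g' j = \1_B by rewrite /g' eqxx.
have g'i i : i != j -> g' i = g i by rewrite /g' => /negbTE ->.
have intB : (\int[P]_w (\1_B (Y j w))%:E = P (Y j @^-1` B))%E.
  rewrite (eq_integral (fun w => (\1_(Y j @^-1` B) w)%:E))//.
  by rewrite integral_indic ?setIT//; exact: mYi.
have := IHJ g'; rewrite [X in _ -> _ -> _ -> _ -> _ = X](bigD1 j)//= g'j intB.
rewrite [X in (_ * X)%E](_ : _ = c); last first.
  by apply: eq_bigr => i ij; rewrite g'i.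
rewrite muleC => <-.
- apply: eq_integral => w _; rewrite [in RHS](bigD1 j)//= g'j mulrC; congr (_ * _)%:E.
  by apply: eq_bigr => i ij; rewrite g'i.
- move=> i iJ; have [->|ij] := eqVneq i j; first by exists B.
  by rewrite g'i//; apply: gJ; rewrite inE negb_or ij.
- move=> i; have [->|ij] := eqVneq i j; last by rewrite g'i.
  by rewrite g'j; exact: measurable_indic.
- by move=> i y; have [->|ij] := eqVneq i j; [rewrite g'j|rewrite g'i].
- move=> i; have [->|ij] := eqVneq i j; last by rewrite g'i.
  by rewrite g'j intB; apply: fin_num_measure; exact: mYi.
Qed.

End independence.

(** Measurable rectangles are stable under intersection and generate the product sigma-algebra. *)
Lemma measure_unique_setX d1 d2 (T1 : measurableType d1) (T2 : measurableType d2)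
    (R : realType) (m1 m2 : {measure set (T1 * T2) -> \bar R}) :
  (m1 setT < +oo)%E ->
  (forall A B, measurable A -> measurable B -> m1 (A `*` B) = m2 (A `*` B)) ->
  forall X, measurable X -> m1 X = m2 X.
Proof.
move=> m1fin m12 X mX.
pose C : set (set (T1 * T2)) :=
  [set C | exists A, measurable A /\ exists B, measurable B /\ C = A `*` B].
have CI : setI_closed C.
  move=> /= _ _ [X1 [mX1 [X2 [mX2 ->]]]] [Y1 [mY1 [Y2 [mY2 ->]]]].
  rewrite -setXI; exists (X1 `&` Y1); split; first exact: measurableI.
  by exists (X2 `&` Y2); split => //; exact: measurableI.
apply: (measure_unique C (fun=> setT)) => //.
- rewrite measurable_prod_measurableType //; congr (<<s _ >>).
  rewrite predeqE; split => [[A mA [B mB <-]]|[A [mA [B [mB ->]]]]].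
    by exists A; split => //; exists B.
  by exists A => //; exists B.
- by move=> n; exists setT; split => //; exists setT; split => //; rewrite setXTT.
- by apply/seteqP; split => // x _; exists 0%N.
- by move=> A [A1 [mA1 [A2 [mA2 ->]]]]; exact: m12.
Qed.

(** * Disjoint pairs of independent variables *)

Section pairs.
Context d (T : measurableType d) (R : realType) (P : probability T R).
Context d1 (T1 : measurableType d1) (I J : finType).
Variables (Y : I -> T -> T1) (a b : J -> I).
Hypotheses (ia : injective a) (ib : injective b) (ab : forall j k, a j != b k).
Hypotheses (mY : forall i, measurable_fun setT (Y i)) (indY : indep_family P Y).

Let mYi i B : measurable B -> measurable (Y i @^-1` B).
Proof. by move=> mB; rewrite -[_ @^-1` _]setTI; exact: mY. Qed.

Lemma indep_disjoint_setX (A B : J -> set T1) :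
  (forall j, measurable (A j)) -> (forall j, measurable (B j)) ->
  P [set w | forall j, (A j `*` B j) (Y (a j) w, Y (b j) w)] =
  (\prod_j (P (Y (a j) @^-1` A j) * P (Y (b j) @^-1` B j)))%E.
Proof.
move=> mA mB.
(* [D i] is the side of the rectangle that index [i] serves, if any, and the whole space for an
   index that occurs in no pair; injectivity and disjointness make the choice unambiguous. *)
pose D i := if [pick j | a j == i] is Some j then A j else
  if [pick j | b j == i] is Some j then B j else setT.
have Da j : D (a j) = A j.
  rewrite /D; case: pickP => [k /eqP/ia->//|/(_ j)]; by rewrite eqxx.
have Db j : D (b j) = B j.
  rewrite /D; case: pickP => [k akb|_]; first by have := ab k j; rewrite akb.
  by case: pickP => [k /eqP/ib->//|/(_ j)]; rewrite eqxx.
have Dn i : i \notin a @: [set: J]%SET -> i \notin b @: [set: J]%SET -> D i = setT.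
  move=> ni nj; rewrite /D; case: pickP => [k /eqP ak|_].
    by move: ni; rewrite -ak imset_f ?inE.
  case: pickP => // k /eqP bk.
  by move: nj; rewrite -bk imset_f ?inE.
rewrite (_ : mkset _ = [set w | forall i, D i (Y i w)]); last first.
  apply/seteqP; split => w /= h.
    move=> i; have [/imsetP[j _ ->]|ni] := boolP (i \in a @: [set: J]%SET).
      by rewrite Da; have [] := h j.
    have [/imsetP[j _ ->]|nj] := boolP (i \in b @: [set: J]%SET).
      by rewrite Db; have [] := h j.
    by rewrite Dn.
  by move=> j; split => /=; [rewrite -Da|rewrite -Db]; exact: h.
have mD i : measurable (D i).
  by rewrite /D; case: pickP => [? _|_]; [exact: mA|case: pickP => [? _|_] //; exact: mB].
rewrite (indY mD) big_split/= (bigID (mem (a @: [set: J]%SET)))/=; congr (_ * _)%E.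
  rewrite big_imset/=; last by move=> j k _ _; exact: ia.
  by apply: eq_big => [j|j _]; rewrite ?inE ?Da.
rewrite (bigID (mem (b @: [set: J]%SET)))/= [X in (_ * X)%E]big1 ?mule1; last first.
  by move=> i /andP[ni nj]; rewrite Dn// preimage_setT probability_setT.
rewrite (eq_bigl (mem (b @: [set: J]%SET))) => [|i]; last first.
  rewrite andb_idl// => /imsetP[j _ ->].
  by apply/negP => /imsetP[k _ /esym/eqP]; rewrite (negbTE (ab k j)).
rewrite big_imset/=; last by move=> j k _ _; exact: ib.
by apply: eq_big => [j|j _]; rewrite ?inE ?Db.
Qed.

Let V j w := (Y (a j) w, Y (b j) w).

Lemma measurable_disjoint_pair j : measurable_fun setT (V j).
Proof. exact: measurable_fun_pair. Qed.

(** Rectangles are upgraded to arbitrary measurable sets one pair at a time, [s] listing the pairs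
    still allowed to be arbitrary. With the other sets fixed, both sides are finite measures of
    [C j0] that agree on rectangles by induction: one is the law of the pair restricted to the other
    events, the other is that law scaled by their product. *)
Lemma indep_disjoint_pairs : indep_family P V.
Proof.
have mV j C : measurable C -> measurable (V j @^-1` C).
  by move=> mC; rewrite -[_ @^-1` _]setTI; exact: measurable_disjoint_pair.
suff H (s : seq J) (C : J -> set (T1 * T1)) :
    (forall j, j \notin s -> exists A B, [/\ measurable A, measurable B & C j = A `*` B]) ->
    (forall j, measurable (C j)) ->
    P [set w | forall j, C j (V j w)] = (\prod_j P (V j @^-1` C j))%E.
  by move=> C mC; apply: (H (enum J)) => // j; rewrite mem_enum.
elim: s C => [|j0 s IH] C CX mC.
  have /choice[A] : forall j, exists A, exists B, [/\ measurable A, measurable B & C j = A `*` B].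
    by move=> j; exact: CX.
  move=> /choice[B] AB.
  have mA j : measurable (A j) by have [] := AB j.
  have mB j : measurable (B j) by have [] := AB j.
  have CE : C = fun j => A j `*` B j by apply/funext => j; have [] := AB j.
  rewrite CE (indep_disjoint_setX mA mB); apply: eq_bigr => j _.
  have := @indep_disjoint_setX (fun l => if l == j then A l else setT)
    (fun l => if l == j then B l else setT).
  rewrite [in RHS](bigD1 j)//= eqxx big1 ?mule1; last first.
    by move=> l /negbTE ->; rewrite !preimage_setT probability_setT mule1.
  move=> <- => [|l|l]; last 2 first.
  - by case: ifP.
  - by case: ifP.
  congr (P _); apply/seteqP; split => w /=.
    by move=> /(_ j); rewrite eqxx.
  by move=> h l; case: eqP => [->|].
pose E := [set w | forall j, j != j0 -> C j (V j w)].
have mE : measurable E.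
  rewrite (_ : E = [set w | forall j, (if j != j0 then C j else setT) (V j w)]).
    apply: (@measurable_forall _ _ _ (fun j => V j @^-1` (if j != j0 then C j else setT))) => j.
    by apply: mV; case: ifP.
  apply/seteqP; split => w /= h j; have := h j; first by case: ifP => // _; exact.
  by move=> + jj0; rewrite jj0.
pose k := (\prod_(j | j != j0) P (V j @^-1` C j))%E.
have kfin : k \is a fin_num by apply: ge0_prod_fin_num => j; apply: fin_num_measure; exact: mV.
have k0 : (0 <= k)%E by apply: prode_ge0.
have k0' : 0 <= fine k by exact: fine_ge0.
pose m1' : {measure set (T1 * T1) -> \bar R} := pushforward (mrestr P mE) (V j0).
pose m2' : {measure set (T1 * T1) -> \bar R} := mscale (NngNum k0') (pushforward P (V j0)).
pose m1 := m1' (measurable_disjoint_pair j0).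
pose m2 := m2' (measurable_disjoint_pair j0).
have split_j0 (C' : J -> set (T1 * T1)) :
    (forall j, j != j0 -> C' j = C j) ->
    m1 (C' j0) = P [set w | forall j, C' j (V j w)].
  move=> C'C; rewrite /m1/= /pushforward/= /mrestr; congr (P _).
  apply/seteqP; split => w /=.
    move=> [h h'] j; have [->//|jj0] := eqVneq j j0.
    by rewrite C'C//; exact: h'.
  by move=> h; split => [|j jj0]; [exact: h|rewrite -C'C].
rewrite -split_j0// (bigD1 j0)//= -/k muleC.
transitivity (m2 (C j0)); last by rewrite /m2/= /mscale/= fineK.
apply: (measure_unique_setX (m1 := m1) (m2 := m2)) => //.
  apply: (@le_lt_trans _ _ 1%E); last exact: ltry.
  by apply: probability_le1; apply: measurableI => //; exact: (mV j0 setT).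
move=> A B mA mB.
pose C' j := if j == j0 then A `*` B else C j.
have C'j : C' j0 = A `*` B by rewrite /C' eqxx.
have C'i j : j != j0 -> C' j = C j by rewrite /C' => /negbTE ->.
rewrite -{1}C'j split_j0// IH.
- rewrite (bigD1 j0)//= C'j /m2/= /mscale/= fineK// muleC; congr (_ * _)%E.
  by apply: eq_bigr => j jj0; rewrite C'i.
- move=> j js; have [->|jj0] := eqVneq j j0; first by exists A, B.
  by rewrite C'i//; apply: CX; rewrite inE negb_or jj0.
- move=> j; have [->|jj0] := eqVneq j j0; last by rewrite C'i.
  by rewrite C'j; exact: measurableX.
Qed.

End pairs.

(** * Elementary bounds on the exponential *)

Section exp_inequalities.
Context {R : realType}.
Implicit Types x a : R.

(** From [expR x <= 1 / (1 - x)], since [(1 + x + 2 x^2) (1 - x) = 1 + x^2 (1 - 2 x) >= 1]. *)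
Lemma expR_le_quadratic x : x <= 2^-1 -> expR x <= 1 + x + 2 * x ^+ 2.
Proof.
move=> x2; have h := expR_ge1Dx (- x).
have e0 := expR_gt0 x.
have : expR x * (1 - x) <= 1.
  by rewrite -[leRHS](expRxMexpNx_1 x) ler_wpM2l// ltW.
move=> e1; have x1 : 0 < 1 - x by lra.
rewrite -(ler_pM2r x1) (le_trans e1)//.
have : 0 <= x ^+ 2 * (1 - 2 * x) by rewrite mulr_ge0 ?sqr_ge0//; lra.
lra.
Qed.

(** The remainder after the linear term is at most [(a x)^2 * expR (a x)]. As [a <= 1 / 2], one half
    of [expR x] absorbs [expR (a x)] and the other absorbs [x^2 <= 16 * expR (x / 2)]; the factor
    [a^2] is what a Chernoff bound needs. *)
Lemma expR_scale_le a x : 0 <= a <= 2^-1 -> 0 <= x ->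
  expR (a * x) <= 1 + a * x + 16 * a ^+ 2 * expR x.
Proof.
move=> /andP[a0 a2] x0; set t := a * x.
have t0 : 0 <= t by rewrite mulr_ge0.
have et : expR t <= 1 + t + t ^+ 2 * expR t.
  have e0 := expR_gt0 t.
  have [t1|t1] := leP 1 t.
    have : expR t <= t ^+ 2 * expR t.
      by rewrite ler_peMl ?(ltW e0)// -(expr1n _ 2) ler_sqr ?nnegrE.
    lra.
  have := expR_ge1Dx (- t) => h.
  have : expR t * (1 - t) <= 1.
    by rewrite -[leRHS](expRxMexpNx_1 t) ler_wpM2l// ltW.
  move=> h1; have : expR t * (1 - t) * (1 + t) <= 1 * (1 + t).
    by rewrite ler_wpM2r//; lra.
  lra.
suff key : x ^+ 2 * expR t <= 16 * expR x.
  apply: (le_trans et); rewrite lerD2l.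
  have -> : t ^+ 2 * expR t = a ^+ 2 * (x ^+ 2 * expR t) by rewrite /t; ring.
  by rewrite [leRHS]mulrAC mulrC ler_wpM2r ?sqr_ge0.
have x4 : 0 <= x / 4 by lra.
have e4 : x / 4 <= expR (x / 4) by have := expR_ge1Dx (x / 4); lra.
have e2 : (x / 4) ^+ 2 <= expR (x / 2).
  have -> : expR (x / 2) = expR (x / 4) ^+ 2.
    by rewrite expr2 -expRD; congr expR; lra.
  by rewrite ler_sqr// nnegrE expR_ge0.
have ta : expR t <= expR (x / 2).
  by rewrite ler_expR /t mulrC ler_wpM2l.
apply: (@le_trans _ _ (expR (x / 2) * x ^+ 2)); first by rewrite mulrC ler_wpM2r ?sqr_ge0.
rewrite (_ : expR x = expR (x / 2) * expR (x / 2)); last first.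
  by rewrite -expRD; congr expR; lra.
rewrite [leRHS]mulrCA ler_wpM2l ?expR_ge0//.
move: e2; lra.
Qed.

End exp_inequalities.

(** * Exponential moments and Chernoff bounds *)

Section exponential_moments.
Context d (T : measurableType d) (R : realType) (P : probability T R).
Implicit Types (S g z : T -> R).

Lemma exp_markov S (c t : R) : measurable_fun setT S ->
  (\int[P]_w (expR (S w))%:E <= (expR c)%:E)%E ->
  (P [set w | (t <= S w)%R] <= (expR (c - t))%:E)%E.
Proof.
move=> mS Sc.
have mE : measurable_fun setT (fun w => (expR (S w))%:E).
  by apply/measurable_EFinP; exact: measurableT_comp.
have := @le_integral_abse _ _ _ P setT measurableT _ (expR t) mE (expR_gt0 t).
under [X in (_ <= X)%E -> _]eq_integral do rewrite gee0_abs ?lee_fin ?expR_ge0//.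
move=> /le_trans/(_ Sc); rewrite setTI.
rewrite (_ : [set x | _] = [set w | (t <= S w)%R]); last first.
  by apply/seteqP; split => w /=; rewrite lee_fin ger0_norm ?expR_ge0// ler_expR.
rewrite -lee_pdivlMl ?expR_gt0// => h.
by rewrite addrC expRD expRN EFinM.
Qed.

Lemma exp_avg_le (N : nat) (S : 'I_N.+1 -> T -> R) (c : R) :
  (forall m, measurable_fun setT (S m)) ->
  (forall m, \int[P]_w (expR (S m w))%:E <= (expR c)%:E)%E ->
  (\int[P]_w (expR (N.+1%:R^-1 * \sum_m S m w))%:E <= (expR c)%:E)%E.
Proof.
move=> mS Sc.
have mE m : measurable_fun setT (fun w => (N.+1%:R^-1 * expR (S m w))%:E).
  apply/measurable_EFinP; apply: measurable_funM => //; exact: measurableT_comp.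
apply: (@le_trans _ _ (\int[P]_w (\sum_m (N.+1%:R^-1 * expR (S m w))%:E))%E).
  apply: ge0_le_integral => //.
  - apply/measurable_EFinP; apply: measurableT_comp => //.
    by apply: measurable_funM => //; exact: measurable_sum.
  - by apply: emeasurable_sum.
  move=> w _; rewrite sumEFin lee_fin -mulr_sumr.
  set a := _ * _.
  have N0 : 0 < N.+1%:R :> R by rewrite ltr0n.
  rewrite -(ler_pM2l N0) mulVKf ?gt_eqF//.
  (* Jensen's inequality through the tangent to [expR] at the average [a]: the linear corrections
     sum to zero. *)
  apply: (@le_trans _ _ (\sum_m (expR a * (1 + (S m w - a))))); last first.
    apply: ler_sum => m _; have -> : expR (S m w) = expR a * expR (S m w - a).
      by rewrite -expRD addrC subrK.
    by rewrite ler_wpM2l ?expR_ge0//; exact: expR_ge1Dx.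
  rewrite -mulr_sumr big_split/= sumrB !sumr_const card_ord -mulr_natl.
  rewrite -[a *+ _]mulr_natl mulVKf ?gt_eqF// subrr addr0 mulr1.
  by rewrite mulrC.
rewrite ge0_integral_sum//.
have N0 : 0 <= N.+1%:R^-1 :> R by rewrite invr_ge0.
apply: (@le_trans _ _ (\sum_(m < N.+1) (N.+1%:R^-1 * expR c)%:E)%E).
  apply: lee_sum => m _; under eq_integral do rewrite EFinM.
  rewrite ge0_integralZl//; first by rewrite [leRHS]EFinM lee_wpmul2l.
  by apply/measurable_EFinP; exact: measurableT_comp.
by rewrite sumEFin lee_fin sumr_const card_ord -[leLHS]mulr_natl mulrA mulfV ?mul1r// pnatr_eq0.
Qed.

Lemma indep_exp_sum (I : finType) d1 (T1 : measurableType d1)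
    (Y : I -> T -> T1) (f : I -> T1 -> R) (c : I -> R) :
  (forall i, measurable_fun setT (Y i)) -> indep_family P Y ->
  (forall i, measurable_fun setT (f i)) ->
  (forall i, \int[P]_w (expR (f i (Y i w)))%:E <= (expR (c i))%:E)%E ->
  (\int[P]_w (expR (\sum_i f i (Y i w)))%:E <= (expR (\sum_i c i))%:E)%E.
Proof.
move=> mY iY mf fc.
have i0 i : (0 <= \int[P]_w (expR (f i (Y i w)))%:E)%E.
  by apply: integral_ge0 => w _; rewrite lee_fin expR_ge0.
under eq_integral do rewrite expR_sum.
rewrite (@indep_integral_prod _ _ _ P _ _ _ _ (fun i y => expR (f i y)))//; last 2 first.
- by move=> i; exact: measurableT_comp.
- by move=> i; rewrite ge0_fin_numE// (le_lt_trans (fc i))// ltry.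
rewrite expR_sum -prodEFin.
suff : (0 <= \prod_i \int[P]_w (expR (f i (Y i w)))%:E <= \prod_i (expR (c i))%:E)%E.
  by case/andP.
apply: (big_ind2 (fun x y => 0 <= x <= y)%E); first by rewrite lexx lee01.
  move=> x1 x2 y1 y2 /andP[x10 x12] /andP[y10 y12].
  by rewrite mule_ge0//= lee_pmul.
by move=> i _; rewrite i0 fc.
Qed.

(** The nonnegative [f1] stands for a term subtracted from the bound on [expR S]; moving it to the
    other side leaves only nonnegative integrands. The exponential form of the result is
    [b - a <= expR (b - a - 1)]. *)
Lemma exp_moment_le S (f1 f2 : T -> R) (a b c : R) : measurable_fun setT S ->
  measurable_fun setT f1 -> measurable_fun setT f2 ->
  (forall w, 0 <= f1 w) -> (forall w, expR (S w) + f1 w <= f2 w) ->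
  (\int[P]_w (f1 w)%:E = a%:E)%E -> (\int[P]_w (f2 w)%:E <= b%:E)%E ->
  (\int[P]_w (expR (S w + c))%:E <= (expR (c + (b - a - 1)))%:E)%E.
Proof.
move=> mS mf1 mf2 f10 Sf f1a f2b.
have mE : measurable_fun setT (fun w => (expR (S w))%:E).
  by apply/measurable_EFinP; exact: measurableT_comp.
have h : ((\int[P]_w (expR (S w))%:E) + a%:E <= b%:E)%E.
  rewrite -f1a -ge0_integralD//; last 2 first.
  - by move=> w _; rewrite lee_fin.
  - exact/measurable_EFinP.
  apply: le_trans f2b; apply: ge0_le_integral => //.
  - by move=> w _; rewrite adde_ge0// lee_fin.
  - by apply: emeasurable_funD => //; exact/measurable_EFinP.
  - exact/measurable_EFinP.
  - by move=> w _; rewrite -EFinD lee_fin.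
have h2 : (\int[P]_w (expR (S w))%:E <= b%:E - a%:E)%E by rewrite leeBrDr.
under eq_integral do rewrite addrC expRD EFinM.
rewrite ge0_integralZl//.
rewrite expRD EFinM lee_pmul2l ?lte_fin ?expR_gt0// (le_trans h2)//.
by rewrite -EFinB lee_fin; have := expR_ge1Dx (b - a - 1); lra.
Qed.

(** The exponent [- lam * z ^ 2] is never positive, so the quadratic bound on [expR] holds for all
    [lam >= 0] and a fourth moment suffices. *)
Lemma exp_lower_moment z (m v lam : R) : measurable_fun setT z -> 0 <= lam ->
  (\int[P]_w (z w ^+ 2)%:E = m%:E)%E -> (\int[P]_w (z w ^+ 4)%:E <= v%:E)%E ->
  (\int[P]_w (expR (lam * (m - z w ^+ 2)))%:E <= (expR (2 * lam ^+ 2 * v))%:E)%E.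
Proof.
move=> mz lam0 zm zv.
have mz2 : measurable_fun setT (fun w => lam * z w ^+ 2).
  by apply: measurable_funM => //; exact: measurable_funX.
have mz4 : measurable_fun setT (fun w => 2 * lam ^+ 2 * z w ^+ 4).
  by apply: measurable_funM => //; exact: measurable_funX.
rewrite (eq_integral (fun w => (expR (- (lam * z w ^+ 2) + lam * m))%:E)); last first.
  by move=> w _; congr (expR _)%:E; ring.
rewrite (_ : 2 * lam ^+ 2 * v = lam * m + (1 + 2 * lam ^+ 2 * v - lam * m - 1)); last by ring.
apply: (@exp_moment_le _ (fun w => lam * z w ^+ 2)
  (fun w => 1 + 2 * lam ^+ 2 * z w ^+ 4)) => //.
- exact: measurableT_comp.
- exact: measurable_funD.
- by move=> w; rewrite mulr_ge0// sqr_ge0.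
- move=> w; rewrite -lerBrDr.
  have /expR_le_quadratic : - (lam * z w ^+ 2) <= 2^-1.
    have : 0 <= lam * z w ^+ 2 by rewrite mulr_ge0// sqr_ge0.
    lra.
  move/le_trans; apply; rewrite sqrrN exprMn -exprM; lra.
- under eq_integral do rewrite EFinM.
  rewrite ge0_integralZl//; last 2 first.
  + by apply/measurable_EFinP; exact: measurable_funX.
  + by move=> w _; rewrite lee_fin sqr_ge0.
  by rewrite zm.
- under eq_integral do rewrite EFinD.
  have c0 : 0 <= 2 * lam ^+ 2 by rewrite mulr_ge0// sqr_ge0.
  have z40 w : 0 <= z w ^+ 4 by rewrite (_ : 4 = 2 * 2)%N// exprM sqr_ge0.
  rewrite ge0_integralD//; last 2 first.
  + by move=> w _; rewrite lee_fin mulr_ge0.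
  + exact/measurable_EFinP.
  rewrite integral_cst//= probability_setT mule1 EFinD leeD2l//.
  under eq_integral do rewrite EFinM.
  rewrite ge0_integralZl//; last 2 first.
  + by apply/measurable_EFinP; exact: measurable_funX.
  + by move=> w _; rewrite lee_fin.
  by rewrite [leRHS]EFinM lee_wpmul2l.
Qed.

(** Apply [expR_scale_le] with [a = lam / lam0] and [x = lam0 * z ^ 2]; the constant is
    [32 = 16 * 2], the [2] bounding the exponential moment at [lam0]. *)
Lemma exp_upper_moment z (m lam lam0 : R) : measurable_fun setT z -> 0 < lam0 ->
  0 <= lam <= lam0 / 2 ->
  (\int[P]_w (z w ^+ 2)%:E = m%:E)%E -> (\int[P]_w (expR (lam0 * z w ^+ 2))%:E <= 2%:E)%E ->
  (\int[P]_w (expR (lam * (z w ^+ 2 - m)))%:E <= (expR (32 * (lam / lam0) ^+ 2))%:E)%E.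
Proof.
move=> mz l0 /andP[lam0_ge0 laml0] zm z2.
have mz2 k : measurable_fun setT (fun w => k * z w ^+ 2).
  by apply: measurable_funM => //; exact: measurable_funX.
have mE : measurable_fun setT (fun w => expR (lam0 * z w ^+ 2)) by exact: measurableT_comp.
have a0 : 0 <= 16 * (lam / lam0) ^+ 2 by rewrite mulr_ge0// sqr_ge0.
rewrite (eq_integral (fun w => (expR (lam * z w ^+ 2 + - (lam * m)))%:E)); last first.
  by move=> w _; congr (expR _)%:E; ring.
rewrite (_ : 32 * (lam / lam0) ^+ 2 = - (lam * m) +
    (1 + lam * m + 16 * (lam / lam0) ^+ 2 * 2 - 0 - 1)); last by ring.
apply: (@exp_moment_le _ (cst 0) (fun w => 1 + lam * z w ^+ 2 +
  16 * (lam / lam0) ^+ 2 * expR (lam0 * z w ^+ 2))) => //.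
- by apply: measurable_funD; [exact: measurable_funD|exact: measurable_funM].
- move=> w; rewrite addr0.
  have := @expR_scale_le R (lam / lam0) (lam0 * z w ^+ 2).
  rewrite mulrA divfK ?gt_eqF//; apply.
    by rewrite divr_ge0 ?(ltW l0)//= ler_pdivrMr// mulrC.
  by rewrite mulr_ge0 ?sqr_ge0// ltW.
- by rewrite integral0.
have z20 w : 0 <= lam * z w ^+ 2 by rewrite mulr_ge0// sqr_ge0.
under eq_integral do rewrite !EFinD.
rewrite ge0_integralD//; last 4 first.
- by move=> w _; rewrite adde_ge0// lee_fin.
- by apply: emeasurable_funD => //; exact/measurable_EFinP.
- by move=> w _; rewrite lee_fin mulr_ge0// expR_ge0.
- by apply/measurable_EFinP; exact: measurable_funM.
rewrite ge0_integralD//; last 2 first.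
- by move=> w _; rewrite lee_fin.
- exact/measurable_EFinP.
rewrite integral_cst//= probability_setT mule1 !EFinD; apply: leeD.
  rewrite leeD2l//; under eq_integral do rewrite EFinM.
  rewrite ge0_integralZl//; last 2 first.
  + by apply/measurable_EFinP; exact: measurable_funX.
  + by move=> w _; rewrite lee_fin sqr_ge0.
  by rewrite zm.
under eq_integral do rewrite EFinM.
rewrite ge0_integralZl//; last exact/measurable_EFinP.
by rewrite [leRHS]EFinM lee_wpmul2l.
Qed.

(** Since [|g - mu| <= 2], the condition [t <= 1 / 4] keeps the exponent below [1 / 2], and the
    quadratic remainder is at most [2 * t ^ 2 * 4]. *)
Lemma exp_bounded_moment g (mu t : R) : measurable_fun setT g ->
  (forall w, `|g w| <= 1) -> (\int[P]_w (1 + g w)%:E = (1 + mu)%:E)%E ->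
  0 <= t <= 4^-1 ->
  (\int[P]_w (expR (t * (g w - mu)))%:E <= (expR (8 * t ^+ 2))%:E)%E.
Proof.
move=> mg g1 gmu /andP[t0 t4].
have g0 w : 0 <= 1 + g w by have := g1 w; rewrite ler_norml; lra.
have m1g : measurable_fun setT (fun w => 1 + g w) by exact: measurable_funD.
have mu0 : 0 <= 1 + mu.
  by rewrite -lee_fin -gmu; apply: integral_ge0 => w _; rewrite lee_fin.
have mu2 : mu <= 1.
  suff : 1 + mu <= 2 by lra.
  rewrite -lee_fin -gmu -[leRHS]mule1 -(probability_setT P) -integral_cst//.
  apply: ge0_le_integral => //.
  - by move=> w _; rewrite lee_fin.
  - exact/measurable_EFinP.
  - by move=> w _; rewrite lee_fin; have := g1 w; rewrite ler_norml; lra.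
have mtg : measurable_fun setT (fun w => t * (1 + g w)) by exact: measurable_funM.
rewrite (eq_integral (fun w => (expR (t * (g w - mu) + 0))%:E)); last first.
  by move=> w _; rewrite addr0.
rewrite (_ : 8 * t ^+ 2 = 0 + (t * (1 + mu) + (1 + 8 * t ^+ 2) - t * (1 + mu) - 1)); last by ring.
apply: (@exp_moment_le _ (cst (t * (1 + mu)))
  (fun w => t * (1 + g w) + (1 + 8 * t ^+ 2))) => //.
- by apply: measurable_funM => //; exact: measurable_funB.
- exact: measurable_funD.
- by move=> w; rewrite mulr_ge0.
- move=> w; have := g1 w; rewrite ler_norml => /andP[gl gu].
  have q : (g w - mu) ^+ 2 <= 4.
    have : 0 <= (2 - (g w - mu)) * (2 + (g w - mu)) by rewrite mulr_ge0//; lra.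
    lra.
  have /expR_le_quadratic : t * (g w - mu) <= 2^-1.
    have : t * (g w - mu) <= t * 2 by rewrite ler_wpM2l//; lra.
    lra.
  have : t ^+ 2 * (g w - mu) ^+ 2 <= t ^+ 2 * 4 by rewrite ler_wpM2l// sqr_ge0.
  rewrite exprMn /=; lra.
- by rewrite (eq_integral (cst (t * (1 + mu))%:E))// integral_cst//= probability_setT mule1.
under eq_integral do rewrite EFinD.
have c0 : 0 <= 1 + 8 * t ^+ 2 by rewrite addr_ge0// mulr_ge0// sqr_ge0.
rewrite ge0_integralD//; last 2 first.
- by move=> w _; rewrite lee_fin mulr_ge0.
- exact/measurable_EFinP.
rewrite integral_cst//= probability_setT mule1 [leRHS]EFinD leeD2r//.
under eq_integral do rewrite EFinM.
rewrite ge0_integralZl//; last 2 first.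
- exact/measurable_EFinP.
- by move=> w _; rewrite lee_fin.
by rewrite gmu.
Qed.

End exponential_moments.

(** * Moments of subgaussian variables *)

Section subgaussian.
Context d (T : measurableType d) (R : realType) (P : probability T R).
Implicit Types z : T -> R.

Lemma psi2norm_moment z (K : R) (m : nat) : measurable_fun setT z -> 0 <= K ->
  (psi2norm P z <= K%:E)%E -> (0 < m)%N ->
  (\int[P]_w (z w ^+ (2 * m))%:E <= ((2 * m)%:R ^+ m * K ^+ (2 * m))%:E)%E.
Proof.
move=> mz K0 zK m0; set q : R := (2 * m)%:R.
have q1 : 1 <= q by rewrite ler1n muln_gt0.
have q0 : 0 < q by lra.
have : ((q `^ (- 2^-1))%:E * 'N[P]_(q%:E)[EFin \o z] <= K%:E)%E.
  by apply: le_trans zK; apply: ereal_sup_ubound; exists q.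
have qi : 0 < q `^ (- 2^-1) by exact: powR_gt0.
rewrite -[q `^ (- 2^-1)]invrK -powRN opprK lee_pdivrMl ?powR_gt0// -EFinM => h.
have hint : (\int[P]_w (z w ^+ (2 * m))%:E = 'N[P]_(q%:E)[EFin \o z] `^ q)%E.
  rewrite poweR_Lnorm ?gt_eqF//; apply: eq_integral => w _ /=.
  rewrite /q powR_mulrn// -normrX ger0_norm//.
  by rewrite mulnC exprM sqr_ge0.
rewrite hint.
have N0 := Lnorm_ge0 P q%:E (EFin \o z).
have inN : ('N[P]_q%:E[EFin \o z] \in `[0%E, +oo%E])%E by rewrite in_itv/= leey N0.
have inK : ((q `^ 2^-1 * K)%:E \in `[0%E, +oo%E])%E.
  by rewrite in_itv/= leey lee_fin mulr_ge0// powR_ge0.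
have := @gt0_ler_poweR R q (ltW q0) _ _ inN inK h.
move/le_trans; apply; rewrite poweR_EFin lee_fin powRM ?powR_ge0// -powRrM.
rewrite (_ : 2^-1 * q = m%:R); last by rewrite /q natrM mulrA mulVf ?mul1r.
by rewrite powR_mulrn ?(ltW q0)// [K `^ _]powR_mulrn.
Qed.

(** A single term of the exponential series at [n] is at most its sum. *)
Lemma pow_le_fact_expR (n : nat) : n%:R ^+ n <= expR 1 ^+ n * n`!%:R :> R.
Proof.
rewrite -expRM_natr mul1r; case: n => [|n]; first by rewrite expr0 expR0 mul1r.
have := @expR_ge1Dxn R n.+1%:R n (ler0n _ _).
rewrite -ler_pdivrMr ?ltr0n ?fact_gt0//; lra.
Qed.

(** Integrate the exponential series term by term. The moment bound and [m ^ m <= e ^ m * m!] make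
    the [m]-th term at most [(2 * e * lam * K ^ 2) ^ m]; the factor 4 in [lam] turns this into
    [2 ^ - m], a series of sum 2. *)
Lemma subgaussian_square_exp z (K : R) : measurable_fun setT z -> 0 < K ->
  (psi2norm P z <= K%:E)%E ->
  (\int[P]_w (expR ((4 * expR 1 * K ^+ 2)^-1 * z w ^+ 2))%:E <= 2%:E)%E.
Proof.
move=> mz K0 zK; set lam := _^-1.
have e0 : 0 < expR 1 :> R := expR_gt0 _.
have lam0 : 0 < lam by rewrite invr_gt0 !mulr_gt0// exprn_gt0.
pose u n w := series (exp_coeff (lam * z w ^+ 2)) n.
have y0 w : 0 <= lam * z w ^+ 2 by rewrite mulr_ge0 ?sqr_ge0// ltW.
have t0 k w : 0 <= exp_coeff (lam * z w ^+ 2) k by exact: exp_coeff_ge0.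
have mt k : measurable_fun setT (fun w => exp_coeff (lam * z w ^+ 2) k).
  rewrite /exp_coeff/=; apply: measurable_funM => //.
  by apply: measurable_funX; apply: measurable_funM => //; exact: measurable_funX.
have uE n w : u n w = \sum_(0 <= k < n) exp_coeff (lam * z w ^+ 2) k by [].
have u0 n w : 0 <= u n w by rewrite uE; apply: sumr_ge0.
have mu n : measurable_fun setT (u n) by apply: measurable_sum.
have undec w : {homo (fun n => u n w) : m n / (m <= n)%N >-> m <= n}.
  move=> m n mn; rewrite !uE (big_cat_nat _ mn)//=.
  by rewrite lerDl; apply: sumr_ge0.
rewrite (eq_integral (fun w => limn (fun n => (u n w)%:E))); last first.
  move=> w _; apply/esym/cvg_lim => //; apply: cvg_EFin; first exact: nearW.
  exact: is_cvg_series_exp_coeff.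
rewrite monotone_convergence//; last 3 first.
- by move=> n; exact/measurable_EFinP.
- by move=> n w _; rewrite lee_fin.
- by move=> w _ m n mn; rewrite lee_fin undec.
have term k : (\int[P]_w (exp_coeff (lam * z w ^+ 2) k)%:E <= ((2^-1) ^+ k)%:E)%E.
  case: k => [|k].
    rewrite (eq_integral (cst 1%:E)); last first.
      by move=> w _; rewrite /exp_coeff/= fact0 divr1.
    by rewrite integral_cst//= probability_setT mule1.
  set m := k.+1.
  rewrite (eq_integral (fun w => ((lam ^+ m / m`!%:R)%:E * (z w ^+ (2 * m))%:E)%E)); last first.
    by move=> w _; rewrite /exp_coeff/= -EFinM exprMn -exprM; congr EFin; rewrite mulrAC.
  have c0 : 0 <= lam ^+ m / m`!%:R by rewrite divr_ge0// exprn_ge0// ltW.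
  rewrite ge0_integralZl//; last 2 first.
  - by apply/measurable_EFinP; exact: measurable_funX.
  - by move=> w _; rewrite lee_fin mulnC exprM sqr_ge0.
  apply: (@le_trans _ _ ((lam ^+ m / m`!%:R)%:E * ((2 * m)%:R ^+ m * K ^+ (2 * m))%:E)%E).
    by apply: lee_wpmul2l => //; apply: psi2norm_moment => //; exact: ltW.
  rewrite -EFinM lee_fin natrM exprMn.
  have mf : 0 < m`!%:R :> R by rewrite ltr0n fact_gt0.
  apply: (@le_trans _ _ (lam ^+ m / m`!%:R * (2 ^+ m * (expR 1 ^+ m * m`!%:R) * K ^+ (2 * m)))).
    rewrite ler_wpM2l// ler_wpM2r//; first by rewrite exprn_ge0// ltW.
    by rewrite ler_wpM2l ?exprn_ge0//; exact: pow_le_fact_expR.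
  rewrite (_ : _ * _ = (lam * 2 * expR 1 * K ^+ 2) ^+ m); last first.
    by rewrite 3!exprMn -exprM; field; rewrite gt_eqF.
  rewrite (_ : lam * 2 * expR 1 * K ^+ 2 = 2^-1)// /lam; field.
  by rewrite !gt_eqF.
apply: lime_le.
  apply/ereal_nondecreasing_is_cvgn => m n mn; apply: ge0_le_integral => //=.
  - by move=> ? _; rewrite lee_fin.
  - exact/measurable_EFinP.
  - exact/measurable_EFinP.
  - by move=> w _; rewrite lee_fin undec.
apply: nearW => n.
rewrite (eq_integral (fun w => (\sum_(0 <= k < n) (exp_coeff (lam * z w ^+ 2) k)%:E)%E)); last first.
  by move=> w _; rewrite sumEFin.
rewrite ge0_integral_sum//; last 2 first.
- by move=> k; exact/measurable_EFinP.
- by move=> k w _; rewrite lee_fin.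
apply: (@le_trans _ _ (\sum_(0 <= k < n) ((2^-1) ^+ k)%:E)%E).
  exact: lee_sum.
rewrite sumEFin lee_fin.
suff -> : \sum_(0 <= k < n) 2^-1 ^+ k = 2 - 2 * (2^-1) ^+ n :> R.
  by rewrite gerBl mulr_ge0// exprn_ge0.
elim: n => [|n IH]; first by rewrite big_geq// expr0; lra.
by rewrite big_nat_recr//= IH exprS; lra.
Qed.

End subgaussian.

(** * Square-integrable variables *)

Section second_moments.
Context d (T : measurableType d) (R : realType) (P : probability T R).
Implicit Types X Y : T -> R.

Lemma Lfun2_of_sqr X : measurable_fun setT X ->
  (\int[P]_w (X w ^+ 2)%:E < +oo)%E -> X \in Lfun P 2%:E.
Proof.
move=> mX X2; rewrite inE/=; apply/andP; split; first by rewrite inE.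
rewrite inE/= /finite_norm unlock /Lnorm poweR_lty//.
rewrite (eq_integral (fun w => (X w ^+ 2)%:E))// => w _.
by rewrite /= powR_mulrn// real_normK// num_real.
Qed.

Lemma Lfun2_integrableM X Y : X \in Lfun P 2%:E -> Y \in Lfun P 2%:E ->
  P.-integrable setT (fun w => (X w * Y w)%:E).
Proof. by move=> X2 Y2; apply/Lfun1_integrable; exact: Lfun2_mul_Lfun1. Qed.

Lemma Lfun2_Lfun1 X : X \in Lfun P 2%:E -> X \in Lfun P 1.
Proof. by move=> X2; apply: Lfun_subset12 => //; exact: fin_num_measure. Qed.

Lemma Lfun2_sum (I : Type) (s : seq I) (f : I -> T -> R) (a : I -> R) :
  (forall i, f i \in Lfun P 2%:E) ->
  (fun w => \sum_(i <- s) a i * f i w) \in Lfun P 2%:E.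
Proof.
move=> f2; elim: s => [|i s IH].
  rewrite (_ : (fun _ => _) = cst 0); first exact: Lfun_cst.
  by apply/funext => w; rewrite big_nil.
rewrite (_ : (fun _ => _) = (a i \o* f i) \+ (fun w => \sum_(i <- s) a i * f i w)).
  have [_ addL] := @Lfun_addr_closed _ _ _ P 2%:E (lee1n _).
  by apply: addL => //; apply: Lfun_scale => //; rewrite ler1n.
by apply/funext => w; rewrite big_cons/= mulrC.
Qed.

Lemma covariance_centered X Y : X \in Lfun P 2%:E -> Y \in Lfun P 2%:E ->
  ('E_P[X] = 0)%E -> (covariance P X Y = \int[P]_w (X w * Y w)%:E)%E.
Proof.
move=> X2 Y2 X0; rewrite covarianceE; last 3 first.
- exact: Lfun2_Lfun1.
- exact: Lfun2_Lfun1.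
- exact: Lfun2_mul_Lfun1.
by rewrite X0 mul0e sube0 expectation.unlock.
Qed.

Lemma integral_sumM (I J : finType) (a : I -> R) (b : J -> R) (f : I -> T -> R) (g : J -> T -> R) :
  (forall i, f i \in Lfun P 2%:E) -> (forall j, g j \in Lfun P 2%:E) ->
  (\int[P]_w ((\sum_i a i * f i w) * (\sum_j b j * g j w))%:E =
   (\sum_i \sum_j a i * b j * fine (\int[P]_w (f i w * g j w)%:E))%:E)%E.
Proof.
move=> f2 g2.
rewrite (eq_integral (fun w => \sum_i \sum_j ((a i * b j)%:E * (f i w * g j w)%:E)%E)); last first.
  move=> w _; rewrite mulr_suml -sumEFin; apply: eq_bigr => i _.
  rewrite mulr_sumr -sumEFin; apply: eq_bigr => j _; rewrite -EFinM; congr EFin; ring.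
have ifg i j : P.-integrable setT (fun w => ((a i * b j)%:E * (f i w * g j w)%:E)%E).
  by apply: integrableZl => //; exact: Lfun2_integrableM.
rewrite integral_sum//; last by move=> i; exact: integrable_sum.
rewrite -sumEFin; apply: eq_bigr => i _; rewrite integral_sum// -sumEFin.
apply: eq_bigr => j _; rewrite integralZl//; last exact: Lfun2_integrableM.
rewrite [RHS]EFinM fineK//; apply: integrable_fin_num => //; exact: Lfun2_integrableM.
Qed.

End second_moments.

(** * The covariance matrix as a bilinear form *)

Section covariance_matrix.
Context d (T : measurableType d) (R : realType) (P : probability T R).
Context (p : nat) (x : {RV P >-> p.-tuple R}).
Hypothesis mean0 : forall j, ('E_P[coordrv x j] = 0)%E.
Hypothesis x2 : forall j, coordrv x j \in Lfun P 2%:E.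

Lemma lincombE (u : 'cV[R]_p) w : lincomb u x w = \sum_j u j 0 * coordrv x j w.
Proof. by rewrite /lincomb dotpE; apply: eq_bigr => j _; rewrite mxE. Qed.

Lemma measurable_coordrv j : measurable_fun setT (coordrv x j).
Proof.
apply: (@measurableT_comp _ _ _ _ _ _ (fun t : p.-tuple R => tnth t j)) => //.
exact: measurable_tnth.
Qed.

Lemma measurable_lincomb (u : 'cV[R]_p) : measurable_fun setT (lincomb u x).
Proof.
rewrite (_ : lincomb u x = fun w => \sum_j u j 0 * coordrv x j w).
  by apply: measurable_sum => j; apply: measurable_funM => //; exact: measurable_coordrv.
by apply/funext => w; rewrite lincombE.
Qed.

Lemma Lfun2_lincomb (u : 'cV[R]_p) : lincomb u x \in Lfun P 2%:E.
Proof.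
rewrite (_ : lincomb u x = fun w => \sum_j u j 0 * coordrv x j w); first exact: Lfun2_sum.
by apply/funext => w; rewrite lincombE.
Qed.

Lemma cov_mxE j k : cov_mx P x j k = fine (\int[P]_w (coordrv x j w * coordrv x k w)%:E).
Proof. by rewrite mxE covariance_centered. Qed.

Lemma cov_mx_sym : (cov_mx P x)^T = cov_mx P x.
Proof. by apply/matrixP => j k; rewrite mxE [LHS]mxE [RHS]mxE covarianceC. Qed.

Lemma integral_lincombM (u v : 'cV[R]_p) :
  (\int[P]_w (lincomb u x w * lincomb v x w)%:E = (dotp u (cov_mx P x *m v))%:E)%E.
Proof.
under eq_integral do rewrite !lincombE.
rewrite integral_sumM//; congr EFin; rewrite dotpE; apply: eq_bigr => j _.
rewrite mxE mulr_sumr; apply: eq_bigr => k _; rewrite cov_mxE; ring.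
Qed.

Lemma integral_lincomb_sqr (u : 'cV[R]_p) :
  (\int[P]_w (lincomb u x w ^+ 2)%:E = (qform (cov_mx P x) u)%:E)%E.
Proof.
by rewrite qformE -integral_lincombM; apply: eq_integral => w _; rewrite expr2.
Qed.

Lemma lincomb_delta j : lincomb (delta_mx j 0) x = coordrv x j.
Proof. by apply/funext => w; rewrite /lincomb dotp_delta mxE. Qed.

Lemma mean_lincomb (u : 'cV[R]_p) : (\int[P]_w (lincomb u x w)%:E = 0)%E.
Proof.
under eq_integral do rewrite lincombE -sumEFin.
have ix j : P.-integrable setT (fun w => (coordrv x j w)%:E).
  by apply/Lfun1_integrable; exact: Lfun2_Lfun1.
rewrite integral_sum//; last by move=> j; exact: (integrableZl measurableT (u j 0) (ix j)).
apply: big1 => j _.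
under eq_integral do rewrite EFinM.
by rewrite integralZl//; have := mean0 j; rewrite expectation.unlock => ->; rewrite mule0.
Qed.

End covariance_matrix.

(** * Equality of laws and independence of two variables *)

Section laws.
Context d (T : measurableType d) (R : realType) (P : probability T R).

Lemma measurable_set_ge (f : T -> R) (t : R) : measurable_fun setT f ->
  measurable [set w | t <= f w].
Proof.
move=> mf; rewrite (_ : mkset _ = f @^-1` `[t, +oo[%classic).
  by rewrite -[X in measurable X]setTI; exact: mf.
by apply/seteqP; split => w /=; rewrite in_itv/= andbT.
Qed.

Lemma measure_le_cover2 (A B C : set T) (b c : R) :
  measurable A -> measurable B -> measurable C -> A `<=` B `|` C ->
  (P B <= b%:E -> P C <= c%:E -> P A <= (b + c)%:E)%E.
Proof.
move=> mA mB mC ABC Bb Cc.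
apply: (@le_trans _ _ (P (B `|` C))).
  by apply: le_measure => //; rewrite inE//; exact: measurableU.
rewrite EFinD; apply: le_trans (leeD Bb Cc).
exact: measureU2.
Qed.

Lemma mutually_independent_family n d1 (T1 : measurableType d1) (X : 'I_n -> T -> T1) :
  mutually_independent P X -> indep_family P X.
Proof.
move=> iX A mA; rewrite -iX//; congr (P _); apply/seteqP; split => w /= h i.
  by move=> _; exact: h.
exact: h.
Qed.

Lemma same_law_integral d1 (T1 : measurableType d1) (X Y : T -> T1) (F : T1 -> \bar R) :
  measurable_fun setT X -> measurable_fun setT Y -> same_law P X Y ->
  measurable_fun setT F -> (forall t, 0 <= F t)%E ->
  (\int[P]_w F (X w) = \int[P]_w F (Y w))%E.
Proof.
move=> mX mY XY mF F0.
have := ge0_integral_pushforward mX P measurableT mF (fun y _ => F0 y).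
rewrite preimage_setT => <-.
have := ge0_integral_pushforward mY P measurableT mF (fun y _ => F0 y).
rewrite preimage_setT => <-.
by apply: eq_measure_integral => A mA _; exact: XY.
Qed.

Lemma ge0_integral_indep2 d1 (T1 : measurableType d1) d2 (T2 : measurableType d2)
    (X : T -> T1) (Y : T -> T2) (F : T1 * T2 -> \bar R) :
  measurable_fun setT X -> measurable_fun setT Y -> independent2 P X Y ->
  measurable_fun setT F -> (forall t, 0 <= F t)%E ->
  (\int[P]_w F (X w, Y w) = \int[P]_w \int[P]_w' F (X w, Y w'))%E.
Proof.
move=> mX mY iXY mF F0.
have mXY : measurable_fun setT (fun w => (X w, Y w)) by exact: measurable_fun_pair.
pose Xm : {RV P >-> T1} := HB.pack X (isMeasurableFun.Build _ _ _ _ _ mX).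
pose Ym : {RV P >-> T2} := HB.pack Y (isMeasurableFun.Build _ _ _ _ _ mY).
have := ge0_integral_pushforward mXY P measurableT mF (fun y _ => F0 y).
rewrite preimage_setT => <-.
pose m' : {measure set (T1 * T2) -> \bar R} := pushforward P (fun w => (X w, Y w)).
rewrite (eq_measure_integral (distribution P Xm \x distribution P Ym)%E); last first.
  move=> A mA _.
  apply/esym; apply: (@product_measure_unique _ _ _ _ _ (distribution P Xm)
    (distribution P Ym) (m' mXY)) => // B C mB mC; exact: iXY.
rewrite fubini_tonelli1//=.
have mFF : measurable_fun setT (fubini_F (distribution P Ym) F).
  exact: measurable_fun_fubini_tonelli_F.
have F0' z : (0 <= fubini_F (distribution P Ym) F z)%E by apply: integral_ge0 => ? _.
rewrite (@ge0_integral_distribution _ _ _ _ _ P Xm)//.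
apply: eq_integral => w _ /=.
rewrite /fubini_F (@ge0_integral_distribution _ _ _ _ _ P Ym)//.
exact: measurable_fun_pair2.
Qed.

End laws.

(** * Concentration of the sample covariance along one direction *)

Section sample_quadratic.
Context d (T : measurableType d) (R : realType) (P : probability T R).
Context (n p : nat) (x : {RV P >-> p.-tuple R}) (y : {RV P >-> R}).
Context (Z : 'I_n -> {RV P >-> (p.-tuple R * R)%type}).
Variable K : R.
Hypothesis K0 : 0 < K.
Hypothesis mean0 : forall j, ('E_P[coordrv x j] = 0)%E.
Hypothesis psi2x : (psi2norm_vec P x <= K%:E)%E.
Hypothesis iidZ : iid_copies P Z (fun w => (x w, y w)).
Hypothesis n0 : (0 < n)%N.

Lemma unit_psi2norm u : dotp u u = 1 -> (psi2norm P (lincomb u x) <= K%:E)%E.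
Proof.
move=> u1; apply: le_trans psi2x; apply: ereal_sup_ubound; exists u => //=.
by apply/eqP; rewrite -(@eqrXn2 _ 2) ?l2norm_ge0// l2normE u1 expr1n.
Qed.

Lemma subgaussian_moment u m : dotp u u = 1 -> (0 < m)%N ->
  (\int[P]_w (lincomb u x w ^+ (2 * m))%:E <= ((2 * m)%:R ^+ m * K ^+ (2 * m))%:E)%E.
Proof.
move=> u1 m0; apply: psi2norm_moment => //; last exact: unit_psi2norm.
  exact: measurable_lincomb.
exact: ltW.
Qed.

Lemma Lfun2_coordrv j : coordrv x j \in Lfun P 2%:E.
Proof.
apply: Lfun2_of_sqr; first exact: measurable_coordrv.
rewrite -lincomb_delta.
have := @subgaussian_moment (delta_mx j 0) 1.
rewrite dotp_delta mxE !eqxx => /(_ erefl erefl) /le_lt_trans; apply.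
exact: ltry.
Qed.

Lemma qform_cov_le u : dotp u u = 1 -> qform (cov_mx P x) u <= 2 * K ^+ 2.
Proof.
move=> u1; rewrite -lee_fin -integral_lincomb_sqr//; last exact: Lfun2_coordrv.
by have := subgaussian_moment u1 (ltn0Sn 0); rewrite muln1 expr1.
Qed.

Definition obs_proj (u : 'cV[R]_p) (D : p.-tuple R * R) : R := dotp u (col_of_tuple D.1).

Lemma measurable_obs_proj u : measurable_fun setT (obs_proj u).
Proof.
rewrite (_ : obs_proj u = fun D => \sum_j u j 0 * tnth D.1 j); last first.
  by apply/funext => D; rewrite /obs_proj dotpE; apply: eq_bigr => j _; rewrite mxE.
apply: measurable_sum => j; apply: measurable_funM => //.
apply: (@measurableT_comp _ _ _ _ _ _ (fun t : p.-tuple R => tnth t j)) => //.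
exact: measurable_tnth.
Qed.

Lemma Sigma_hat_sym (D : 'I_n -> p.-tuple R * R) : (Sigma_hat_xx D)^T = Sigma_hat_xx D.
Proof.
rewrite /Sigma_hat_xx linearZ/= linear_sum/=; congr (_ *: _).
by apply: eq_bigr => i _; rewrite trmx_mul trmxK.
Qed.

Lemma qform_Sigma_hat (D : 'I_n -> p.-tuple R * R) u :
  qform (Sigma_hat_xx D) u = n%:R^-1 * \sum_i obs_proj u (D i) ^+ 2.
Proof.
rewrite /Sigma_hat_xx qformZl; congr (_ * _).
rewrite qformE mulmx_suml dotpE.
under eq_bigr do rewrite summxE mulr_sumr.
rewrite exchange_big/=; apply: eq_bigr => i _.
rewrite -dotpE -mulmxA [_^T *m u]mx11_scalar mul_mx_scalar dotpZr.
by rewrite -/(dotp _ _) (dotpC _ u) expr2.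
Qed.

Lemma measurable_qform_hat u :
  measurable_fun setT (fun w => qform (Sigma_hat_xx (fun i => Z i w)) u).
Proof.
rewrite (_ : (fun _ => _) = fun w => n%:R^-1 * \sum_i obs_proj u (Z i w) ^+ 2).
  apply: measurable_funM => //; apply: measurable_sum => i; apply: measurable_funX.
  by apply: measurableT_comp => //; exact: measurable_obs_proj.
by apply/funext => w; rewrite qform_Sigma_hat.
Qed.

(** With [lam2 = (4 * e * K ^ 2)^-1], at which the squared projection has exponential moment at most
    2, [dev_cst] is [32 / lam2 ^ 2] and [dev_max] is [lam2 / 2], the range in which
    [exp_upper_moment] applies. *)
Definition dev_cst : R := 512 * expR 1 ^+ 2 * K ^+ 4.
Definition dev_max : R := (8 * expR 1 * K ^+ 2)^-1.

(** Chernoff's bound for an average of [n] independent squares. The parameter [s] carries a sign, so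
    [s = lam] and [s = - lam] give the two tails. *)
Lemma qform_hat_one_sided u (s c tau : R) : dotp u u = 1 ->
  (\int[P]_w (expR (s * (lincomb u x w ^+ 2 - qform (cov_mx P x) u)))%:E <= (expR c)%:E)%E ->
  (P [set w | (tau <= s * (qform (Sigma_hat_xx (fun i => Z i w)) u - qform (cov_mx P x) u))%R]
    <= (expR (n%:R * (c - tau)))%:E)%E.
Proof.
set m := qform (cov_mx P x) u => u1 sc.
have nR : 0 < n%:R :> R by rewrite ltr0n.
pose f (D : p.-tuple R * R) := s * (obs_proj u D ^+ 2 - m).
have mf : measurable_fun setT f.
  apply: measurable_funM => //; apply: measurable_funB => //.
  by apply: measurable_funX; exact: measurable_obs_proj.
have mZ i : measurable_fun setT (Z i) by [].
have [indZ lawZ] := iidZ.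
have fc i : (\int[P]_w (expR (f (Z i w)))%:E <= (expR c)%:E)%E.
  rewrite (@same_law_integral _ _ _ P _ _ _ (fun w => (x w, y w)) (fun D => (expR (f D))%:E))//.
  - exact: measurable_fun_pair.
  - by apply/measurable_EFinP; exact: measurableT_comp.
have := @indep_exp_sum _ _ _ P 'I_n _ _ (fun i => Z i) (fun=> f) (fun=> c) mZ
  (mutually_independent_family indZ) (fun=> mf) fc.
rewrite [X in (_ <= (expR X)%:E)%E -> _]sumr_const card_ord -[c *+ n]mulr_natl.
move=> /exp_markov => /(_ (n%:R * tau)) h.
have mS : measurable_fun setT (fun w => \sum_(i < n) f (Z i w)).
  by apply: measurable_sum => i; exact: measurableT_comp.
rewrite mulrBr; apply: le_trans (h mS).
rewrite le_eqVlt; apply/orP; left; apply/eqP; congr (P _); apply/seteqP.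
have e w : \sum_(i < n) f (Z i w) =
    n%:R * (s * (qform (Sigma_hat_xx (fun i => Z i w)) u - m)).
  rewrite /f -mulr_sumr sumrB sumr_const card_ord -[m *+ n]mulr_natl qform_Sigma_hat.
  by field; rewrite gt_eqF.
by split => w /=; rewrite e ler_pM2l.
Qed.

Lemma qform_hat_deviation u (lam t : R) : dotp u u = 1 -> 0 <= lam <= dev_max ->
  (P [set w | (t <= `|qform (Sigma_hat_xx (fun i => Z i w)) u - qform (cov_mx P x) u|)%R]
    <= (2 * expR (- (n%:R * (lam * t - dev_cst * lam ^+ 2))))%:E)%E.
Proof.
set m := qform (cov_mx P x) u => u1 /andP[lam0 lam1].
have e1 : 1 <= expR 1 :> R by have := expR_ge1Dx (1 : R); lra.
have mz := measurable_lincomb x u.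
have zm := integral_lincomb_sqr mean0 Lfun2_coordrv u.
have mh s : measurable_fun setT (fun w => s * (qform (Sigma_hat_xx (fun i => Z i w)) u - m)).
  by apply: measurable_funM => //; apply: measurable_funB => //; exact: measurable_qform_hat.
have up : (P [set w | (lam * t <= lam * (qform (Sigma_hat_xx (fun i => Z i w)) u - m))%R]
    <= (expR (- (n%:R * (lam * t - dev_cst * lam ^+ 2))))%:E)%E.
  rewrite (_ : - (n%:R * _) = n%:R * (dev_cst * lam ^+ 2 - lam * t)); last by ring.
  apply: qform_hat_one_sided => //.
  pose lam2 : R := (4 * expR 1 * K ^+ 2)^-1.
  rewrite (_ : dev_cst * lam ^+ 2 = 32 * (lam / lam2) ^+ 2); last first.
    by rewrite /dev_cst /lam2 invrK; ring.
  apply: exp_upper_moment => //.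
  - by rewrite invr_gt0 !mulr_gt0// ?exprn_gt0// expR_gt0.
  - rewrite lam0 (le_trans lam1)// /dev_max /lam2 le_eqVlt; apply/orP; left; apply/eqP.
    by field; rewrite !gt_eqF ?expR_gt0.
  - by apply: subgaussian_square_exp => //; exact: unit_psi2norm.
(* The lower tail uses the fourth moment [16 * K ^ 4]; its constant [32 * K ^ 4] is dominated by
   [dev_cst]. *)
have lo : (P [set w | (lam * t <= - lam * (qform (Sigma_hat_xx (fun i => Z i w)) u - m))%R]
    <= (expR (- (n%:R * (lam * t - dev_cst * lam ^+ 2))))%:E)%E.
  rewrite (_ : - (n%:R * _) = n%:R * (dev_cst * lam ^+ 2 - lam * t)); last by ring.
  apply: qform_hat_one_sided => //.
  rewrite (eq_integral (fun w => (expR (lam * (m - lincomb u x w ^+ 2)))%:E)); last first.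
    by move=> w _; congr (expR _)%:E; rewrite -/m; ring.
  apply: le_trans (exp_lower_moment (v := 16 * K ^+ 4) mz lam0 zm _) _.
    have := subgaussian_moment u1 (ltn0Sn 1).
    by rewrite (_ : (2 * 2)%:R ^+ 2 = 16 :> R)// -natrX.
  rewrite lee_fin ler_expR /dev_cst.
  rewrite (_ : 2 * lam ^+ 2 * (16 * K ^+ 4) = 32 * K ^+ 4 * lam ^+ 2); last by ring.
  rewrite ler_wpM2r ?sqr_ge0// ler_wpM2r ?exprn_ge0 ?(ltW K0)//.
  have : 1 <= expR 1 ^+ 2 :> R by rewrite exprn_ege1.
  lra.
rewrite mulr_natl mulr2n; apply: measure_le_cover2 lo up.
- apply: measurable_set_ge; apply: measurableT_comp => //.
  by apply: measurable_funB => //; exact: measurable_qform_hat.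
- exact: measurable_set_ge.
- exact: measurable_set_ge.
move=> w /=; set q := _ - m; rewrite ler_normr => /orP[h|h]; [right|left].
  by rewrite ler_wpM2l.
by rewrite mulNr -mulrN ler_wpM2l.
Qed.

End sample_quadratic.

(** * Hoeffding's inequality for U-statistics of order two *)
Section ustatistic.
Context d (T : measurableType d) (R : realType) (P : probability T R).
Context d1 (T1 : measurableType d1) (n : nat).
Variables (Z : 'I_n.+2 -> T -> T1) (W : T -> T1).
Hypotheses (mZ : forall i, measurable_fun setT (Z i)) (mW : measurable_fun setT W).
Hypotheses (indZ : indep_family P Z) (lawZ : forall i, same_law P (Z i) W).
Let N : nat := n.+2.

Definition ustat (G : T1 * T1 -> R) (w : T) : R :=
  2 / (N%:R * (N%:R - 1)) * \sum_(i < N) \sum_(l < N | (i < l)%N) G (Z i w, Z l w).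

(* For each residue [m] the pairs [i < l] with [i + l = m] mod [N] are disjoint, so
   the U-statistic is a convex combination of sums of independent variables, and
   Jensen's inequality reduces its exponential moments to theirs. *)
Let pr (m : 'I_N) (q : 'I_N * 'I_N) : bool :=
  (q.1 < q.2)%N && ((q.1 + q.2) %% N == m)%N.

Lemma ord_modn_inj (a b c : 'I_N) : ((a + b) %% N = (a + c) %% N)%N -> b = c.
Proof.
move=> /eqP; rewrite eqn_modDl !modn_small// => /eqP; exact: val_inj.
Qed.

Lemma sum_pairs_split (F : 'I_N * 'I_N -> R) :
  \sum_(i < N) \sum_(l < N | (i < l)%N) F (i, l) =
  \sum_(m < N) \sum_(q : {q | q \in pr m}) F (val q).
Proof.
rewrite pair_big_dep/=.
pose f (q : 'I_N * 'I_N) : 'I_N := Ordinal (ltn_pmod (q.1 + q.2) (ltn0Sn n.+1)).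
rewrite (partition_big f xpredT)//=.
apply: eq_bigr => m _; rewrite -big_sub; apply: eq_big => [[i l]|[i l] _]//=.
Qed.

Lemma card_ltn_pairs :
  \sum_(i < N) \sum_(l < N | (i < l)%N) (1 : R) = N%:R * (N%:R - 1) / 2.
Proof.
set s := LHS.
have s1 : s = \sum_(i < N) \sum_(l < N) (i < l)%N%:R.
  by apply: eq_bigr => i _; rewrite big_mkcond; apply: eq_bigr => l _; case: ltnP.
have s2 : s = \sum_(i < N) \sum_(l < N) (l < i)%N%:R by rewrite s1 exchange_big.
have s3 : N%:R = \sum_(i < N) \sum_(l < N) (i == l)%:R :> R.
  rewrite -[LHS]mulr1 mulr_natl -[X in _ *+ X](card_ord N) -sumr_const.
  apply: eq_bigr => i _; rewrite (bigD1 i)//= eqxx big1 ?addr0// => l li.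
  by rewrite eq_sym (negbTE li).
have : s + s + N%:R = N%:R * N%:R.
  rewrite {1}s1 {1}s2 {1}s3 -!big_split/= [in RHS]mulr_natl.
  rewrite -[X in _ *+ X](card_ord N) -sumr_const.
  apply: eq_bigr => i _; rewrite -!big_split/=.
  rewrite -[RHS]mulr1 mulr_natl -[X in _ *+ X](card_ord N) -sumr_const.
  apply: eq_bigr => l _; rewrite -val_eqE/=.
  by case: ltngtP => _; rewrite ?addr0 ?add0r.
lra.
Qed.

Lemma measurable_integral_law (F : T1 * T1 -> \bar R) :
  measurable_fun setT F -> (forall t, 0 <= F t)%E ->
  measurable_fun setT (fun t => \int[P]_w F (t, W w))%E.
Proof.
move=> mF F0.
pose Wm : {RV P >-> T1} := HB.pack W (isMeasurableFun.Build _ _ _ _ _ mW).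
rewrite (_ : (fun _ => _) = fubini_F (distribution P Wm) F).
  exact: measurable_fun_fubini_tonelli_F.
apply/funext => t; rewrite /fubini_F (@ge0_integral_distribution _ _ _ _ _ P Wm)//.
exact: measurable_fun_pair2.
Qed.

Lemma integral_pair_law (F : T1 * T1 -> \bar R) i l : i != l ->
  measurable_fun setT F -> (forall t, 0 <= F t)%E ->
  (\int[P]_w F (Z i w, Z l w) = \int[P]_w \int[P]_w' F (W w, W w'))%E.
Proof.
move=> il mF F0.
rewrite ge0_integral_indep2//; last first.
  move=> A B mA mB.
  have := @indep_disjoint_setX _ _ _ P _ _ _ 'I_1 Z (fun=> i) (fun=> l) _ _ _ indZ
    (fun=> A) (fun=> B) (fun=> mA) (fun=> mB).
  rewrite big_ord1 => <- //.
  - congr (P _); apply/seteqP; split => w /=; last by move=> /(_ ord0).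
    by move=> [].
  - by move=> a b _; rewrite !ord1.
  - by move=> a b _; rewrite !ord1.
rewrite -(@same_law_integral _ _ _ P _ _ (Z i) W (fun t => \int[P]_w' F (t, W w'))%E)//.
- apply: eq_integral => w _.
  apply: (@same_law_integral _ _ _ P _ _ (Z l) W (fun t => F (Z i w, t))) => //.
  exact: measurable_fun_pair2.
- exact: measurable_integral_law.
- by move=> t; apply: integral_ge0.
Qed.

Lemma measurable_ustat G : measurable_fun setT G -> measurable_fun setT (ustat G).
Proof.
move=> mG; apply: measurable_funM => //; apply: measurable_sum => i.
rewrite (_ : (fun _ => _) = fun w =>
    \sum_(l < N) (if (i < l)%N then G (Z i w, Z l w) else 0)).
  apply: measurable_sum => l; case: (i < l)%N => //.
  by apply: measurableT_comp => //; exact: measurable_fun_pair.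
by apply/funext => w; rewrite big_mkcond.
Qed.

Lemma ustat_one_sided (G : T1 * T1 -> R) (tau theta t : R) :
  measurable_fun setT G -> (forall z, `|G z| <= 1) ->
  (\int[P]_w \int[P]_w' (1 + G (W w, W w'))%:E = (1 + tau)%:E)%E ->
  0 <= theta <= 4^-1 ->
  (P [set w | (theta * t <= theta * (ustat G w - tau))%R] <=
    (expR (- (N%:R * (theta * t / 4 - 8 * theta ^+ 2))))%:E)%E.
Proof.
move=> mG G1 Gtau /[dup] thetab /andP[th0 th1].
pose J (m : 'I_N) : finType := {q | q \in pr m}.
pose S (m : 'I_N) w := \sum_(q : J m) theta * (G (Z (val q).1 w, Z (val q).2 w) - tau).
have mG2 i l : measurable_fun setT (fun w => G (Z i w, Z l w)).
  by apply: measurableT_comp => //; exact: measurable_fun_pair.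
have mS m : measurable_fun setT (S m).
  apply: measurable_sum => q; apply: measurable_funM => //.
  exact: measurable_funB.
have F0 z : (0 <= (1 + G z)%:E)%E.
  by rewrite lee_fin; have := G1 z; rewrite ler_norml; lra.
have mF : measurable_fun setT (fun z => (1 + G z)%:E).
  by apply/measurable_EFinP; exact: measurable_funD.
have Sexp m : (\int[P]_w (expR (S m w))%:E <= (expR (8 * theta ^+ 2 * N%:R))%:E)%E.
  pose V (q : J m) w := (Z (val q).1 w, Z (val q).2 w).
  have prq (q : J m) : ((val q).1 < (val q).2)%N /\ (((val q).1 + (val q).2) %% N = m)%N.
    by have := valP q; rewrite unfold_in => /andP[? /eqP].
  have ia : injective (fun q : J m => (val q).1).
    move=> q q' /= e; apply: val_inj; case: (prq q) (prq q') => _ h [_ h'].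
    rewrite [val q]surjective_pairing [val q']surjective_pairing -e; congr pair.
    by apply: (@ord_modn_inj (val q).1); rewrite h e h'.
  have ib : injective (fun q : J m => (val q).2).
    move=> q q' /= e; apply: val_inj; case: (prq q) (prq q') => _ h [_ h'].
    rewrite [val q]surjective_pairing [val q']surjective_pairing -e; congr pair.
    by apply: (@ord_modn_inj (val q).2); rewrite addnC h e addnC h'.
  (* Equality would force [q.2 = q'.1] as well, since both pairs have the same residue; then
     [q.1 < q.2 = q'.1 < q'.2 = q.1]. *)
  have iab (q q' : J m) : (val q).1 != (val q').2.
    apply/eqP => e; case: (prq q) (prq q') => lt h [lt' h'].
    have e' : (val q).2 = (val q').1.
      by apply: (@ord_modn_inj (val q).1); rewrite h e addnC h'.
    by move: lt; rewrite e' e => /(ltn_trans lt'); rewrite ltnn.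
  have indV := indep_disjoint_pairs ia ib iab mZ indZ.
  have mV q : measurable_fun setT (V q) by exact: measurable_fun_pair.
  have := @indep_exp_sum _ _ _ P (J m) _ _ V (fun=> fun z => theta * (G z - tau))
    (fun=> 8 * theta ^+ 2) mV indV.
  move=> /(_ _ _)/le_trans; apply => //.
  - by move=> q; apply: measurable_funM => //; exact: measurable_funB.
  - move=> q; apply: (@exp_bounded_moment _ _ _ P (fun w => G (V q w))) => //.
      exact: mG2.
    rewrite (integral_pair_law (i := (val q).1) (l := (val q).2) _ mF F0)//.
  rewrite lee_fin ler_expR sumr_const -[leLHS]mulr_natr ler_wpM2l//.
    by rewrite mulr_ge0// sqr_ge0.
  by rewrite ler_nat (leq_trans (leq_card _ ia))// card_ord.
have h := @exp_avg_le _ _ _ P n.+1 S _ mS Sexp.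
have N0 : 0 < N%:R :> R by rewrite ltr0n.
have N1 : 0 < N%:R - 1 :> R by rewrite subr_gt0 ltr1n.
have mavg : measurable_fun setT (fun w => N%:R^-1 * \sum_m S m w).
  by apply: measurable_funM => //; exact: measurable_sum.
(* The [N (N - 1) / 2] pairs are spread over [N] residues, hence the factor [(N - 1) / 2]. Its lower
   bound [N / 4] is the origin of the [4] in the exponent. *)
have e w : N%:R^-1 * \sum_m S m w = (N%:R - 1) / 2 * (theta * (ustat G w - tau)).
  rewrite /S -(@sum_pairs_split (fun q => theta * (G (Z q.1 w, Z q.2 w) - tau)))/=.
  under eq_bigr do rewrite -mulr_sumr sumrB.
  rewrite -mulr_sumr sumrB.
  have -> : \sum_(i < N) \sum_(l < N | (i < l)%N) tau = tau * (N%:R * (N%:R - 1) / 2).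
    rewrite -card_ltn_pairs mulr_sumr; apply: eq_bigr => i _.
    by rewrite mulr_sumr; apply: eq_bigr => l _; rewrite mulr1.
  rewrite /ustat; field; rewrite !gt_eqF//.
have := exp_markov ((N%:R - 1) / 2 * (theta * t)) mavg h.
rewrite (_ : [set w | _] = [set w | (theta * t <= theta * (ustat G w - tau))%R]); last first.
  have c0 : 0 < (N%:R - 1) / 2 :> R by rewrite divr_gt0.
  by apply/seteqP; split => w /=; rewrite e (ler_pM2l c0).
(* For negative [t] the claimed bound is at least 1. The comparison of [N - 1] with [N / 2] below
   multiplies by [theta * t] and so takes [t] nonnegative. *)
have [t0|t0] := leP 0 t; last first.
  move=> _; apply: (@le_trans _ _ 1%E).
    apply: probability_le1; apply: measurable_set_ge.
    apply: measurable_funM => //; apply: measurable_funB => //; exact: measurable_ustat.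
  rewrite lee_fin -[leLHS]expR0 ler_expR.
  rewrite oppr_ge0 pmulr_rle0//.
  have : theta * t <= 0 by rewrite mulr_ge0_le0// ltW.
  have : 0 <= theta ^+ 2 by exact: sqr_ge0.
  lra.
move/le_trans; apply; rewrite lee_fin ler_expR.
have N2 : N%:R / 2 <= N%:R - 1 :> R.
  have : 2 <= N%:R :> R by rewrite ler_nat.
  lra.
have : (N%:R / 2) * (theta * t) <= (N%:R - 1) * (theta * t) by rewrite ler_wpM2r// mulr_ge0.
lra.
Qed.

Lemma integral_pair_opp (G : T1 * T1 -> R) (tau : R) :
  measurable_fun setT G -> (forall z, `|G z| <= 1) ->
  (\int[P]_w \int[P]_w' (1 + G (W w, W w'))%:E = (1 + tau)%:E)%E ->
  (\int[P]_w \int[P]_w' (1 - G (W w, W w'))%:E = (1 - tau)%:E)%E.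
Proof.
move=> mG G1 Gtau.
have int_cst (c : \bar R) : (\int[P]_w c = c)%E.
  by rewrite integral_cst// [X in (_ * X)%E]probability_setT mule1.
have Gp z : (0 <= (1 + G z)%:E)%E by rewrite lee_fin; have := G1 z; rewrite ler_norml; lra.
have Gn z : (0 <= (1 - G z)%:E)%E by rewrite lee_fin; have := G1 z; rewrite ler_norml; lra.
have mp : measurable_fun setT (fun z => (1 + G z)%:E).
  by apply/measurable_EFinP; exact: measurable_funD.
have mn : measurable_fun setT (fun z => (1 - G z)%:E).
  by apply/measurable_EFinP; exact: measurable_funB.
have mIp := measurableT_comp (measurable_integral_law mp Gp) mW.
have mIn := measurableT_comp (measurable_integral_law mn Gn) mW.
have : (\int[P]_w \int[P]_w' (1 + G (W w, W w'))%:E +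
    \int[P]_w \int[P]_w' (1 - G (W w, W w'))%:E = 2%:E)%E.
  rewrite -ge0_integralD//; last 2 first.
  - by move=> w _; apply: integral_ge0.
  - by move=> w _; apply: integral_ge0.
  rewrite -[RHS]int_cst; apply: eq_integral => w _.
  rewrite -ge0_integralD//; last 2 first.
  - exact: (measurableT_comp (measurable_fun_pair2 (W w) mp) mW).
  - exact: (measurableT_comp (measurable_fun_pair2 (W w) mn) mW).
  rewrite -[RHS]int_cst; apply: eq_integral => w' _.
  by rewrite -EFinD; congr EFin; ring.
rewrite Gtau; case: (\int[P]_w \int[P]_w' (1 - G (W w, W w'))%:E)%E => [r||]//= [] h.
by congr EFin; lra.
Qed.

Lemma ustat_deviation (G : T1 * T1 -> R) (tau theta t : R) :
  measurable_fun setT G -> (forall z, `|G z| <= 1) ->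
  (\int[P]_w \int[P]_w' (1 + G (W w, W w'))%:E = (1 + tau)%:E)%E ->
  0 <= theta <= 4^-1 ->
  (P [set w | (t <= `|ustat G w - tau|)%R] <=
    (2 * expR (- (N%:R * (theta * t / 4 - 8 * theta ^+ 2))))%:E)%E.
Proof.
move=> mG G1 Gtau thetab; have NGtau := integral_pair_opp mG G1 Gtau.
have UN w : ustat (fun z => - G z) w = - ustat G w.
  rewrite /ustat -mulrN -sumrN; congr (_ * _); apply: eq_bigr => i _.
  by rewrite -sumrN.
have up := ustat_one_sided t mG G1 Gtau thetab.
have mNG : measurable_fun setT (fun z => - G z) by exact: measurableT_comp.
have NG1 z : `|- G z| <= 1 by rewrite normrN.
have lo := ustat_one_sided t mNG NG1 NGtau thetab.
rewrite mulr_natl mulr2n; apply: measure_le_cover2 up lo.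
- apply: measurable_set_ge; apply: measurableT_comp => //.
  by apply: measurable_funB => //; exact: measurable_ustat.
- apply: measurable_set_ge; apply: measurable_funM => //; apply: measurable_funB => //; exact: measurable_ustat.
- apply: measurable_set_ge; apply: measurable_funM => //; apply: measurable_funB => //; exact: measurable_ustat.
case/andP: thetab => th0 _.
move=> w /=; rewrite UN; set q := ustat G w; rewrite ler_normr => /orP[h|h]; [left|right].
  by rewrite ler_wpM2l.
rewrite ler_wpM2l//; lra.
Qed.

End ustatistic.

(** * Kendall's tau of elliptical pairs *)
Section circle.
Context {R : realType}.
Notation mu := (@lebesgue_measure R).
Implicit Types (f : R -> \bar R) (a b c t : R).

Lemma measurable_shift c : measurable_fun [set: measurableTypeR R] (fun t : measurableTypeR R => t + c : measurableTypeR R).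
Proof. by apply: measurable_funD. Qed.

Lemma lebesgue_measure_shift c (A : set R) : measurable A ->
  pushforward mu (fun t : measurableTypeR R => t + c : measurableTypeR R) A = mu A.
Proof.
move=> mA.
pose m' : {measure set (measurableTypeR R) -> \bar R} := pushforward mu (fun t : measurableTypeR R => t + c : measurableTypeR R).
apply/esym/(@lebesgue_measure_unique R (m' (measurable_shift c))) => //= _ [[a b]] _ <-.
rewrite /pushforward/= (_ : _ @^-1` _ = `]a - c, b - c]%classic); last first.
  by apply/seteqP; split => t /=; rewrite !in_itv/= ltrBlDr lerBrDr.
rewrite !lebesgue_measure_itv/= !lte_fin ltrD2r; case: ifP => // _.
by rewrite -!EFinD; congr EFin; ring.
Qed.

Lemma ge0_integral_shift c (D : set R) f : measurable D ->
  measurable_fun setT f -> (forall t, 0 <= f t)%E ->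
  (\int[mu]_(t in [set t | D (t + c)%R]) f (t + c)%R = \int[mu]_(t in D) f t)%E.
Proof.
move=> mD mf f0.
have := ge0_integral_pushforward (measurable_shift c) mu mD
  (measurable_funTS mf) (fun y _ => f0 y).
pose m' : {measure set (measurableTypeR R) -> \bar R} :=
  pushforward mu (fun t : measurableTypeR R => t + c : measurableTypeR R).
move=> <-; apply: (eq_measure_integral mu (m1 := m' (measurable_shift c))) => A mA _.
exact: lebesgue_measure_shift.
Qed.

Lemma ge0_integral_itv_split f a b c : a <= b -> b <= c ->
  measurable_fun setT f -> (forall t, 0 <= f t)%E ->
  (\int[mu]_(t in `[a, c[) f t =
   \int[mu]_(t in `[a, b[) f t + \int[mu]_(t in `[b, c[) f t)%E.
Proof.
move=> ab bc mf f0.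
rewrite -ge0_integral_setU//=.
- congr (integral _ _ _).
  by rewrite -itv_bndbnd_setU// bnd_simp.
- exact: measurable_funTS.
apply/disj_setPS => t [] /=; rewrite !in_itv/= => /andP[_ tb] /andP[bt _].
by move: tb; rewrite ltNge bt.
Qed.

Definition circle_periodic f := forall t, f (t + 2 * pi) = f t.

(** The translated period is cut at [2 * pi] and the overhang is moved back by periodicity. *)
Lemma circle_shift f c : 0 <= c <= 2 * pi ->
  measurable_fun setT f -> (forall t, 0 <= f t)%E -> circle_periodic f ->
  (\int[mu]_(t in `[0%R, (2 * pi)%R[) f (t + c)%R = \int[mu]_(t in `[0%R, (2 * pi)%R[) f t)%E.
Proof.
move=> /andP[c0 c2] mf f0 pf.
transitivity (\int[mu]_(t in `[c, (c + 2 * pi)%R[) f t)%E.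
  rewrite -(ge0_integral_shift c _ mf f0)//; congr (integral _ _ _).
  by apply/seteqP; split => t /=; rewrite !in_itv/= lerDr (addrC c) ltrD2r.
rewrite (@ge0_integral_itv_split _ c (2 * pi))// ?lerDr//.
rewrite (@ge0_integral_itv_split _ 0 c (2 * pi))// addeC; congr (_ + _)%E.
rewrite -(ge0_integral_shift (2 * pi) _ mf f0)//.
transitivity (\int[mu]_(t in `[0%R, c[) f (t + 2 * pi)%R)%E.
  congr (integral _ _ _).
  by apply/seteqP; split => t /=; rewrite !in_itv/= lerDr ltrD2r.
by apply: eq_integral => t _; rewrite pf.
Qed.

Lemma integral_uniform_circle f : measurable_fun setT f -> (forall t, 0 <= f t)%E ->
  (\int[uniform_prob (@zero_lt_2pi R)]_t f t =
   ((2 * pi)^-1)%:E * \int[mu]_(t in `[0%R, (2 * pi)%R[) f t)%E.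
Proof.
move=> mf f0; rewrite integral_uniform// subr0; congr (_ * _)%E.
by apply: esym; apply: integral_itv_bndo_bndc; exact: measurable_funTS.
Qed.

Lemma uniform_shift f c : 0 <= c <= 2 * pi ->
  measurable_fun setT f -> (forall t, 0 <= f t)%E -> circle_periodic f ->
  (\int[uniform_prob (@zero_lt_2pi R)]_t f (t + c)%R =
   \int[uniform_prob (@zero_lt_2pi R)]_t f t)%E.
Proof.
move=> c2 mf f0 pf; rewrite !integral_uniform_circle//; last first.
  by apply: (measurableT_comp mf); exact: measurable_shift.
by rewrite circle_shift.
Qed.

End circle.

(** * Agreement of signs at a uniform angle *)

Section circle_signs.
Context {R : realType}.
Notation mu := (@lebesgue_measure R).
Notation U := (uniform_prob (@zero_lt_2pi R)).
Implicit Types (a b t delta : R).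

Lemma sinD2pi_mul t : sin (t + 2 * pi) = sin t.
Proof. by rewrite mulr_natl sinD2pi. Qed.

Lemma cosD2pi_mul t : cos (t + 2 * pi) = cos t.
Proof. by rewrite mulr_natl cosD2pi. Qed.

Lemma polar_coordinates a b : exists rho alpha : R,
  [/\ 0 <= rho, 0 <= alpha <= 2 * pi, a = rho * cos alpha & b = rho * sin alpha].
Proof.
have pi0 := pi_gt0 R.
pose rho := Num.sqrt (a ^+ 2 + b ^+ 2).
have s0 : 0 <= a ^+ 2 + b ^+ 2 by rewrite addr_ge0 ?sqr_ge0.
have rho0 : 0 <= rho by exact: sqrtr_ge0.
have rho2 : rho ^+ 2 = a ^+ 2 + b ^+ 2 by rewrite sqr_sqrtr.
have [r0|rn] := eqVneq rho 0.
  move: rho2; rewrite r0 expr0n/= => /esym/eqP.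
  rewrite paddr_eq0 ?sqr_ge0// !sqrf_eq0 => /andP[/eqP -> /eqP ->].
  by exists 0, 0; split; rewrite ?mul0r// lexx mulr_ge0// ltW.
have rp : 0 < rho by rewrite lt_neqAle eq_sym rn.
have ab1 : (a / rho) ^+ 2 + (b / rho) ^+ 2 = 1.
  by rewrite !expr_div_n -mulrDl -rho2 divff// expf_neq0.
have a1 : -1 <= a / rho <= 1.
  rewrite -ler_norml -(@expr_le1 _ 2)// real_normK ?num_real// -ab1 lerDl.
  exact: sqr_ge0.
have b2 : Num.sqrt (1 - (a / rho) ^+ 2) = `|b / rho|.
  by rewrite -sqrtr_sqr; congr Num.sqrt; lra.
have [b0|b0] := leP 0 b.
  exists rho, (acos (a / rho)); split => //.
  - by rewrite acos_ge0//= (le_trans (acos_lepi a1))//; lra.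
  - by rewrite acosK// mulrC divfK.
  - by rewrite sin_acos// b2 ger0_norm ?divr_ge0// mulrC divfK.
exists rho, (2 * pi - acos (a / rho)); split => //.
- have := acos_ge0 a1; have := acos_lepi a1; lra.
- by rewrite addrC cosD2pi_mul cosN acosK// mulrC divfK.
- rewrite addrC sinD2pi_mul sinN sin_acos// b2 ltr0_norm; last first.
    by rewrite pmulr_llt0// invr_gt0.
  by rewrite opprK mulrC divfK.
Qed.

Lemma measurable_sg : measurable_fun [set: R] (@Num.sg R).
Proof.
rewrite (_ : @Num.sg R = fun x => if x < 0 then -1 else if 0 < x then 1 else 0).
  apply: measurable_fun_ifT => //; first exact: measurable_fun_ltr.
  by apply: measurable_fun_ifT => //; exact: measurable_fun_ltr.
apply/funext => x; case: ltP => [/ltr0_sg//|x0].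
by case: ltP => [/gtr0_sg//|x0']; rewrite (_ : x = 0) ?sgr0//; apply/eqP; rewrite eq_le x0 x0'.
Qed.

Lemma norm_sg_le1 (x : R) : `|Num.sg x| <= 1.
Proof. by rewrite normr_sg lern1 leq_b1. Qed.

Lemma sgM_itv (x y : R) : -1 <= Num.sg x * Num.sg y <= 1.
Proof. by rewrite -ler_norml normrM mulr_ile1// norm_sg_le1. Qed.

(** Moving [delta] by [pi] reverses the second sign. Allowing [s = -1] therefore reduces angles
    beyond [pi] to the interval [[0, pi]]. *)
Definition sign_agree (s delta t : R) : \bar R :=
  (1 + s * (Num.sg (sin t) * Num.sg (sin (t - delta))))%:E.

Lemma measurable_sign_agree s delta : measurable_fun setT (sign_agree s delta).
Proof.
apply/measurable_EFinP; apply: measurable_funD => //; apply: measurable_funM => //.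
have msin : measurable_fun [set: R] (@sin R) by apply: continuous_measurable_fun; exact: continuous_sin.
apply: measurable_funM; apply: (measurableT_comp measurable_sg); first exact: msin.
by apply: (measurableT_comp msin); exact: measurable_funB.
Qed.

Lemma sign_agree_ge0 s delta t : -1 <= s <= 1 -> (0 <= sign_agree s delta t)%E.
Proof.
move=> s1; rewrite lee_fin.
have : `|s * (Num.sg (sin t) * Num.sg (sin (t - delta)))| <= 1.
  by rewrite normrM mulr_ile1// ler_norml// sgM_itv.
by rewrite ler_norml; lra.
Qed.

Lemma integral_sign_agree_pi s delta : -1 <= s <= 1 -> 0 <= delta <= pi ->
  (\int[mu]_(t in `[0%R, pi[) sign_agree s delta t =
    ((1 - s) * delta + (1 + s) * (pi - delta))%:E)%E.
Proof.
move=> s1 /andP[d0 dpi].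
have pi0 := pi_gt0 R.
have ms := measurable_sign_agree s delta.
have s0 := fun t => sign_agree_ge0 delta t s1.
rewrite (@ge0_integral_itv_split _ _ 0 delta pi)//.
have cst_itv (a b c : R) : a <= b ->
    (\int[mu]_(t in `]a, b[) (cst c%:E) t = (c * (b - a))%:E)%E.
  move=> ab; rewrite integral_cst//= lebesgue_measure_itv/= lte_fin.
  by case: ltP => [_|ba]; rewrite -?EFinD -?EFinM//; rewrite (_ : b - a = 0) ?mulr0 ?mule0//; lra.
rewrite !integral_itv_bndoo; try exact: measurable_funTS.
rewrite (@eq_integral _ _ _ mu `]0, delta[%classic (cst (1 - s)%:E)); last first.
  move=> t; rewrite inE/= in_itv/= => /andP[t0 td].
  rewrite /sign_agree gtr0_sg; last by apply: sin_gt0_pi; rewrite t0/=; lra.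
  rewrite -opprB sinN ltr0_sg; last first.
    by rewrite oppr_lt0; apply: sin_gt0_pi; apply/andP; split; lra.
  by congr EFin; ring.
rewrite (@eq_integral _ _ _ mu `]delta, pi[%classic (cst (1 + s)%:E)); last first.
  move=> t; rewrite inE/= in_itv/= => /andP[td tp].
  rewrite /sign_agree gtr0_sg; last by apply: sin_gt0_pi; apply/andP; split; lra.
  rewrite gtr0_sg; last by apply: sin_gt0_pi; apply/andP; split; lra.
  by congr EFin; ring.
by rewrite !cst_itv// subr0.
Qed.

Lemma uniform_sign_agree_pi s delta : -1 <= s <= 1 -> 0 <= delta <= pi ->
  (\int[U]_t sign_agree s delta t = (1 + s * (1 - 2 * delta / pi))%:E)%E.
Proof.
move=> s1 d1; have pi0 := pi_gt0 R.
have ms := measurable_sign_agree s delta.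
have s0 := fun t => sign_agree_ge0 delta t s1.
rewrite integral_uniform_circle// (@ge0_integral_itv_split _ _ 0 pi (2 * pi))//; [|lra..].
have -> : (\int[mu]_(t in `[pi, (2 * pi)%R[) sign_agree s delta t =
    \int[mu]_(t in `[0%R, pi[) sign_agree s delta t)%E.
  rewrite -(ge0_integral_shift pi _ ms s0)//.
  transitivity (\int[mu]_(t in `[0%R, pi[) sign_agree s delta (t + pi)%R)%E.
    congr (integral _ _ _); apply/seteqP; split => t /=; rewrite !in_itv/=; lra.
  apply: eq_integral => t _; rewrite /sign_agree sinDpi.
  by rewrite -addrA (addrC pi) addrA sinDpi !sgrN mulrNN.
rewrite integral_sign_agree_pi// -EFinD -EFinM; congr EFin.
by move: (@pi R) pi0 => q q0; field; rewrite gt_eqF.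
Qed.


(** For [delta] in [[0, pi]] the signs differ on a fraction [delta / pi] of the circle, so
    [tau = 1 - 2 * delta / pi] and [pi / 2 * tau] is the complement of [delta]. Other angles are
    reduced to this case by periods and half-turns. *)
Lemma uniform_sign_agree delta : - (2 * pi) <= delta <= 2 * pi ->
  exists tau : R, [/\ (\int[U]_t sign_agree 1 delta t = (1 + tau)%:E)%E,
    -1 <= tau <= 1 & sin (pi / 2 * tau) = cos delta].
Proof.
have pi0 := pi_gt0 R.
suff H d : 0 <= d <= 2 * pi -> exists tau : R,
    [/\ (\int[U]_t sign_agree 1 d t = (1 + tau)%:E)%E,
    -1 <= tau <= 1 & sin (pi / 2 * tau) = cos d].
  move=> /andP[d1 d2]; have [d0|d0] := leP 0 delta; first by apply: H; rewrite d0.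
  have [|tau [h1 h2 h3]] := H (delta + 2 * pi); first by apply/andP; split; lra.
  exists tau; split => //; last by rewrite h3 cosD2pi_mul.
  rewrite -h1; apply: eq_integral => t _; rewrite /sign_agree; congr (1 + 1 * (_ * Num.sg _))%:E.
  by rewrite -[RHS]sinD2pi_mul; congr sin; ring.
move=> /andP[d0 d2]; have [dpi|dpi] := leP d pi.
  exists (1 - 2 * d / pi); split.
  - by rewrite uniform_sign_agree_pi ?mul1r// ?d0//; lra.
  - have h : 0 <= d / pi <= 1 by rewrite divr_ge0 ?ler_pdivrMr ?mul1r// ltW.
    by rewrite -mulrA; apply/andP; split; lra.
  - rewrite (_ : pi / 2 * _ = - d + pi / 2); last first.
    by move: (@pi R) pi0 => q q0; field; rewrite gt_eqF.
    by rewrite sinDpihalf cosN.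
exists (- (1 - 2 * (d - pi) / pi)); split.
- rewrite (_ : - (1 - _) = -1 * (1 - 2 * (d - pi) / pi)); last by ring.
  rewrite -uniform_sign_agree_pi; [|lra|apply/andP; split; lra].
  apply: eq_integral => t _; rewrite /sign_agree.
  rewrite (_ : t - (d - pi) = t - d + pi); last by ring.
  by rewrite sinDpi sgrN mul1r mulN1r mulrN opprK.
- have h : 0 <= (d - pi) / pi <= 1.
    by rewrite divr_ge0 ?ler_pdivrMr ?mul1r ?(ltW pi0)//; lra.
  by rewrite -mulrA; apply/andP; split; lra.
- rewrite (_ : pi / 2 * _ = (d - pi) - pi / 2); last first.
    by move: (@pi R) pi0 => q q0; field; rewrite gt_eqF.
  by rewrite sinBpihalf -cosDpi subrK.
Qed.

(** Two rotations of the uniform angle, by [alpha1] and by [3 / 2 * pi], turn the cosines into sines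
    at phases [0] and [alpha2 - alpha1]. *)
Lemma uniform_cos_agree alpha1 alpha2 : 0 <= alpha1 <= 2 * pi -> 0 <= alpha2 <= 2 * pi ->
  exists tau : R, [/\ (\int[U]_t (1 + Num.sg (cos (t - alpha1)) * Num.sg (cos (t - alpha2)))%:E =
     (1 + tau)%:E)%E, -1 <= tau <= 1 & sin (pi / 2 * tau) = cos (alpha1 - alpha2)].
Proof.
move=> /andP[a10 a1p] /andP[a20 a2p]; have pi0 := pi_gt0 R.
have [|tau [h1 h2 h3]] := @uniform_sign_agree (alpha2 - alpha1).
  by apply/andP; split; lra.
exists tau; split => //; last by rewrite h3 -cosN opprB.
have mcos : measurable_fun [set: R] (@cos R) by apply: continuous_measurable_fun; exact: continuous_cos.
pose f t : \bar R := (1 + Num.sg (cos (t - alpha1)) * Num.sg (cos (t - alpha2)))%:E.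
have mf : measurable_fun setT f.
  apply/measurable_EFinP; apply: measurable_funD => //.
  by apply: measurable_funM; apply: (measurableT_comp measurable_sg);
    apply: (measurableT_comp mcos); exact: measurable_funB.
have f0 t : (0 <= f t)%E by rewrite lee_fin; have := sgM_itv (cos (t - alpha1)) (cos (t - alpha2)); lra.
have pf : circle_periodic f.
  by move=> t; rewrite /f !(addrAC t (2 * pi)) !cosD2pi_mul.
rewrite -h1 -[LHS](@uniform_shift _ f alpha1)//; last by rewrite a10.
pose g t := f (t + alpha1).
rewrite -(@uniform_shift _ g (3 / 2 * pi))//; last first.
- by move=> t; rewrite /g addrAC; exact: pf.
- by move=> t; exact: f0.
- by apply: (measurableT_comp mf); exact: measurable_shift.
- by apply/andP; split; lra.
apply: eq_integral => t _; rewrite /g /f /sign_agree mul1r.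
have e x : cos (x + 3 / 2 * pi) = sin x.
  rewrite (_ : x + _ = x + pi + pi / 2); last by move: (@pi R) => q; field.
  by rewrite cosDpihalf sinDpi opprK.
congr (1 + Num.sg _ * Num.sg _)%:E.
- by rewrite -e; congr cos; ring.
- by rewrite -e; congr cos; ring.
Qed.

End circle_signs.

(** * Exceptional angles and radii *)

Section uniform_angle.
Context {R : realType}.
Notation U := (uniform_prob (@zero_lt_2pi R)).

(** The angle 0 has to be left out: at it, two points of equal radius coincide and have no direction
    of difference. *)
Lemma uniform_eq_integral (f g : R -> \bar R) :
  measurable_fun setT f -> measurable_fun setT g ->
  (forall t, 0 <= f t)%E -> (forall t, 0 <= g t)%E ->
  (forall t, 0 < t < 2 * pi -> f t = g t) ->
  (\int[U]_t f t = \int[U]_t g t)%E.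
Proof.
move=> mf mg f0 g0 fg; rewrite !integral_uniform_circle//; congr (_ * _)%E.
rewrite !integral_itv_bndoo; try exact: measurable_funTS.
by apply: eq_integral => t; rewrite inE/= in_itv/=; exact: fg.
Qed.

Lemma positive_eq_integral (nu : probability R R) (f g : R -> \bar R) :
  nu `]0, +oo[%classic = 1%E ->
  measurable_fun setT f -> measurable_fun setT g ->
  (forall t, 0 <= f t)%E -> (forall t, 0 <= g t)%E ->
  (forall r, 0 < r -> f r = g r) ->
  (\int[nu]_r f r = \int[nu]_r g r)%E.
Proof.
move=> nu1 mf mg f0 g0 fg.
have mI : measurable (`]0, +oo[%classic : set R) by [].
apply: ge0_ae_eq_integral => //.
exists (~` `]0, +oo[%classic); split; first exact: measurableC.
  by have := probability_setC nu mI; rewrite nu1 subee.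
move=> r /= h rI; apply: h => _; apply: fg.
by move: rI; rewrite in_itv/= andbT.
Qed.

Lemma integral_cst_prob d (T : measurableType d) (Q : probability T R) (c : \bar R) :
  (\int[Q]_t c = c)%E.
Proof. by rewrite integral_cst// [X in (_ * X)%E]probability_setT mule1. Qed.

Lemma measurable_integral2 d1 d2 (T1 : measurableType d1) (T2 : measurableType d2)
    (Q : probability T2 R) (F : T1 * T2 -> \bar R) :
  measurable_fun setT F -> (forall z, 0 <= F z)%E ->
  measurable_fun setT (fun z => \int[Q]_w F (z, w))%E.
Proof. by move=> mF F0; apply: measurable_fun_fubini_tonelli_F. Qed.

End uniform_angle.

(** * Concordance of two copies of an elliptical pair *)

Section elliptical.
Context d (T : measurableType d) (R : realType) (P : probability T R).
Notation U := (uniform_prob (@zero_lt_2pi R)).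
Variables (X Y : T -> R) (m1 m2 a11 a12 a21 a22 : R) (nu : probability R R).
Hypotheses (mX : measurable_fun setT X) (mY : measurable_fun setT Y).
Hypothesis nu1 : nu `]0, +oo[%classic = 1%E.
Let c1 (r t : R) := m1 + r * (a11 * cos t + a12 * sin t).
Let c2 (r t : R) := m2 + r * (a21 * cos t + a22 * sin t).
Hypothesis lawXY : forall B : set (R * R), measurable B ->
  P [set w | B (X w, Y w)] =
  (nu \x U)%E [set t : R * R | B (c1 t.1 t.2, c2 t.1 t.2)].

Lemma measurable_ray (m a b : R) d' (S : measurableType d') (r t : S -> R) :
  measurable_fun setT r -> measurable_fun setT t ->
  measurable_fun setT (fun s => m + r s * (a * cos (t s) + b * sin (t s))).
Proof.
move=> mr mt.
have mcos : measurable_fun [set: R] (@cos R) by apply: continuous_measurable_fun; exact: continuous_cos.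
have msin : measurable_fun [set: R] (@sin R) by apply: continuous_measurable_fun; exact: continuous_sin.
apply: measurable_funD => //; apply: measurable_funM => //; apply: measurable_funD.
- by apply: measurable_funM => //; exact: (measurableT_comp mcos).
- by apply: measurable_funM => //; exact: (measurableT_comp msin).
Qed.

Lemma integral_elliptical (F : R * R -> \bar R) :
  measurable_fun setT F -> (forall z, 0 <= F z)%E ->
  (\int[P]_w F (X w, Y w) = \int[nu]_r \int[U]_t F (c1 r t, c2 r t))%E.
Proof.
move=> mF F0.
have mXY : measurable_fun setT (fun w => (X w, Y w)) by exact: measurable_fun_pair.
pose phi (t : R * measurableTypeR R) : R * R := (c1 t.1 t.2, c2 t.1 t.2).
have mphi : measurable_fun setT phi.
  by apply: measurable_fun_pair; apply: measurable_ray.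
pose Q : {measure set (R * measurableTypeR R) -> \bar R} := (nu \x U)%E.
transitivity (\int[Q]_t (F \o phi) t)%E.
  have := ge0_integral_pushforward mXY P measurableT mF (fun y _ => F0 y).
  rewrite preimage_setT => <-.
  have := ge0_integral_pushforward mphi Q measurableT mF (fun y _ => F0 y).
  rewrite preimage_setT => <-.
  pose n1 : {measure set (R * R) -> \bar R} := pushforward P (fun w => (X w, Y w)).
  pose n2 : {measure set (R * R) -> \bar R} := pushforward Q phi.
  by apply: (eq_measure_integral (n2 mphi) (m1 := n1 mXY)) => A mA _; exact: lawXY.
rewrite fubini_tonelli1//=.
  by apply: measurableT_comp.
Qed.

Let K (r t r' t' : R) : \bar R :=
  (1 + Num.sg (c1 r t - c1 r' t') * Num.sg (c2 r t - c2 r' t'))%:E.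

Lemma concordance_ge0 (x y : R) : (0 <= (1 + Num.sg x * Num.sg y)%:E)%E.
Proof. by rewrite lee_fin; have := sgM_itv x y; lra. Qed.

Lemma measurable_concordance d' (S : measurableType d') (f1 f2 g1 g2 : S -> R) :
  measurable_fun setT f1 -> measurable_fun setT f2 ->
  measurable_fun setT g1 -> measurable_fun setT g2 ->
  measurable_fun setT (fun s => (1 + Num.sg (f1 s - g1 s) * Num.sg (f2 s - g2 s))%:E).
Proof.
move=> *; apply/measurable_EFinP; apply: measurable_funD => //.
by apply: measurable_funM; apply: (measurableT_comp measurable_sg); exact: measurable_funB.
Qed.

Let measurable_K d' (S : measurableType d') (r t r' t' : S -> R) :
  measurable_fun setT r -> measurable_fun setT t ->
  measurable_fun setT r' -> measurable_fun setT t' ->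
  measurable_fun setT (fun s => K (r s) (t s) (r' s) (t' s)).
Proof. by move=> *; apply: measurable_concordance; exact: measurable_ray. Qed.

Variables (rho1 rho2 alpha1 alpha2 : R).
Hypotheses (r1 : 0 < rho1) (r2 : 0 < rho2).
Hypotheses (e11 : a11 = rho1 * cos alpha1) (e12 : a12 = rho1 * sin alpha1).
Hypotheses (e21 : a21 = rho2 * cos alpha2) (e22 : a22 = rho2 * sin alpha2).

Let kappa : \bar R :=
  (\int[U]_t (1 + Num.sg (cos (t - alpha1)) * Num.sg (cos (t - alpha2)))%:E)%E.

(* Seen from the rotated frame, the difference of two points of the two circles is
   a fixed nonzero vector turned by [t'], so only the angle between the two rows
   of the scatter matrix matters. *)
Lemma rotated_difference (r t r' : R) : 0 < r -> 0 < r' -> 0 < t < 2 * pi ->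
  (\int[U]_t' K r (t + t')%R r' t' = kappa)%E.
Proof.
move=> rp rp' /andP[t0 t2]; have pi0 := pi_gt0 R.
have [rho [beta [rho0 hbeta eb1 eb2]]] := polar_coordinates (r * cos t - r') (r * sin t).
(* A zero difference would need [sin t = 0], that is [t = pi] inside the open interval; but then its
   first coordinate is [- r - r'], which is negative. *)
have rhop : 0 < rho.
  rewrite lt_neqAle eq_sym rho0 andbT; apply/eqP => rho00.
  move: eb1 eb2; rewrite rho00 !mul0r => eb1 /eqP; rewrite mulf_eq0 gt_eqF//= => /eqP st.
  have tpi : t = pi.
    apply: contrapT => /eqP; rewrite neq_lt => /orP[tp|tp].
      by have := @sin_gt0_pi R t; rewrite t0 tp st ltxx => /(_ erefl).
    have : 0 < sin (t - pi) by apply: sin_gt0_pi; apply/andP; split; lra.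
    by rewrite sinB cospi sinpi st; lra.
  by move: eb1; rewrite tpi cospi; lra.
have key m a b rho' al (t' : R) : 0 < rho' -> a = rho' * cos al -> b = rho' * sin al ->
    Num.sg ((m + r * (a * cos (t + t') + b * sin (t + t'))) -
            (m + r' * (a * cos t' + b * sin t'))) = Num.sg (cos (t' + beta - al)).
  move=> rho'p -> ->.
  have -> : (m + r * (rho' * cos al * cos (t + t') + rho' * sin al * sin (t + t'))) -
      (m + r' * (rho' * cos al * cos t' + rho' * sin al * sin t')) =
    rho' * ((r * cos t - r') * cos (t' - al) - (r * sin t) * sin (t' - al)).
    by rewrite cosB sinB cosD sinD; ring.
  rewrite eb1 eb2 (_ : _ - _ = rho * cos (t' + beta - al)); last first.
    by rewrite (_ : t' + beta - al = beta + (t' - al)) ?cosD; ring.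
  by rewrite !sgrM (gtr0_sg rho'p) (gtr0_sg rhop) !mul1r.
pose f (s : R) : \bar R := (1 + Num.sg (cos (s - alpha1)) * Num.sg (cos (s - alpha2)))%:E.
have mcos : measurable_fun [set: R] (@cos R) by apply: continuous_measurable_fun; exact: continuous_cos.
transitivity (\int[U]_t' f (t' + beta)%R)%E.
  by apply: eq_integral => t' _; rewrite /K /c1 /c2 (key _ _ _ rho1 alpha1)// (key _ _ _ rho2 alpha2).
rewrite uniform_shift//.
- apply/measurable_EFinP; apply: measurable_funD => //.
  by apply: measurable_funM; apply: (measurableT_comp measurable_sg);
    apply: (measurableT_comp mcos); exact: measurable_funB.
- by move=> s; exact: concordance_ge0.
- by move=> s; rewrite /f !(addrAC s (2 * pi)) !cosD2pi_mul.
Qed.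

(** For fixed [t'], rotation invariance replaces [t] by [t + t'], so that [t] becomes the angle
    between the two points. Integrating over [t'] first then gives [kappa] for every [t] in the open
    interval. *)
Lemma integral_two_angles (r r' : R) : 0 < r -> 0 < r' ->
  (\int[U]_t \int[U]_t' K r t r' t' = kappa)%E.
Proof.
move=> rp rp'; have pi0 := pi_gt0 R.
have K0 a b c e : (0 <= K a b c e)%E by exact: concordance_ge0.
have mK1 : measurable_fun setT (fun z : measurableTypeR R * measurableTypeR R => K r z.1 r' z.2) by exact: measurable_K.
have mK2 : measurable_fun setT (fun z : measurableTypeR R * measurableTypeR R => K r (z.1 + z.2) r' z.2).
  by apply: measurable_K => //; exact: measurable_funD.
have mK1' : measurable_fun setT (fun z : measurableTypeR R * measurableTypeR R => K r z.2 r' z.1) by exact: measurable_K.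
have mK2' : measurable_fun setT (fun z : measurableTypeR R * measurableTypeR R => K r (z.2 + z.1) r' z.1).
  by apply: measurable_K => //; exact: measurable_funD.
rewrite (@fubini_tonelli _ _ _ _ _ U U (fun z => K r z.1 r' z.2))//=.
transitivity (\int[U]_t' \int[U]_t K r (t + t')%R r' t')%E.
  apply: uniform_eq_integral.
  - apply: (@measurable_integral2 _ _ _ _ _ U _ mK1') => z; exact: K0.
  - apply: (@measurable_integral2 _ _ _ _ _ U _ mK2') => z; exact: K0.
  - by move=> t; apply: integral_ge0.
  - by move=> t; apply: integral_ge0.
  move=> t' /andP[t'0 t'2]; rewrite (@uniform_shift _ (fun t => K r t r' t'))//.
  - by apply/andP; split; lra.
  - by apply: measurable_K => //; exact: measurable_cst.
  - by move=> t; rewrite /K /c1 /c2 !cosD2pi_mul !sinD2pi_mul.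
rewrite -(@fubini_tonelli _ _ _ _ _ U U (fun z => K r (z.1 + z.2)%R r' z.2))//=.
rewrite (@uniform_eq_integral _ _ (cst kappa)).
- exact: integral_cst_prob.
- apply: (@measurable_integral2 _ _ _ _ _ U _ mK2) => z; exact: K0.
- exact: measurable_cst.
- by move=> t; apply: integral_ge0.
- by move=> t; apply: integral_ge0 => s _; exact: concordance_ge0.
by move=> t tI; exact: rotated_difference.
Qed.

(** The average over both angles is [kappa] for all positive radii, and the radii are almost surely
    positive. What has to be arranged is the order of the four integrals: the radius of the second
    copy is moved outside the angle of the first. *)
Lemma kendall_elliptical :
  (\int[P]_w \int[P]_w' (1 + Num.sg (X w - X w') * Num.sg (Y w - Y w'))%:E = kappa)%E.
Proof.
have K0 a b c e : (0 <= K a b c e)%E by exact: concordance_ge0.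
pose F (z z' : R * R) : \bar R := (1 + Num.sg (z.1 - z'.1) * Num.sg (z.2 - z'.2))%:E.
have kappa0 : (0 <= kappa)%E by apply: integral_ge0 => s _; exact: concordance_ge0.
pose H z : \bar R := (\int[P]_w F z (X w, Y w))%E.
have mH : measurable_fun setT H.
  apply: (@measurable_integral2 _ _ _ _ _ P (fun zw => F zw.1 (X zw.2, Y zw.2))) => [|z].
    apply: measurable_concordance => /=.
    - exact: (measurableT_comp measurable_fst measurable_fst).
    - exact: (measurableT_comp measurable_snd measurable_fst).
    - exact: (measurableT_comp mX measurable_snd).
    - exact: (measurableT_comp mY measurable_snd).
  exact: concordance_ge0.
have H0 z : (0 <= H z)%E by apply: integral_ge0 => s _; exact: concordance_ge0.
have HE z : H z = (\int[nu]_r \int[U]_t F z (c1 r t, c2 r t))%E.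
  apply: (@integral_elliptical (F z)) => [|z'].
    by apply: measurable_concordance => //; exact: measurable_cst.
  exact: concordance_ge0.
have mphi : measurable_fun setT (fun t : R * measurableTypeR R => (c1 t.1 t.2, c2 t.1 t.2)).
  by apply: measurable_fun_pair; apply: measurable_ray.
transitivity (\int[P]_w H (X w, Y w))%E; first by [].
rewrite (integral_elliptical mH H0).
rewrite (@positive_eq_integral _ nu _ (cst kappa))//.
- exact: integral_cst_prob.
- apply: (@measurable_integral2 _ _ _ _ _ U (fun rt => H (c1 rt.1 rt.2, c2 rt.1 rt.2))) => [|z].
    exact: (measurableT_comp mH mphi).
  exact: H0.
- by move=> r; apply: integral_ge0.
move=> r rp /=.
pose L (t r' : R) : \bar R := (\int[U]_t' K r t r' t')%E.
have L0 t r' : (0 <= L t r')%E by apply: integral_ge0.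
have mL : measurable_fun setT (fun z : measurableTypeR R * R => L z.1 z.2).
  apply: (@measurable_integral2 _ _ _ _ _ U
    (fun z : (measurableTypeR R * R) * measurableTypeR R => K r z.1.1 z.1.2 z.2)) => //.
  apply: measurable_K => //.
  - exact: (measurableT_comp measurable_fst measurable_fst).
  - exact: (measurableT_comp measurable_snd measurable_fst).
transitivity (\int[U]_t \int[nu]_r' L t r')%E.
  by apply: eq_integral => t _; rewrite HE.
rewrite (@fubini_tonelli _ _ _ _ _ U nu (fun z => L z.1 z.2))//=.
rewrite (@positive_eq_integral _ nu _ (cst kappa))//.
- exact: integral_cst_prob.
- apply: (@measurable_integral2 _ _ _ _ _ U (fun z : R * measurableTypeR R => L z.2 z.1)) => //.
  have msw : measurable_fun setT (fun z : R * measurableTypeR R => (z.2, z.1)).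
    exact: measurable_fun_pair.
  exact: (measurableT_comp mL msw).
- by move=> r'; apply: integral_ge0.
by move=> r' rp'; exact: integral_two_angles.
Qed.

End elliptical.

(** * Centre, moments and correlation of an elliptical pair *)

Section elliptical_moments.
Context d (T : measurableType d) (R : realType) (P : probability T R).
Notation U := (uniform_prob (@zero_lt_2pi R)).

(** A quarter turn exchanges the squares of cosine and sine, whose sum is 1. *)
Lemma uniform_cos_sqr (alpha : R) : 0 <= alpha <= 2 * pi ->
  (\int[U]_t (cos (t - alpha) ^+ 2)%:E = (2^-1)%:E)%E.
Proof.
move=> ha; have pi0 := pi_gt0 R.
have mcos : measurable_fun [set: R] (@cos R) by apply: continuous_measurable_fun; exact: continuous_cos.
have msin : measurable_fun [set: R] (@sin R) by apply: continuous_measurable_fun; exact: continuous_sin.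
pose f (t : R) : \bar R := (cos (t - alpha) ^+ 2)%:E.
pose g (t : R) : \bar R := (sin (t - alpha) ^+ 2)%:E.
have mf : measurable_fun setT f.
  apply/measurable_EFinP; apply: measurable_funX; apply: (measurableT_comp mcos).
  exact: measurable_funB.
have mg : measurable_fun setT g.
  apply/measurable_EFinP; apply: measurable_funX; apply: (measurableT_comp msin).
  exact: measurable_funB.
have f0 t : (0 <= f t)%E by rewrite lee_fin sqr_ge0.
have g0 t : (0 <= g t)%E by rewrite lee_fin sqr_ge0.
have fg : (\int[U]_t f t = \int[U]_t g t)%E.
  rewrite -(@uniform_shift _ f (pi / 2))//.
  - by apply: eq_integral => t _; rewrite /f addrAC cosDpihalf sqrrN.
  - by apply/andP; split; lra.
  - by move=> t; rewrite /f addrAC cosD2pi_mul.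
have : (\int[U]_t f t + \int[U]_t g t = 1)%E.
  rewrite -ge0_integralD//.
  rewrite (eq_integral (cst 1%E)); first exact: integral_cst_prob.
  by move=> t _; rewrite /f /g -EFinD cos2Dsin2.
rewrite -fg; change (\int[U]_t f t + \int[U]_t f t = 1 -> \int[U]_t f t = (2^-1)%:E)%E.
have : (0 <= \int[U]_t f t)%E by apply: integral_ge0.
case: (\int[U]_t f t)%E => [r||]//= r0 [] h.
by congr EFin; lra.
Qed.

Variables (X Y : T -> R).
Hypotheses (X2 : X \in Lfun P 2%:E) (Y2 : Y \in Lfun P 2%:E).
Hypotheses (X0 : (\int[P]_w (X w)%:E = 0)%E) (Y0 : (\int[P]_w (Y w)%:E = 0)%E).

Let mX : measurable_fun setT X.
Proof. by move: X2; rewrite inE => /andP[+ _]; rewrite inE. Qed.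
Let mY : measurable_fun setT Y.
Proof. by move: Y2; rewrite inE => /andP[+ _]; rewrite inE. Qed.

Section centre.
Variables (m1 m2 a11 a12 a21 a22 : R) (nu : probability R R).
Hypothesis lawXY : forall B : set (R * R), measurable B ->
  P [set w | B (X w, Y w)] =
  (nu \x U)%E [set t : R * R | B (m1 + t.1 * (a11 * cos t.2 + a12 * sin t.2),
                                  m2 + t.1 * (a21 * cos t.2 + a22 * sin t.2))].

(** A half-turn of the angle reflects the law in its centre. *)
Lemma elliptical_symmetric (F : R * R -> \bar R) :
  measurable_fun setT F -> (forall z, 0 <= F z)%E ->
  (\int[P]_w F (X w - m1, Y w - m2)%R = \int[P]_w F (m1 - X w, m2 - Y w)%R)%E.
Proof.
move=> mF F0; have pi0 := pi_gt0 R.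
have mp (f g : R * R -> R) : measurable_fun setT f -> measurable_fun setT g ->
    measurable_fun setT (fun z : R * R => F (f z, g z)).
  by move=> mf mg; apply: (measurableT_comp mF); exact: measurable_fun_pair.
rewrite (integral_elliptical mX mY lawXY (F := fun z => F (z.1 - m1, z.2 - m2)))//; last first.
  by apply: mp; exact: measurable_funB.
rewrite (integral_elliptical mX mY lawXY (F := fun z => F (m1 - z.1, m2 - z.2)))//; last first.
  by apply: mp; exact: measurable_funB.
apply: eq_integral => r _ /=.
pose G (t : R) := F (m1 + r * (a11 * cos t + a12 * sin t) - m1,
                     m2 + r * (a21 * cos t + a22 * sin t) - m2).
rewrite -(@uniform_shift _ G pi)//.
- apply: eq_integral => t _; rewrite /G cosDpi sinDpi.
  by congr (F (_, _)); ring.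
- by apply/andP; split; lra.
- apply: (measurableT_comp mF); apply: measurable_fun_pair; apply: measurable_funB => //.
    by apply: measurable_ray => //; exact: measurable_cst.
  by apply: measurable_ray => //; exact: measurable_cst.
- by move=> t; exact: F0.
- by move=> t; rewrite /G !cosD2pi_mul !sinD2pi_mul.
Qed.

(** By symmetry the positive and negative parts of [Z - m] have the same integral, so its mean [- m]
    is zero. The map [k] is one of the two projections, which treats both coordinates at once. *)
Lemma centre_eq0 (Z : T -> R) (m : R) (k : R * R -> R) :
  measurable_fun setT k -> Z \in Lfun P 2%:E -> (\int[P]_w (Z w)%:E = 0)%E ->
  (forall w, Z w - m = k (X w - m1, Y w - m2)) ->
  (forall w, m - Z w = k (m1 - X w, m2 - Y w)) -> m = 0.
Proof.
move=> mk Z2 Z0 h1 h2.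
have iZ : P.-integrable setT (EFin \o Z) by apply/Lfun1_integrable/Lfun2_Lfun1.
have im : P.-integrable setT (EFin \o cst m) by exact: finite_measure_integrable_cst.
have iZm : P.-integrable setT (fun w => (Z w - m)%:E).
  by apply: eq_integrable (integrableB measurableT iZ im).
have e1 : (\int[P]_w (Z w - m)%:E = (- m)%:E)%E.
  have := integralB_EFin measurableT iZ im; rewrite Z0 /= integral_cst_prob sub0e.
  by move=> h; rewrite EFinN -h; apply: eq_integral.
have mpos : measurable_fun setT (fun z => (Num.max (k z) 0)%:E).
  by apply/measurable_EFinP; exact: measurable_maxr.
have := elliptical_symmetric mpos.
have p0 z : (0 <= (Num.max (k z) 0)%:E)%E by rewrite lee_fin le_max lexx orbT.
move=> /(_ p0).
under eq_integral do rewrite -h1.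
under [X in _ = X -> _]eq_integral do rewrite -h2.
move=> e2.
have := integralE P setT (fun w => (Z w - m)%:E).
rewrite e1 => /esym.
rewrite (_ : (\int[P]_x (fun w => (Z w - m)%:E)^\+ x = \int[P]_w (Num.max (Z w - m) 0)%:E)%E); last first.
  by apply: eq_integral => w _; rewrite funeposE -EFin_max.
rewrite (_ : (\int[P]_x (fun w => (Z w - m)%:E)^\- x = \int[P]_w (Num.max (m - Z w) 0)%:E)%E); last first.
  by apply: eq_integral => w _; rewrite funenegE -EFinN -EFin_max opprB.
rewrite -e2.
have : (\int[P]_w (Num.max (Z w - m) 0)%:E)%E \is a fin_num.
  have := integrable_pos_fin_num measurableT iZm.
  rewrite (_ : (\int[P]_x (fun w => (Z w - m)%:E)^\+ x = \int[P]_w (Num.max (Z w - m) 0)%:E)%E)//.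
  by apply: eq_integral => w _; rewrite funeposE -EFin_max.
by move=> /subee -> [] /eqP; rewrite eq_sym oppr_eq0 => /eqP.
Qed.

Lemma elliptical_centre : m1 = 0 /\ m2 = 0.
Proof.
split.
- by apply: (@centre_eq0 X m1 fst).
- by apply: (@centre_eq0 Y m2 snd).
Qed.

(** At a fixed radius, a linear combination of the centred pair is a sinusoid whose squared
    amplitude is the squared norm of the combined rows, and a squared cosine averages to [1 / 2]. *)
Lemma elliptical_quadratic_moment (s1 s2 : R) :
  (\int[P]_w ((s1 * X w + s2 * Y w) ^+ 2)%:E =
   (((s1 * a11 + s2 * a21) ^+ 2 + (s1 * a12 + s2 * a22) ^+ 2) / 2)%:E *
   \int[nu]_r (r ^+ 2)%:E)%E.
Proof.
have [m10 m20] := elliptical_centre.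
pose F (z : R * R) : \bar R := ((s1 * z.1 + s2 * z.2) ^+ 2)%:E.
have mF : measurable_fun setT F.
  apply/measurable_EFinP; apply: measurable_funX; apply: measurable_funD; exact: measurable_funM.
have F0 z : (0 <= F z)%E by rewrite lee_fin sqr_ge0.
have := integral_elliptical mX mY lawXY mF F0; rewrite /F/= => ->.
have [rho [alpha [rho0 ha ea eb]]] := polar_coordinates (s1 * a11 + s2 * a21) (s1 * a12 + s2 * a22).
rewrite ea eb (_ : (rho * cos alpha) ^+ 2 + (rho * sin alpha) ^+ 2 = rho ^+ 2); last first.
  by rewrite !exprMn -mulrDr cos2Dsin2 mulr1.
have mcos : measurable_fun [set: R] (@cos R) by apply: continuous_measurable_fun; exact: continuous_cos.
rewrite -ge0_integralZl//; last 3 first.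
- by apply/measurable_EFinP; exact: measurable_funX.
- by move=> r _; rewrite lee_fin sqr_ge0.
- by rewrite lee_fin divr_ge0// sqr_ge0.
apply: eq_integral => r _.
rewrite (eq_integral (fun t : measurableTypeR R => ((r ^+ 2 * rho ^+ 2)%:E * (cos (t - alpha) ^+ 2)%:E)%E)); last first.
  move=> t _; rewrite m10 m20 -EFinM; congr EFin; rewrite -!exprMn; congr (_ ^+ 2).
  rewrite cosB.
  rewrite (_ : _ + _ = r * ((s1 * a11 + s2 * a21) * cos t + (s1 * a12 + s2 * a22) * sin t)); last by ring.
  by rewrite ea eb; ring.
rewrite ge0_integralZl//; last 3 first.
- apply/measurable_EFinP; apply: measurable_funX; apply: (measurableT_comp mcos).
  exact: measurable_funB.
- by move=> t _; rewrite lee_fin sqr_ge0.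
- by rewrite lee_fin mulr_ge0// sqr_ge0.
by rewrite uniform_cos_sqr// -!EFinM; congr EFin; ring.
Qed.

End centre.

Lemma kendall_elliptical_covariance :
  bivariate_elliptical P X Y -> (0 < \int[P]_w (X w ^+ 2)%:E)%E ->
  exists tau : R,
    (\int[P]_w \int[P]_w' (1 + Num.sg (X w - X w') * Num.sg (Y w - Y w'))%:E
      = (1 + tau)%:E)%E /\
    Num.sqrt (fine (\int[P]_w (X w ^+ 2)%:E)) * Num.sqrt (fine (\int[P]_w (Y w ^+ 2)%:E)) *
      sin (pi / 2 * tau) = fine (\int[P]_w (X w * Y w)%:E).
Proof.
move=> [m1 [m2 [a11 [a12 [a21 [a22 [nu [nu1 lawXY]]]]]]]] VX0.
have Q := elliptical_quadratic_moment lawXY.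
have [rho1 [alpha1 [rho10 h1 e11 e12]]] := polar_coordinates a11 a12.
have [rho2 [alpha2 [rho20 h2 e21 e22]]] := polar_coordinates a21 a22.
have n1 : a11 ^+ 2 + a12 ^+ 2 = rho1 ^+ 2 by rewrite e11 e12 !exprMn -mulrDr cos2Dsin2 mulr1.
have n2 : a21 ^+ 2 + a22 ^+ 2 = rho2 ^+ 2 by rewrite e21 e22 !exprMn -mulrDr cos2Dsin2 mulr1.
have VX : (\int[P]_w (X w ^+ 2)%:E = (rho1 ^+ 2 / 2)%:E * \int[nu]_r (r ^+ 2)%:E)%E.
  have := Q 1 0; rewrite !mul1r !mul0r !addr0 n1 => <-.
  by apply: eq_integral => w _; rewrite mul1r mul0r addr0.
have VY : (\int[P]_w (Y w ^+ 2)%:E = (rho2 ^+ 2 / 2)%:E * \int[nu]_r (r ^+ 2)%:E)%E.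
  have := Q 0 1; rewrite !mul1r !mul0r !add0r n2 => <-.
  by apply: eq_integral => w _; rewrite mul1r mul0r add0r.
have iX2 : P.-integrable setT (fun w => (X w ^+ 2)%:E) by exact: Lfun2_integrable_sqr.
have iY2 : P.-integrable setT (fun w => (Y w ^+ 2)%:E) by exact: Lfun2_integrable_sqr.
have iXY : P.-integrable setT (fun w => (X w * Y w)%:E) by exact: Lfun2_integrableM.
have e20 : (0 <= \int[nu]_r (r ^+ 2)%:E)%E by apply: integral_ge0 => r _; rewrite lee_fin sqr_ge0.
have rho1n : rho1 != 0.
  by apply/eqP => r0; move: VX0; rewrite VX r0 expr0n/= mul0r mul0e ltxx.
have rho1p : 0 < rho1 by rewrite lt_neqAle eq_sym rho1n.
have [e eE] : exists e : R, (\int[nu]_r (r ^+ 2)%:E = e%:E)%E.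
  have := integrable_fin_num measurableT iX2; rewrite VX.
  case: (\int[nu]_r (r ^+ 2)%:E)%E e20 => [e _ _|_|//]; first by exists e.
  by rewrite gt0_muley// lte_fin divr_gt0// exprn_gt0.
have e0 : 0 <= e by move: e20; rewrite eE lee_fin.
rewrite eE -EFinM in VX; rewrite eE -EFinM in VY.
(* The covariance follows by polarisation from the second moment of [X + Y]. The squared norm of the
   sum of the two rows contains [2 * rho1 * rho2 * cos (alpha1 - alpha2)]. *)
have cov : (\int[P]_w (X w * Y w)%:E = (rho1 * rho2 / 2 * e * cos (alpha1 - alpha2))%:E)%E.
  have := Q 1 1; rewrite !mul1r eE -EFinM.
  rewrite (eq_integral (fun w => ((X w ^+ 2)%:E + ((2%:E * (X w * Y w)%:E) + (Y w ^+ 2)%:E))%E)); last first.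
    by move=> w _; rewrite -EFinM -!EFinD; congr EFin; ring.
  have i2 : P.-integrable setT (fun w => (2%:E * (X w * Y w)%:E)%E) by exact: integrableZl.
  rewrite integralD//; last exact: integrableD.
  rewrite integralD// integralZl// VX VY.
  have := integrable_fin_num measurableT iXY.
  case: (\int[P]_w (X w * Y w)%:E)%E => [c _|//|//].
  rewrite -EFinM -!EFinD => -[h]; congr EFin.
  have h' : (a11 + a21) ^+ 2 + (a12 + a22) ^+ 2 =
      rho1 ^+ 2 + rho2 ^+ 2 + 2 * (rho1 * rho2 * cos (alpha1 - alpha2)).
    by rewrite -n1 -n2 cosB e11 e12 e21 e22; ring.
  by move: h; rewrite h'; lra.
have sqe : Num.sqrt (e / 2) ^+ 2 = e / 2 by rewrite sqr_sqrtr// divr_ge0.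
have sq (rho : R) : 0 <= rho -> Num.sqrt (rho ^+ 2 / 2 * e) = rho * Num.sqrt (e / 2).
  by move=> r0; rewrite -mulrA (mulrC _ e) sqrtrM ?sqr_ge0// sqrtr_sqr ger0_norm.
rewrite VX VY cov/= !sq//.
(* If the second row vanishes, both sides of the covariance identity are zero, so [tau] may be
   whatever the finite integral dictates. *)
have [r20|r2n] := eqVneq rho2 0.
  pose I := (\int[P]_w \int[P]_w' (1 + Num.sg (X w - X w') * Num.sg (Y w - Y w'))%:E)%E.
  exists (fine I - 1); split; last by rewrite r20 !(mul0r, mulr0).
  rewrite addrC subrK fineK//.
  have I0 w w' : (0 <= (1 + Num.sg (X w - X w') * Num.sg (Y w - Y w'))%:E)%E.
    exact: concordance_ge0.
  have mI : measurable_fun setT (fun z : T * T =>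
      (1 + Num.sg (X z.1 - X z.2) * Num.sg (Y z.1 - Y z.2))%:E).
    by apply: measurable_concordance; apply: measurableT_comp.
  rewrite ge0_fin_numE; last by apply: integral_ge0 => w _; apply: integral_ge0.
  apply: (@le_lt_trans _ _ 2%:E); last exact: ltry.
  rewrite -[leRHS](integral_cst_prob P); apply: ge0_le_integral => //.
  - by move=> w _; apply: integral_ge0.
  - exact: (@measurable_integral2 _ _ _ _ _ P _ mI).
  move=> w _; rewrite -[leRHS](integral_cst_prob P); apply: ge0_le_integral => //.
  - exact: (measurable_fun_pair2 w mI).
  by move=> w' _; rewrite lee_fin; have := sgM_itv (X w - X w') (Y w - Y w'); lra.
have rho2p : 0 < rho2 by rewrite lt_neqAle eq_sym r2n.
have [tau [t1 _ t3]] := uniform_cos_agree h1 h2.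
exists tau; split; last first.
  rewrite t3; transitivity (rho1 * rho2 * Num.sqrt (e / 2) ^+ 2 * cos (alpha1 - alpha2)).
    by ring.
  by rewrite sqe; ring.
rewrite -t1; exact: (kendall_elliptical mX mY nu1 lawXY rho1p rho2p e11 e12 e21 e22).
Qed.

End elliptical_moments.

(** * Population identities of the transformation model *)

Section model.
Context d (T : measurableType d) (R : realType) (P : probability T R).
Context (p : nat) (x : {RV P >-> p.-tuple R}) (y eps : {RV P >-> R}).
Context (h : R -> R) (beta : 'cV[R]_p).
Hypothesis model : transformation_model x y eps h beta.
Hypothesis x2 : forall j, coordrv x j \in Lfun P 2%:E.

Let mean0 := mean_x model.

Lemma Lfun2_noise : (eps : T -> R) \in Lfun P 2%:E.
Proof.
apply: Lfun2_of_sqr => //.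
have := var_eps model; rewrite /variance covariance.unlock (mean_eps model) /= expectation.unlock.
rewrite (eq_integral (fun w => (eps w ^+ 2)%:E))// => w _.
by rewrite -[LHS]/(((eps w - 0) * (eps w - 0))%:E) subr0 expr2.
Qed.

Lemma noise_mean : (\int[P]_w (eps w)%:E = 0)%E.
Proof. by have := mean_eps model; rewrite expectation.unlock. Qed.

Lemma integral_sqrD (X Y : T -> R) : X \in Lfun P 2%:E -> Y \in Lfun P 2%:E ->
  (\int[P]_w ((X w + Y w) ^+ 2)%:E =
   \int[P]_w (X w ^+ 2)%:E + (2%:E * \int[P]_w (X w * Y w)%:E + \int[P]_w (Y w ^+ 2)%:E))%E.
Proof.
move=> X2 Y2.
have iX2 : P.-integrable setT (fun w => (X w ^+ 2)%:E) by exact: Lfun2_integrable_sqr.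
have iY2 : P.-integrable setT (fun w => (Y w ^+ 2)%:E) by exact: Lfun2_integrable_sqr.
have iXY : P.-integrable setT (fun w => (X w * Y w)%:E) by exact: Lfun2_integrableM.
rewrite (eq_integral (fun w => ((X w ^+ 2)%:E + ((2%:E * (X w * Y w)%:E) + (Y w ^+ 2)%:E))%E)); last first.
  by move=> w _; rewrite -EFinM -!EFinD; congr EFin; ring.
have i2 : P.-integrable setT (fun w => (2%:E * (X w * Y w)%:E)%E) by exact: integrableZl.
rewrite integralD//; last exact: integrableD.
by rewrite integralD// integralZl.
Qed.

(* Expanding [E (eps + u^T x)^2], computed by Fubini, shows that the cross term
   vanishes while only nonnegative functions are integrated. *)
Lemma noise_uncorrelated u : (\int[P]_w (eps w * lincomb u x w)%:E = 0)%E.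
Proof.
have l2 := Lfun2_lincomb x2 u.
have ml := measurable_lincomb x u.
have il2 : P.-integrable setT (fun w => (lincomb u x w ^+ 2)%:E) by exact: Lfun2_integrable_sqr.
have ie2 : P.-integrable setT (fun w => (eps w ^+ 2)%:E).
  by apply: Lfun2_integrable_sqr; exact: Lfun2_noise.
have il : P.-integrable setT (fun w => (lincomb u x w)%:E).
  by apply/Lfun1_integrable/Lfun2_Lfun1.
pose g (t : p.-tuple R) : R := dotp u (col_of_tuple t).
have mg : measurable_fun setT g.
  rewrite (_ : g = fun t => \sum_j u j 0 * tnth t j); last first.
    by apply/funext => t; rewrite /g dotpE; apply: eq_bigr => j _; rewrite mxE.
  apply: measurable_sum => j; apply: measurable_funM => //; exact: measurable_tnth.
pose F (z : R * p.-tuple R) : \bar R := ((z.1 + g z.2) ^+ 2)%:E.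
have mF : measurable_fun setT F.
  apply/measurable_EFinP; apply: measurable_funX; apply: measurable_funD => //.
  exact: (measurableT_comp mg).
have F0 z : (0 <= F z)%E by rewrite lee_fin sqr_ge0.
have := integral_sqrD Lfun2_noise l2.
have := ge0_integral_indep2 (P := P) (X := eps) (Y := x) _ _ (eps_indep model) mF F0.
move=> /(_ _ _) h1; rewrite [X in X = _ -> _](_ : _ = \int[P]_w F (eps w, x w))%E//.
rewrite h1//.
rewrite (eq_integral (fun w => (eps w ^+ 2)%:E + (\int[P]_w' (lincomb u x w' ^+ 2)%:E))%E); last first.
  move=> w _.
  rewrite (eq_integral (fun w' => ((eps w ^+ 2)%:E + (((2 * eps w)%:E * (lincomb u x w')%:E) + (lincomb u x w' ^+ 2)%:E))%E)); last first.
    by move=> w' _; rewrite /F/= -/(lincomb u x w') -EFinM -!EFinD; congr EFin; rewrite /lincomb /g; ring.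
  have i1 : P.-integrable setT (fun w' => ((2 * eps w)%:E * (lincomb u x w')%:E)%E) by exact: integrableZl.
  have i0 : P.-integrable setT (fun w' : T => (eps w ^+ 2)%:E) by exact: finite_measure_integrable_cst.
  rewrite integralD//; last exact: integrableD.
  rewrite integralD// integralZl// (mean_lincomb mean0 x2) mule0 add0e.
  by rewrite integral_cst_prob.
have fl : (\int[P]_w' (lincomb u x w' ^+ 2)%:E)%E \is a fin_num by exact: integrable_fin_num.
rewrite integralD//; last first.
  by rewrite -(fineK fl); exact: finite_measure_integrable_cst.
rewrite integral_cst_prob.
have fe : (\int[P]_w' (eps w' ^+ 2)%:E)%E \is a fin_num by exact: integrable_fin_num.
have : (\int[P]_w (eps w * lincomb u x w)%:E)%E \is a fin_num.
  by apply: integrable_fin_num => //; apply: Lfun2_integrableM => //; exact: Lfun2_noise.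
move: fl fe.
case: (\int[P]_w' (lincomb u x w' ^+ 2)%:E)%E => // l _.
case: (\int[P]_w' (eps w' ^+ 2)%:E)%E => // e _.
case: (\int[P]_w (eps w * lincomb u x w)%:E)%E => // c _.
by rewrite -EFinM -!EFinD => -[hh]; congr EFin; lra.
Qed.

Lemma response_eq w : (h \o y) w = lincomb beta x w + eps w.
Proof. exact: h_model model w. Qed.

Lemma Lfun2_response : h \o y \in Lfun P 2%:E.
Proof.
rewrite (_ : h \o y = lincomb beta x \+ eps); last by apply/funext => w; rewrite response_eq.
have [_ addL] := @Lfun_addr_closed _ _ _ P 2%:E (lee1n _).
by apply: addL; [exact: Lfun2_lincomb|exact: Lfun2_noise].
Qed.

Lemma response_mean : (\int[P]_w ((h \o y) w)%:E = 0)%E.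
Proof.
under eq_integral do rewrite response_eq EFinD.
rewrite integralD//; last 2 first.
- by apply/Lfun1_integrable/Lfun2_Lfun1/Lfun2_lincomb.
- by apply/Lfun1_integrable/Lfun2_Lfun1/Lfun2_noise.
by rewrite noise_mean adde0 mean_lincomb.
Qed.

Lemma response_cov j :
  (\int[P]_w (coordrv x j w * (h \o y) w)%:E = ((cov_mx P x *m beta) j 0)%:E)%E.
Proof.
under eq_integral do rewrite response_eq mulrDr EFinD.
have l2 := Lfun2_lincomb x2 beta; have e2 := Lfun2_noise.
rewrite integralD//; [|exact: Lfun2_integrableM..].
rewrite -lincomb_delta integral_lincombM// dotp_delta.
rewrite [X in (_ + X)%E](_ : _ = 0%E) ?adde0//.
by rewrite -(noise_uncorrelated (delta_mx j 0)); apply: eq_integral => w _; rewrite mulrC.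
Qed.

Lemma response_std : std_dev P (h \o y) = Num.sqrt (fine (\int[P]_w ((h \o y) w ^+ 2)%:E)).
Proof.
have X0 : ('E_P[h \o y] = 0)%E by rewrite expectation.unlock response_mean.
rewrite /std_dev /variance (covariance_centered Lfun2_response Lfun2_response X0).
by congr (Num.sqrt (fine _)); apply: eq_integral => w _; rewrite expr2.
Qed.

(** Ranks do not see [h]: being strictly increasing it preserves the sign of every difference, so
    Kendall's tau of [y] equals that of the elliptical response. Independence of the noise then
    identifies the covariance. *)
Lemma kendall_identity j : bivariate_elliptical P (coordrv x j) (h \o y) ->
  0 < cov_mx P x j j ->
  exists tau : R,
    (\int[P]_w \int[P]_w' (1 + Num.sg (coordrv x j w - coordrv x j w') * Num.sg (y w - y w'))%:E
      = (1 + tau)%:E)%E /\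
    std_dev P (h \o y) * Num.sqrt (cov_mx P x j j) * sin (pi / 2 * tau) =
      (cov_mx P x *m beta) j 0.
Proof.
move=> ell Sjj.
have Sj : (\int[P]_w (coordrv x j w ^+ 2)%:E = (cov_mx P x j j)%:E)%E.
  by rewrite -lincomb_delta integral_lincomb_sqr// qformE mulmx_delta.
have mj : (\int[P]_w (coordrv x j w)%:E = 0)%E.
  by have := mean0 j; rewrite expectation.unlock.
have [|tau [t1 t2]] := kendall_elliptical_covariance (x2 j) Lfun2_response mj response_mean ell.
  by rewrite Sj lte_fin.
exists tau; split; last first.
  by move: t2; rewrite Sj response_cov/= -response_std => <-; ring.
rewrite -t1; apply: eq_integral => w _; apply: eq_integral => w' _.
congr (1 + _ * _)%:E; rewrite /=.
have hmono := h_increasing model.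
case: (ltgtP (y w) (y w')) => [yw|yw|->]; last by rewrite !subrr.
- by rewrite !ltr0_sg// subr_lt0// hmono.
- by rewrite !gtr0_sg// subr_gt0// hmono.
Qed.

End model.

(** * The error bound on the good event *)

Section good_event.
Context {R : realType}.

Lemma sin_lipschitz (a b : R) : `|sin a - sin b| <= `|a - b|.
Proof.
wlog ab : a b / b <= a.
  move=> h; have [ba|/ltW ab] := leP b a; first exact: h.
  by rewrite distrC (distrC a); exact: h.
have sd (x : R) : x \in `]b, a[ -> is_derive x 1 sin (cos x) by move=> _; exact: is_derive_sin.
have sc : {within `[b, a], continuous (@sin R)}.
  by apply: continuous_subspaceT => x; exact: continuous_sin.
have [c _ ->] := MVT_segment ab sd sc.
rewrite normrM ler_piMl//.
by rewrite ler_norml cos_geN1 cos_le1.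
Qed.

(** The difference of roots is [(a - b) / (sqrt a + sqrt b)], and [sqrt b >= M^-1] because
    [b >= M^-1] and [M^-1 <= 1]. *)
Lemma sqrt_lipschitz (M a b : R) : 1 < M -> M^-1 <= b -> 0 <= a ->
  `|Num.sqrt a - Num.sqrt b| <= M * `|a - b|.
Proof.
move=> M1 bM a0.
have M0 : 0 < M by lra.
have Mi : 0 < M^-1 by rewrite invr_gt0.
have b0 : 0 <= b by lra.
have sb : M^-1 <= Num.sqrt b.
  rewrite -(ler_sqr (ltW Mi) (sqrtr_ge0 _)) sqr_sqrtr// (le_trans _ bM)//.
  by rewrite expr2 ler_piMl ?(ltW Mi)// invf_le1// ltW.
have sa := sqrtr_ge0 a.
have -> : a - b = (Num.sqrt a - Num.sqrt b) * (Num.sqrt a + Num.sqrt b).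
  by rewrite -subr_sqr !sqr_sqrtr.
rewrite normrM mulrCA ler_peMr// (ger0_norm (addr_ge0 sa (sqrtr_ge0 b))).
by rewrite -ler_pdivrMl// mulr1; lra.
Qed.

Lemma sqr_invr_sub1 (r u : R) : 0 < r -> `|r ^+ 2 - 1| <= u -> `|r - 1| <= u -> 2 * u <= 1 ->
  (r^-1 - 1) ^+ 2 <= 4 * u ^+ 2.
Proof.
move=> rp; rewrite ler_norml => /andP[r2 _] r1 u1.
have u0 : 0 <= u by apply: le_trans r1.
have -> : (r^-1 - 1) ^+ 2 = (r - 1) ^+ 2 / r ^+ 2 by field; rewrite gt_eqF.
rewrite ler_pdivrMr ?exprn_gt0//.
have q1 : (r - 1) ^+ 2 <= u ^+ 2.
  by rewrite -(real_normK (num_real (r - 1))) ler_sqr ?nnegrE.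
have : 0 <= u ^+ 2 * (r ^+ 2 - 4^-1) by rewrite mulr_ge0 ?sqr_ge0//; lra.
lra.
Qed.

Context {p : nat}.
Implicit Types (S A : 'M[R]_p) (u v beta : 'cV[R]_p).

(** Polarisation: [4 * (A beta) j] is the difference of the forms at [e_j + beta] and [e_j - beta].
    The squared norms of these two vectors add up to [2 * (1 + |beta|^2)], their cross terms
    cancelling. Only deviations of quadratic forms are thus ever needed. *)
Lemma offdiag_deviation S A beta (j : 'I_p) (t : R) : S^T = S -> A^T = A ->
  `|qform A (delta_mx j 0 + beta) - qform S (delta_mx j 0 + beta)| <=
    t * dotp (delta_mx j 0 + beta) (delta_mx j 0 + beta) ->
  `|qform A (delta_mx j 0 - beta) - qform S (delta_mx j 0 - beta)| <=
    t * dotp (delta_mx j 0 - beta) (delta_mx j 0 - beta) ->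
  `|(A *m beta) j 0 - (S *m beta) j 0| <= t * (1 + dotp beta beta) / 2.
Proof.
move=> Ss As.
have qB B : B^T = B -> qform B (delta_mx j 0 - beta) =
    qform B (delta_mx j 0) - 2 * (B *m beta) j 0 + qform B beta.
  move=> Bs; rewrite -[- beta]scaleN1r qformD// -scalemxAr dotpZr dotp_delta qformZ.
  by ring.
have qD B : B^T = B -> qform B (delta_mx j 0 + beta) =
    qform B (delta_mx j 0) + 2 * (B *m beta) j 0 + qform B beta.
  by move=> Bs; rewrite qformD// dotp_delta.
have d1 : dotp (delta_mx j 0) (delta_mx j 0) = 1 :> R by rewrite dotp_delta mxE !eqxx.
have -> : dotp (delta_mx j 0 + beta) (delta_mx j 0 + beta) = 1 + 2 * beta j 0 + dotp beta beta.
  by rewrite dotpDl !dotpDr d1 (dotpC beta) dotp_delta; ring.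
have -> : dotp (delta_mx j 0 - beta) (delta_mx j 0 - beta) = 1 - 2 * beta j 0 + dotp beta beta.
  by rewrite dotpBl !dotpBr d1 (dotpC beta) dotp_delta; ring.
rewrite !qB// !qD//.
by rewrite !ler_norml => /andP[h1 h2] /andP[h3 h4]; apply/andP; split; lra.
Qed.

Lemma l2norm_sqr_le2 u v : l2norm (u + v) ^+ 2 <= 2 * l2norm u ^+ 2 + 2 * l2norm v ^+ 2.
Proof.
have := sqr_ge0 (l2norm (u - v)).
rewrite !l2normE dotpBl !dotpBr dotpDl !dotpDr (dotpC v u); lra.
Qed.

(** The curvature constants are [kappa = (2 * M)^-1] and [eta = B / k] with [B = 2 * K ^ 2 + 1], so
    [288 * eta * s <= kappa] is the condition on [k]. Going through [beta / r] doubles both squared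
    errors: [15488 = 2 * 4 * 1936], and [8 = 2 * 4] for the error of rescaling. *)
Lemma cenet_error_good_event n (D : 'I_n -> p.-tuple R * R) S beta b (tau : 'I_p -> R)
    (s k : nat) (sy sb K M t t' alpha1 alpha2 : R) :
  S^T = S -> 1 < M -> 1 <= K ->
  (forall u, M^-1 * dotp u u <= qform S u) -> (forall j, S j j <= 2 * K ^+ 2) ->
  qform S beta = 1 -> (0 < l0norm beta <= s)%N ->
  0 <= t -> 2 * (t * M) <= 1 -> 0 <= t' ->
  (forall j, `|Sigma_hat_xx D j j - S j j| <= t) ->
  `|qform (Sigma_hat_xx D) beta - qform S beta| <= t * dotp beta beta ->
  (forall j, `|(Sigma_hat_xx D *m beta) j 0 - (S *m beta) j 0| <= t * (1 + dotp beta beta) / 2) ->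
  0 <= sy <= sb ->
  (forall j, sy * Num.sqrt (S j j) * sin (pi / 2 * tau j) = (S *m beta) j 0) ->
  (forall j, `|kendall_tau D j - tau j| <= t') ->
  (forall z : 'I_k.+1 -> 'I_p * bool,
     2^-1 * qform S (\sum_l signed_basis (z l)) <=
     qform (Sigma_hat_xx D) (\sum_l signed_basis (z l))) ->
  576 * M * (2 * K ^+ 2 + 1) * s%:R <= k%:R ->
  0 < alpha1 -> sb * (M * t) + 4 * (sb * K * t') + t * (1 + M) / 2 <= alpha1 / 2 ->
  0 <= alpha2 -> alpha2 * linfnorm beta <= alpha1 ->
  is_cenet D sy alpha1 alpha2 b ->
  l2norm (b - beta) ^+ 2 <= 15488 * M ^+ 2 * s%:R * alpha1 ^+ 2 + 8 * M ^+ 3 * t ^+ 2.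
Proof.
move=> Ss M1 K1 Smin Smax Sb /andP[b0 bs] t0 tM t'0 dj dbeta dcov /andP[sy0 sysb] tauE taud REz ks
  a1 a1E a2 a2b [bfeas bopt].
set A := Sigma_hat_xx D in dj dbeta dcov REz bfeas bopt *.
have As : A^T = A by exact: Sigma_hat_sym.
have M0 : 0 < M by lra.
have Mi : 0 < M^-1 by rewrite invr_gt0.
have sR : 1 <= s%:R :> R by rewrite ler1n (leq_trans b0).
have A0 u : 0 <= qform A u.
  rewrite /A qform_Sigma_hat mulr_ge0 ?invr_ge0//; apply: sumr_ge0 => i _; exact: sqr_ge0.
have bb : dotp beta beta <= M.
  by have := Smin beta; rewrite Sb ler_pdivrMl// mulr1.
have bb0 := dotp_ge0 beta.
have Sjj j : M^-1 <= S j j.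
  have := Smin (delta_mx j 0); rewrite qformE mulmx_delta dotp_delta mxE !eqxx/=.
  by rewrite mulr1.
have Ajj j : 0 <= A j j by have := A0 (delta_mx j 0); rewrite qformE mulmx_delta.
have tM1 : t <= t * M by rewrite ler_peMr// ltW.
pose r := Num.sqrt (qform A beta).
have r2 : r ^+ 2 = qform A beta by rewrite sqr_sqrtr.
have r0 : 0 <= r := sqrtr_ge0 _.
have rdev : `|r ^+ 2 - 1| <= t * M.
  rewrite r2 -Sb (le_trans dbeta)// ler_wpM2l//.
have rhalf : 2^-1 <= r.
  rewrite -(@ler_pXn2r _ 2)// ?nnegrE// expr2.
  by move: rdev; rewrite ler_norml => /andP[h _]; lra.
have rdist : `|r - 1| <= t * M.
  apply: le_trans rdev; have -> : r ^+ 2 - 1 = (r - 1) * (r + 1) by ring.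
  rewrite normrM ler_peMr//.
  by rewrite (ger0_norm (addr_ge0 r0 ler01)); lra.
(* The population identity [tauE] splits the error into three parts: the sample standard deviation,
   Kendall's tau passed through the sine, and the product of the sample covariance with [beta]. *)
have err j : `|(Sigma_hat_xy D sy - A *m beta) j 0| <= alpha1 / 2.
  rewrite [X in `|X|]mxE [X in X + _]mxE [X in _ + X]mxE; set th := sin _.
  have th1 : `|th - sin (pi / 2 * tau j)| <= 2 * t'.
    apply: le_trans (sin_lipschitz _ _) _; rewrite -mulrBr normrM.
    rewrite ger0_norm ?divr_ge0 ?pi_ge0//; apply: ler_pM => //.
      by rewrite divr_ge0 ?pi_ge0.
    by rewrite ltW// pihalf_lt2.
  have sK : Num.sqrt (S j j) <= 2 * K.
    have K2 : 0 <= 2 * K by lra.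
    rewrite -(ler_sqr (sqrtr_ge0 _) K2) sqr_sqrtr; last by have := Sjj j; lra.
    apply: le_trans (Smax j) _; rewrite exprMn; have := sqr_ge0 K; lra.
  have sdev : `|sigma_hat D j - Num.sqrt (S j j)| <= M * t.
    apply: le_trans (sqrt_lipschitz M1 (Sjj j) (Ajj j)) _.
    by rewrite ler_pM2l.
  have -> : sy * sigma_hat D j * th - (A *m beta) j 0 =
    sy * ((sigma_hat D j - Num.sqrt (S j j)) * th) +
    sy * (Num.sqrt (S j j) * (th - sin (pi / 2 * tau j))) -
    ((A *m beta) j 0 - (S *m beta) j 0).
    by rewrite -tauE; ring.
  have e1 : `|sy * ((sigma_hat D j - Num.sqrt (S j j)) * th)| <= sb * (M * t).
    rewrite normrM (ger0_norm sy0) normrM; apply: ler_pM => //.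
    rewrite -[leRHS]mulr1; apply: ler_pM => //; exact: sin_max.
  have e2 : `|sy * (Num.sqrt (S j j) * (th - sin (pi / 2 * tau j)))| <= 4 * (sb * K * t').
    rewrite normrM (ger0_norm sy0) normrM (ger0_norm (sqrtr_ge0 _)).
    rewrite (_ : 4 * _ = sb * ((2 * K) * (2 * t'))); last by ring.
    apply: ler_pM => //; apply: ler_pM => //.
  have e3 : `|(A *m beta) j 0 - (S *m beta) j 0| <= t * (1 + M) / 2.
    apply: le_trans (dcov j) _; rewrite ler_pM2r// ler_wpM2l//; lra.
  apply: le_trans (ler_normB _ _) _; apply: le_trans (lerD (ler_normD _ _) (lexx _)) _.
  lra.
pose B := 2 * K ^+ 2 + 1.
have B0 : 0 < B by rewrite /B; have := sqr_ge0 K; lra.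
have k0 : 0 < k%:R :> R.
  apply: lt_le_trans ks; apply: mulr_gt0; last exact: lt_le_trans ltr01 sR.
  by apply: mulr_gt0; [apply: mulr_gt0; [rewrite ltr0n|exact: M0]|exact: B0].
have RE v : (2 * M)^-1 * dotp v v - B / k%:R * l1norm v ^+ 2 <= qform A v.
  pose Q := A - 2^-1 *: S.
  have Qs : Q^T = Q by rewrite /Q; move: As; move: (A) => A1 A1s; rewrite linearB linearZ/= A1s Ss.
  have QE u : qform Q u = qform A u - 2^-1 * qform S u.
    by rewrite /Q qformDl -[- (_ *: S)]scaleN1r (qformZl (-1)) (qformZl 2^-1) mulN1r.
  (* The condition [2 * (t * M) <= 1] gives [t <= 1 / 2], so a diagonal entry of [Q] is at most
     [S j j / 2 + t], below [B]. *)
  have QB j : Q j j <= B.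
    rewrite /Q mxE [X in _ + X]mxE [X in - X]mxE.
    have := dj j; rewrite ler_norml => /andP[_ h].
    by have := Sjj j; have := Smax j; rewrite /B; lra.
  have := @qform_ge_of_signed_sums _ _ Q B k v Qs QB.
  have Qz (z : 'I_k.+1 -> 'I_p * bool) : 0 <= qform Q (\sum_l signed_basis (z l)).
    by rewrite QE subr_ge0.
  move=> /(_ Qz); rewrite QE => h.
  have h2 : - (B / k%:R * l1norm v ^+ 2) <= qform A v - 2^-1 * qform S v.
    rewrite -(ler_pM2l k0); apply: le_trans h.
    by rewrite le_eqVlt; apply/orP; left; apply/eqP; field; rewrite gt_eqF.
  have := Smin v; rewrite invfM; lra.
have kap0 : 0 < (2 * M)^-1 by rewrite invr_gt0 mulr_gt0.
have eta0 : 0 <= B / k%:R by rewrite divr_ge0// ltW.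
have etas : 288 * (B / k%:R) * s%:R <= (2 * M)^-1.
  have M2 : 0 < 2 * M by rewrite mulr_gt0.
  rewrite -(ler_pM2r k0) -(ler_pM2l M2) [leRHS]mulrA mulfV ?gt_eqF// mul1r.
  apply: le_trans ks; rewrite le_eqVlt; apply/orP; left; apply/eqP.
  by rewrite -/B; field; rewrite gt_eqF.
have main := cenet_error_bound As a1 a2 a2b err rhalf r2 bs kap0 eta0 etas A0 RE bfeas bopt.
have rp : 0 < r by apply: lt_le_trans rhalf; rewrite invr_gt0.
have part1 : l2norm (b - r^-1 *: beta) ^+ 2 <= 7744 * M ^+ 2 * s%:R * alpha1 ^+ 2.
  have M2 : 0 < (2 * M) ^+ 2 by rewrite exprn_gt0// mulr_gt0.
  move: main; rewrite exprVn ler_pdivrMl// => /le_trans; apply.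
  by rewrite le_eqVlt; apply/orP; left; apply/eqP; ring.
have part2 : l2norm (r^-1 *: beta - beta) ^+ 2 <= 4 * M ^+ 3 * t ^+ 2.
  rewrite -[X in _ - X]scale1r -scalerBl l2normE dotpZl dotpZr mulrA -expr2.
  have q := sqr_invr_sub1 rp rdev rdist tM.
  rewrite (_ : 4 * M ^+ 3 * t ^+ 2 = (4 * (t * M) ^+ 2) * M); last by ring.
  by apply: ler_pM => //; exact: sqr_ge0.
rewrite (_ : b - beta = (b - r^-1 *: beta) + (r^-1 *: beta - beta)); last by rewrite addrA subrK.
apply: le_trans (l2norm_sqr_le2 _ _) _.
rewrite (_ : 15488 * _ * _ * _ + _ =
  2 * (7744 * M ^+ 2 * s%:R * alpha1 ^+ 2) + 2 * (4 * M ^+ 3 * t ^+ 2)); last by ring.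
by apply: lerD; rewrite ler_pM2l.
Qed.

End good_event.

(** * Union bounds and bad events *)

Section bad_events.
Context d (T : measurableType d) (R : realType) (P : probability T R).

Lemma union_bound (I : finType) (B : I -> set T) (b : R) :
  (forall i, measurable (B i)) -> (forall i, (P (B i) <= b%:E)%E) ->
  measurable [set w | exists i, B i w] /\
  (P [set w | exists i, B i w] <= (#|I|%:R * b)%:E)%E.
Proof.
move=> mB PB.
have e : [set w | exists i, B i w] = \big[setU/set0]_(i <- enum I) B i.
  rewrite -bigcup_seq; apply/seteqP; split => w /= [i]; first by exists i => //=; rewrite mem_enum.
  by move=> _ ?; exists i.
split; first by rewrite e; exact: bigsetU_measurable.
rewrite e; have : (P (\big[setU/set0]_(i <- enum I) B i) <= (\sum_(i <- enum I) b)%:E)%E.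
  elim: (enum I) => [|i l IH]; first by rewrite !big_nil measure0.
  rewrite !big_cons EFinD; apply: le_trans (leeD (PB i) IH).
  by apply: measureU2 => //; exact: bigsetU_measurable.
by rewrite big_const_seq count_predT -cardE iter_addr_0 -[b *+ _]mulr_natl.
Qed.

Lemma union_bound2 (B C : set T) (b c : R) : measurable B -> measurable C ->
  (P B <= b%:E)%E -> (P C <= c%:E)%E ->
  measurable (B `|` C) /\ (P (B `|` C) <= (b + c)%:E)%E.
Proof.
move=> mB mC PB PC; split; first exact: measurableU.
by rewrite EFinD; apply: le_trans (leeD PB PC); exact: measureU2.
Qed.

Lemma with_prob_setC (B : set T) (c : R) (Q : T -> Prop) : measurable B ->
  (P B <= c%:E)%E -> (forall w, ~ B w -> Q w) -> with_prob_at_least P (1 - c) Q.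
Proof.
move=> mB PB BQ; exists (~` B); split => //; first exact: measurableC.
by rewrite probability_setC// EFinB leeB.
Qed.

Lemma measurable_set_gt (f : T -> R) (t : R) : measurable_fun setT f ->
  measurable [set w | t < f w].
Proof.
move=> mf; rewrite (_ : [set w | _] = f @^-1` `]t, +oo[%classic).
  by rewrite -[X in measurable X]setTI; exact: mf.
by apply/seteqP; split => w /=; rewrite in_itv/= andbT.
Qed.

Context (n p : nat) (x : {RV P >-> p.-tuple R}) (y : {RV P >-> R}).
Context (Z : 'I_n -> {RV P >-> (p.-tuple R * R)%type}).
Variable K : R.
Hypothesis K0 : 0 < K.
Hypothesis mean0 : forall j, ('E_P[coordrv x j] = 0)%E.
Hypothesis psi2x : (psi2norm_vec P x <= K%:E)%E.
Hypothesis iidZ : iid_copies P Z (fun w => (x w, y w)).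

(** Scaling by [dotp u u] lets vectors of any length share one level [t]; the strict inequality
    makes the event empty at [u = 0]. *)
Definition dev_event (t : R) (u : 'cV[R]_p) : set T :=
  [set w | t * dotp u u < `|qform (Sigma_hat_xx (fun i => Z i w)) u - qform (cov_mx P x) u|].

Lemma measurable_dev_event t u : measurable (dev_event t u).
Proof.
apply: measurable_set_gt; apply: measurableT_comp => //.
by apply: measurable_funB => //; exact: measurable_qform_hat.
Qed.

Lemma dev_event_le (lam t : R) u : (0 < n)%N -> 0 <= lam <= dev_max K ->
  (P (dev_event t u) <= (2 * expR (- (n%:R * (lam * t - dev_cst K * lam ^+ 2))))%:E)%E.
Proof.
move=> n0 lam01; have [->|u0] := eqVneq u 0.
  rewrite (_ : dev_event t 0 = set0) ?measure0 ?lee_fin ?mulr_ge0 ?expR_ge0//.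
  by apply/seteqP; split => w //=; rewrite /dev_event/= dotp0l !qform0 mulr0 subrr normr0 ltxx.
have uu : 0 < dotp u u by rewrite lt_neqAle dotp_ge0 eq_sym dotp_eq0 u0.
have l0 : l2norm u != 0 by rewrite -sqrf_eq0 l2normE gt_eqF.
pose v := (l2norm u)^-1 *: u.
have v1 : dotp v v = 1.
  by rewrite dotpZl dotpZr mulrA -expr2 exprVn l2normE mulVf// gt_eqF.
apply: le_trans (qform_hat_deviation K0 mean0 psi2x iidZ n0 t v1 lam01).
apply: le_measure; rewrite ?inE; first exact: measurable_dev_event.
  apply: measurable_set_ge; apply: measurableT_comp => //.
  by apply: measurable_funB => //; exact: measurable_qform_hat.
move=> w; rewrite /dev_event/= => h.
rewrite !qformZ -mulrBr normrM ger0_norm ?sqr_ge0// exprVn l2normE ler_pdivlMl//.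
by rewrite mulrC ltW.
Qed.

Definition kendall_event (t : R) (j : 'I_p) (tau : R) : set T :=
  [set w | t < `|kendall_tau (fun i => Z i w) j - tau|].

Lemma kendall_event_le (theta t : R) j tau : (1 < n)%N -> 0 <= theta <= 4^-1 ->
  (\int[P]_w \int[P]_w' (1 + Num.sg (coordrv x j w - coordrv x j w') * Num.sg (y w - y w'))%:E
      = (1 + tau)%:E)%E ->
  measurable (kendall_event t j tau) /\
  (P (kendall_event t j tau) <= (2 * expR (- (n%:R * (theta * t / 4 - 8 * theta ^+ 2))))%:E)%E.
Proof.
rewrite /kendall_event; case: n Z iidZ => [//|[//|m]] Z' iidZ' _ theta01 tauE.
set event := [set w | _].
pose G (z : (p.-tuple R * R) * (p.-tuple R * R)) : R :=
  Num.sg (tnth z.1.1 j - tnth z.2.1 j) * Num.sg (z.1.2 - z.2.2).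
have mtnth : measurable_fun setT (fun t : p.-tuple R => tnth t j) by exact: measurable_tnth.
have mG : measurable_fun setT G.
  apply: measurable_funM; apply: (measurableT_comp measurable_sg).
    apply: measurable_funB.
      by apply: (measurableT_comp mtnth); apply: measurableT_comp.
    by apply: (measurableT_comp mtnth); apply: measurableT_comp.
  by apply: measurable_funB; apply: measurableT_comp.
have G1 z : `|G z| <= 1 by rewrite normrM mulr_ile1// norm_sg_le1.
have KE w : kendall_tau (fun i => Z' i w) j = ustat (fun i => Z' i) G w.
  by rewrite /kendall_tau /ustat; congr (_ * _); apply: eq_bigr => i _; apply: eq_bigr => l _;
    rewrite /G !mxE.
have eE : event = [set w | t < `|ustat (fun i => Z' i) G w - tau|].
  by apply/seteqP; split => w; rewrite /event/= KE.
have mZ i : measurable_fun setT (Z' i) by [].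
have mu := measurable_ustat mZ mG.
have mgt : measurable event.
  by rewrite eE; apply: measurable_set_gt; apply: measurableT_comp => //; exact: measurable_funB.
split=> //.
have [indZ lawZ] := iidZ'.
have mW : measurable_fun setT (fun w => (x w, y w)) by exact: measurable_fun_pair.
have := ustat_deviation mZ mW (mutually_independent_family indZ) lawZ (tau := tau) (theta := theta)
  t mG G1 tauE theta01.
apply: le_trans; apply: le_measure; rewrite ?inE//.
  by apply: measurable_set_ge; apply: measurableT_comp => //; exact: measurable_funB.
by rewrite eE => w /= /ltW.
Qed.

End bad_events.

(* [A] and [l] stand for [dev_cst K] and [dev_max K]; [a = sqrt (L / N)] with
   [L = ln p]; [t] and [t'] are the deviation levels of the quadratic forms and of
   Kendall's tau, [lam], [theta] and [lam3] the Chernoff parameters for these and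
   for the restricted eigenvalue event, and [c0] the exponent of the latter. *)
Section tuning.
Context {R : realType}.

Lemma tuning_sign (A l K M C' L s sb N tau tau' c0 q C3 T0 E gamma a : R) :
  0 < A -> 0 < l -> 1 <= 2 * (A * l) -> 1 < M -> 1 <= K -> 0 < C' -> 0 < L -> 1 <= s -> 0 <= sb -> 0 < N ->
  0 <= tau -> 0 <= tau' -> c0 = (16 * M ^+ 2 * A)^-1 ->
  q = tau / (2 * A * l) + 2 * (tau * M) + tau' ->
  C3 = q ^+ 2 + 2 * (C' + 1) / c0 ->
  T0 = (C' + 2 + A * l ^+ 2) / l ->
  E = sb * (M * tau) + 4 * (sb * K * tau') + tau * (1 + M) / 2 ->
  1 + 2 * E + (1 + C3) * (sb * (1 + 2 * K ^+ 2 + T0) + 1) <= gamma ->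
  0 <= a -> N * a ^+ 2 = L ->
  [/\ 0 <= q, 0 < c0, 0 <= C3, 0 <= T0 /\ 0 <= sb * (1 + 2 * K ^+ 2 + T0) &
      2 * E <= gamma /\ 1 <= gamma /\ (1 + C3) * (sb * (1 + 2 * K ^+ 2 + T0) + 1) <= gamma].
Proof.
move=> A0 l0 Al M1 K1 C'p Lp s1 sb0 N0 tau0 tau'0 c0E qE C3E T0E EE gE a0 aN.
have M0 : 0 < M := lt_trans ltr01 M1.
have c00 : 0 < c0.
  by rewrite c0E invr_gt0 -mulrA; apply: mulr_gt0 => //; apply: mulr_gt0 => //; exact: exprn_gt0.
have q1 : 0 <= tau / (2 * A * l).
  by apply: divr_ge0 => //; apply: ltW; do 2 (apply: mulr_gt0 => //).
have q2 : 0 <= tau * M by apply: mulr_ge0 => //; exact: ltW.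
have q0 : 0 <= q by rewrite qE !addr_ge0// mulr_ge0.
have D0 : 0 <= 2 * (C' + 1) / c0.
  by apply: divr_ge0; [rewrite mulr_ge0// addr_ge0// ltW|exact: ltW].
have C30 : 0 <= C3 by rewrite C3E addr_ge0// sqr_ge0.
have E0 : 0 <= E.
  have M1p : 0 <= 1 + M by rewrite addr_ge0// ltW.
  have Kp : 0 <= K by exact: le_trans ler01 K1.
  by rewrite EE !addr_ge0 ?divr_ge0 ?mulr_ge0// ltW.
have T00 : 0 <= T0.
  by rewrite T0E divr_ge0 ?(ltW l0)// !addr_ge0 ?(ltW C'p)// mulr_ge0 ?sqr_ge0// ltW.
have sB0 : 0 <= sb * (1 + 2 * K ^+ 2 + T0).
  by rewrite mulr_ge0// !addr_ge0// mulr_ge0// sqr_ge0.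
split=> //.
have CsB : 0 <= (1 + C3) * (sb * (1 + 2 * K ^+ 2 + T0) + 1).
  by rewrite mulr_ge0// addr_ge0.
move: gE CsB; set X := (1 + C3) * _ => gE CsB; clear -gE CsB E0.
by split; [|split]; lra.
Qed.

(** [T0] solves [l * T0 - A * l ^ 2 = C' + 2], the Chernoff exponent at the largest admissible
    parameter. The last summand of the lower bound on [gamma] is made for this regime: it pushes
    [gamma * a] above the bound on the entries. *)
Lemma tuning_small_sample (A l K M C' L s sb N tau tau' c0 q C3 T0 E gamma a alpha1 : R) :
  0 < A -> 0 < l -> 1 <= 2 * (A * l) -> 1 < M -> 1 <= K -> 0 < C' -> 0 < L -> 1 <= s -> 0 <= sb -> 0 < N ->
  0 <= tau -> 0 <= tau' -> c0 = (16 * M ^+ 2 * A)^-1 ->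
  q = tau / (2 * A * l) + 2 * (tau * M) + tau' ->
  C3 = q ^+ 2 + 2 * (C' + 1) / c0 ->
  T0 = (C' + 2 + A * l ^+ 2) / l ->
  E = sb * (M * tau) + 4 * (sb * K * tau') + tau * (1 + M) / 2 ->
  1 + 2 * E + (1 + C3) * (sb * (1 + 2 * K ^+ 2 + T0) + 1) <= gamma ->
  0 <= a -> N * a ^+ 2 = L ->
  N < C3 * L -> 4 * L <= N -> alpha1 = gamma * a ->
  [/\ (C' + 2) * L <= N * (l * T0 - A * l ^+ 2),
      sb * (1 + 2 * K ^+ 2 + T0) < alpha1, 0 <= T0 & 1 <= alpha1].
Proof.
move=> A0 l0 Al M1 K1 C'p Lp s1 sb0 N0 tau0 tau'0 c0E qE C3E T0E EE gE a0 aN nC3 nL aE.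
have [q0 c00 C30 [T00 sB0] [g2 [g1 g3]]] := tuning_sign A0 l0 Al M1 K1 C'p Lp s1 sb0 N0 tau0
  tau'0 c0E qE C3E T0E EE gE a0 aN.
have nT : (C' + 2) * L <= N * (l * T0 - A * l ^+ 2).
  rewrite T0E (_ : _ - _ = C' + 2); last by field; rewrite gt_eqF.
  rewrite mulrC ler_wpM2r// ?addr_ge0// ?ltW//; clear -nL Lp; lra.
move: (sb * _) sB0 g3 => sB sB0 g3.
have Ca : 1 < C3 * a ^+ 2 by rewrite -(ltr_pM2l N0) mulr1 mulrCA aN.
(* From [C3 * a ^ 2 > 1]: if [a < 1] then already [C3 * a > 1], and otherwise the summand [a]
   reaches 1 and [C3 * a] is positive. *)
have Ca1 : 1 < (1 + C3) * a.
  clear -Ca C30 a0; have [ha|ha] := leP 1 a.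
    have : 0 < C3 * a.
      rewrite mulr_gt0//; last by lra.
      rewrite lt_neqAle C30 andbT eq_sym; apply: contraTneq Ca => ->.
      by rewrite mul0r ltr10.
    lra.
  have : C3 * a ^+ 2 <= C3 * a by rewrite ler_wpM2l// expr2 ler_piMl// ltW.
  lra.
have aB : sB + 1 < alpha1.
  have h1 : (1 + C3) * (sB + 1) * a <= gamma * a by rewrite ler_wpM2r.
  have h2 : 0 < (sB + 1) * ((1 + C3) * a - 1).
    by apply: mulr_gt0; [rewrite ltr_wpDl|rewrite subr_gt0].
  rewrite aE; clear -h1 h2; lra.
by clear -nT aB T00 sB0; split=> //; lra.
Qed.

(** Each Chernoff parameter maximises its exponent, the maxima being [t ^ 2 / (4 * A)],
    [t' ^ 2 / 512] and [c0]; [tau] and [tau'] are chosen so that the first two, times [N], equal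
    [(C' + 2) * L]. The summands of [q] encode [lam <= l], [2 * t * M <= 1] and a bound on [theta],
    all ensured by [q * a <= 1], that is by [C3 >= q ^ 2]. For the signed sums, [C1] pays for the
    size of the family and the other part of [C3] for the term in [C']. *)
Lemma tuning_large_sample (A l K M C' L s sb N tau tau' c0 q C3 T0 E gamma a alpha1 C1 : R) (ck : nat) k :
  0 < A -> 0 < l -> 1 <= 2 * (A * l) -> 1 < M -> 1 <= K -> 0 < C' -> 0 < L -> 1 <= s -> 0 <= sb -> 0 < N ->
  0 <= tau -> 0 <= tau' -> c0 = (16 * M ^+ 2 * A)^-1 ->
  q = tau / (2 * A * l) + 2 * (tau * M) + tau' ->
  C3 = q ^+ 2 + 2 * (C' + 1) / c0 ->
  T0 = (C' + 2 + A * l ^+ 2) / l ->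
  E = sb * (M * tau) + 4 * (sb * K * tau') + tau * (1 + M) / 2 ->
  1 + 2 * E + (1 + C3) * (sb * (1 + 2 * K ^+ 2 + T0) + 1) <= gamma ->
  0 <= a -> N * a ^+ 2 = L ->
  C3 * L <= N -> alpha1 = gamma * a -> 8 * ck%:R / c0 <= C1 -> C1 * s * L <= N ->
  tau ^+ 2 = 4 * A * (C' + 2) -> tau' ^+ 2 = 512 * (C' + 2) ->
  1 <= k -> k = ck%:R * s ->
  let t := tau * a in let t' := tau' * a in
  let lam := t / (2 * A) in let theta := t' / 64 in let lam3 := (4 * M * A)^-1 in
  [/\ 0 <= lam <= l /\ (C' + 2) * L <= N * (lam * t - A * lam ^+ 2),
      0 <= theta <= 4^-1 /\ (C' + 2) * L <= N * (theta * t' / 4 - 8 * theta ^+ 2),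
      0 <= lam3 <= l /\
      (2 * (k + 1) + 1 + C') * L <= N * (lam3 * (2 * M)^-1 - A * lam3 ^+ 2),
      [/\ 0 <= t, 2 * (t * M) <= 1 & 0 <= t'] &
      [/\ 0 < alpha1, a <= alpha1 & sb * (M * t) + 4 * (sb * K * t') + t * (1 + M) / 2 <= alpha1 / 2]].
Proof.
move=> A0 l0 Al M1 K1 C'p Lp s1 sb0 N0 tau0 tau'0 c0E qE C3E T0E EE gE a0 aN.
have [q0 c00 C30 [T00 sB0] [g2 [g1 g3]]] := tuning_sign A0 l0 Al M1 K1 C'p Lp s1 sb0 N0 tau0
  tau'0 c0E qE C3E T0E EE gE a0 aN.
move=> nC3 aE C1c nC1 tau2 tau'2 k1 kE t t' lam theta lam3.
have M0 : 0 < M := lt_trans ltr01 M1.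
have An : A != 0 by rewrite gt_eqF.
have lneq : l != 0 by rewrite gt_eqF.
have Mn : M != 0 by rewrite gt_eqF.
have qa : q * a <= 1.
  rewrite -(@ler_pXn2r _ 2)// ?nnegrE ?mulr_ge0// expr1n exprMn.
  rewrite -(ler_pM2l N0) mulr1 mulrCA aN; apply: le_trans nC3.
  by rewrite ler_wpM2r ?(ltW Lp)// C3E lerDl divr_ge0 ?(ltW c00)// mulr_ge0// addr_ge0// ltW.
have qa2 : 0 <= tau / (2 * A * l) * a.
  by rewrite mulr_ge0// divr_ge0// !mulr_ge0// ltW.
have qa3 : 0 <= tau * M * a by rewrite !mulr_ge0// ltW.
have qa4 : 0 <= t' by exact: mulr_ge0.
have t0 : 0 <= t by exact: mulr_ge0.
have qa1 : tau / (2 * A * l) * a + 2 * (tau * M * a) + t' <= 1.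
  by apply: le_trans qa; rewrite qE !mulrDl mulrA.
have MA0 : 0 < 4 * M * A by do 2 (apply: mulr_gt0 => //).
split.
- split.
    apply/andP; split; first by rewrite divr_ge0// mulr_ge0// ltW.
    have li : 0 < l^-1 by rewrite invr_gt0.
    rewrite -(ler_pM2r li) [leRHS]mulfV//.
    rewrite (_ : lam / l = tau / (2 * A * l) * a); last first.
      by rewrite /lam /t; field; rewrite An lneq.
    clear -qa1 qa2 qa3 qa4; lra.
  rewrite (_ : N * _ = (4 * A)^-1 * tau ^+ 2 * (N * a ^+ 2)); last first.
    by rewrite /lam /t; field.
  by rewrite aN tau2 le_eqVlt; apply/orP; left; apply/eqP; field.
- split.
    rewrite /theta; move: (t') qa4 qa1 qa2 qa3 => u; clear; move: (_ * a) (_ * a) => v w *.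
    by apply/andP; split; lra.
  rewrite (_ : N * _ = 512^-1 * tau' ^+ 2 * (N * a ^+ 2)); last first.
    by rewrite /theta /t'; field.
  have n512 : 512 != 0 :> R by rewrite pnatr_eq0.
  by rewrite aN tau'2 (mulKf n512).
- split.
    rewrite invr_ge0 (ltW MA0)/= -(ler_pM2l MA0) mulfV; last by rewrite gt_eqF.
    have : A * l <= M * (A * l) by rewrite ler_peMl ?mulr_ge0 ?ltW.
    clear -Al; lra.
  rewrite (_ : _ - _ = c0); last by rewrite c0E /lam3; field; rewrite An Mn.
  have h1 : 4 * (k * L) <= N * c0 / 2.
    have : 8 * ck%:R / c0 * (s * L) <= N.
      apply: le_trans nC1; rewrite -[leRHS]mulrA ler_wpM2r// mulr_ge0// ltW//.
      exact: lt_le_trans ltr01 s1.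
    rewrite mulrAC ler_pdivrMr// kE; clear; move: (N * c0) => v; lra.
  have h2 : (C' + 1) * L <= N * c0 / 2.
    have : 2 * (C' + 1) / c0 * L <= N.
      by apply: le_trans nC3; rewrite ler_wpM2r ?(ltW Lp)// C3E lerDr sqr_ge0.
    rewrite mulrAC ler_pdivrMr//; clear; move: (N * c0) => v; lra.
  have h4 : L <= k * L by rewrite ler_peMl// ltW.
  move: h1 h2 h4; clear; move: (N * c0) => v; lra.
- split=> //; rewrite /t; clear -qa1 qa2 qa3 qa4; lra.
have apos : 0 < a.
  rewrite lt_neqAle a0 andbT eq_sym; apply: contraTneq Lp => a00.
  by rewrite -aN a00 expr0n/= mulr0 ltxx.
have a1a : a <= alpha1 by rewrite aE ler_peMl.
split=> //; first exact: lt_le_trans a1a.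
rewrite (_ : _ + _ = E * a); last by rewrite EE /t /t'; ring.
have : 2 * E * a <= gamma * a by rewrite ler_wpM2r.
rewrite aE; clear; lra.
Qed.

End tuning.

Lemma dev_cst_gt0 (R : realType) (K : R) : 0 < K -> 0 < dev_cst K.
Proof.
move=> K0; rewrite /dev_cst; apply: mulr_gt0; last exact: exprn_gt0.
by apply: mulr_gt0; [rewrite ltr0n|exact/exprn_gt0/expR_gt0].
Qed.

Lemma dev_max_gt0 (R : realType) (K : R) : 0 < K -> 0 < dev_max K.
Proof.
move=> K0; rewrite /dev_max invr_gt0; apply: mulr_gt0; last exact: exprn_gt0.
by apply: mulr_gt0; [rewrite ltr0n|exact: expR_gt0].
Qed.

(** * Probability of the good event in both regimes *)

Section probability_bounds.
Context d (T : measurableType d) (R : realType) (P : probability T R).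

Lemma ln_nat_ge_half (p : nat) : (1 < p)%N -> 2^-1 <= ln p%:R :> R.
Proof.
move=> p1; rewrite -ler_expR lnK ?posrE ?ltr0n ?(ltn_trans _ p1)//.
have h : 2^-1 <= expR (- 2^-1) :> R by have := expR_ge1Dx (- 2^-1 : R); lra.
have e : expR 2^-1 <= 2 :> R.
  have e0 := expR_gt0 (2^-1 : R).
  have : expR 2^-1 * 2^-1 <= 1 :> R.
    by rewrite -[leRHS](expRxMexpNx_1 2^-1) ler_pM2l.
  lra.
by apply: le_trans e _; rewrite ler_nat.
Qed.

Lemma expR_ln_nat (p : nat) : (0 < p)%N -> expR (ln p%:R) = p%:R :> R.
Proof. by move=> p0; rewrite lnK// posrE ltr0n. Qed.

Context (n p s : nat) (x : {RV P >-> p.-tuple R}) (y eps : {RV P >-> R}).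
Context (h : R -> R) (beta : 'cV[R]_p) (Z : 'I_n -> {RV P >-> (p.-tuple R * R)%type}).
Variables K M C' sb : R.
Hypothesis model : transformation_model x y eps h beta.
Hypothesis K1 : 1 <= K.
Hypothesis psi2x : (psi2norm_vec P x <= K%:E)%E.
Hypothesis iidZ : iid_copies P Z (fun w => (x w, y w)).
Hypothesis M1 : 1 < M.
Hypothesis Smin : forall u, M^-1 * dotp u u <= qform (cov_mx P x) u.
Hypothesis sysb : std_dev P (h \o y) <= sb.
Hypothesis bs : (0 < l0norm beta <= s)%N.
Hypothesis n1 : (1 < n)%N.
Hypothesis p1 : (1 < p)%N.
Hypothesis C'0 : 0 < C'.

Let L : R := ln p%:R.
Let K0 : 0 < K. Proof. exact: lt_le_trans ltr01 K1. Qed.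
Let n0 : (0 < n)%N. Proof. exact: ltnW. Qed.
Let mean0 := mean_x model.
Let S := cov_mx P x.
Let L0 : 0 < L. Proof. by have := ln_nat_ge_half p1; rewrite -/L; lra. Qed.
Let pL : p%:R = expR L. Proof. by rewrite expR_ln_nat// ltnW. Qed.
Let two_le : 2 <= expR L. Proof. by rewrite -pL ler_nat. Qed.

Lemma cov_diag_le (j : 'I_p) : S j j <= 2 * K ^+ 2.
Proof.
have d1 : dotp (delta_mx j 0) (delta_mx j 0) = 1 :> R by rewrite dotp_delta mxE !eqxx.
by have := qform_cov_le K0 mean0 psi2x d1; rewrite qformE mulmx_delta.
Qed.

Lemma dotp_beta_le : dotp beta beta <= M.
Proof.
have M0 : 0 < M := lt_trans ltr01 M1.
by have := Smin beta; rewrite (identifiable model) ler_pdivrMl// mulr1.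
Qed.

Lemma dev_event_diag t (j : 'I_p) w : ~ dev_event x Z t (delta_mx j 0) w ->
  `|Sigma_hat_xx (fun i => Z i w) j j - S j j| <= t.
Proof.
rewrite /dev_event/= dotp_delta mxE !eqxx mulr1 !qformE !mulmx_delta => /negP.
by rewrite -leNgt.
Qed.

(** A family of size at most [p ^ c] costs [c * L] in the exponent; the extra [L] absorbs the factor
    2 of the two tails, since [p >= 2]. *)
Lemma union_dev_event (I : finType) (u : I -> 'cV[R]_p) (lam t c : R) :
  0 <= lam <= dev_max K -> #|I|%:R <= expR (c * L) ->
  (c + 1 + C') * L <= n%:R * (lam * t - dev_cst K * lam ^+ 2) ->
  measurable [set w | exists i, dev_event x Z t (u i) w] /\
  (P [set w | exists i, dev_event x Z t (u i) w] <= (expR (- (C' * L)))%:E)%E.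
Proof.
move=> lam01 cI cn.
have [|i|mB PB] := @union_bound _ _ _ P I (fun i => dev_event x Z t (u i))
  (2 * expR (- (n%:R * (lam * t - dev_cst K * lam ^+ 2)))).
- by move=> i; exact: measurable_dev_event.
- by apply: (dev_event_le K0 mean0 psi2x iidZ).
split=> //; apply: le_trans PB _; rewrite lee_fin.
apply: (@le_trans _ _ (expR (c * L) * (expR L * expR (- ((c + 1 + C') * L))))).
  by rewrite !ler_pM ?mulr_ge0 ?expR_ge0// ler_expR lerN2.
rewrite -!expRD ler_expR le_eqVlt; apply/orP; left; apply/eqP; ring.
Qed.

Lemma cenet_zero_bound (T0 alpha1 alpha2 : R) :
  (C' + 2) * L <= n%:R * (dev_max K * T0 - dev_cst K * dev_max K ^+ 2) ->
  sb * (1 + 2 * K ^+ 2 + T0) < alpha1 -> 0 <= T0 -> 1 <= alpha1 -> 0 <= alpha2 ->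
  with_prob_at_least P (1 - 6 * expR (- (C' * L)))
    (fun w => forall bhat : 'cV[R]_p,
       is_cenet (fun i => Z i w) (std_dev P (h \o y)) alpha1 alpha2 bhat ->
       l2norm (bhat - beta) ^+ 2 <= M * s%:R * alpha1 ^+ 2).
Proof.
move=> nT aT T00 a1 a2.
have lm : 0 <= dev_max K <= dev_max K.
  rewrite lexx andbT /dev_max invr_ge0; apply: mulr_ge0; last exact: sqr_ge0.
  by apply: mulr_ge0 => //; exact: expR_ge0.
have [||mB PB] := @union_dev_event 'I_p (fun j => delta_mx j 0) (dev_max K) T0 1 lm.
- by rewrite card_ord mul1r pL.
- by apply: le_trans nT; rewrite le_eqVlt; apply/orP; left; apply/eqP; ring.
apply: with_prob_setC mB _ _.
  apply: le_trans PB _; rewrite lee_fin.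
  by have := expR_ge0 (- (C' * L)); lra.
move=> w Bw b [_ bopt].
have sy0 : 0 <= std_dev P (h \o y) := sqrtr_ge0 _; have sysb' := sysb.
set sy := std_dev _ _ in sysb' sy0 bopt *.
set D := fun i => Z i w in bopt *.
have Sxy j : `|Sigma_hat_xy D sy j 0| <= sb * (1 + 2 * K ^+ 2 + T0).
  have sjj : Sigma_hat_xx D j j <= 2 * K ^+ 2 + T0.
    have /dev_event_diag : ~ dev_event x Z T0 (delta_mx j 0) w by move=> ?; apply: Bw; exists j.
    by rewrite -/D ler_norml => /andP[_]; have := cov_diag_le j; lra.
  rewrite mxE !normrM (ger0_norm sy0) -mulrA; apply: ler_pM => //.
  rewrite -[leRHS]mulr1; apply: ler_pM => //; last by rewrite sin_max.
  rewrite (ger0_norm (sqrtr_ge0 _)).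
  (* The estimate [sqrt v <= 1 + v] keeps square roots out of the constants. *)
  have B0 : 0 <= 1 + 2 * K ^+ 2 + T0 by have := sqr_ge0 K; lra.
  rewrite -(ler_sqr (sqrtr_ge0 _) B0).
  have [z|z] := leP 0 (Sigma_hat_xx D j j); last first.
    by rewrite ltr0_sqrtr// expr0n sqr_ge0.
  rewrite sqr_sqrtr//; apply: (le_trans sjj).
  have := sqr_ge0 K; set q := K ^+ 2 => q0.
  have : 0 <= (2 * q + T0) ^+ 2 by exact: sqr_ge0.
  lra.
have := bopt 0; rewrite qform0 ler01 => /(_ isT).
rewrite /cenet_objective dotp0l oppr0 add0r.
have n10 : l1norm (0 : 'cV[R]_p) = 0 by rewrite /l1norm big1// => j _; rewrite mxE normr0.
rewrite n10 mulr0 add0r !l2normE dotp0l mulr0 => ob.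
have db : dotp b (Sigma_hat_xy D sy) <= sb * (1 + 2 * K ^+ 2 + T0) * l1norm b.
  rewrite dotpE /l1norm mulr_sumr; apply: ler_sum => j _.
  apply: le_trans (ler_norm _) _; rewrite normrM mulrC; exact: ler_wpM2r.
(* By duality of the l1 and sup norms the linear term is at most [c * l1norm b] with [c < alpha1],
   so the objective is positive at every nonzero [b], while it vanishes at the feasible point 0. *)
have b0 : l1norm b <= 0.
  have bb := dotp_ge0 b.
  have : 0 <= alpha2 * dotp b b by exact: mulr_ge0.
  set c := sb * _ in aT db => h1.
  have : (alpha1 - c) * l1norm b <= 0 by lra.
  by rewrite pmulr_rle0// subr_gt0.
have -> : b = 0.
  apply/matrixP => j k; rewrite ord1 mxE; apply/eqP; rewrite -normr_eq0 eq_le normr_ge0 andbT.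
  apply: le_trans b0; rewrite /l1norm (bigD1 j)//= lerDl; exact: sumr_ge0.
rewrite sub0r -scaleN1r dotpZl dotpZr mulrA mulN1r opprK mul1r.
apply: le_trans dotp_beta_le _; rewrite -mulrA ler_peMr//; first exact: ltW (lt_trans ltr01 M1).
have sR : 1 <= s%:R :> R by case/andP: bs => b1 b2; rewrite ler1n (leq_trans b1).
by rewrite mulr_ege1// exprn_ege1.
Qed.

Hypothesis ell : forall j : 'I_p, bivariate_elliptical P (coordrv x j) (h \o y).

(** The six bad events: the forms at [e_j], at [e_j + beta], at [e_j - beta] and at [beta] deviate
    by more than [t]; some Kendall coefficient deviates by more than [t']; a form at a signed sum
    deviates by more than [(2 * M)^-1]. *)
Lemma cenet_oracle_bound (k : nat) (t t' lam lam3 theta alpha1 alpha2 : R) :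
  0 <= lam <= dev_max K -> (C' + 2) * L <= n%:R * (lam * t - dev_cst K * lam ^+ 2) ->
  0 <= theta <= 4^-1 -> (C' + 2) * L <= n%:R * (theta * t' / 4 - 8 * theta ^+ 2) ->
  0 <= lam3 <= dev_max K ->
  (2 * k.+1%:R + 1 + C') * L <= n%:R * (lam3 * (2 * M)^-1 - dev_cst K * lam3 ^+ 2) ->
  0 <= t -> 2 * (t * M) <= 1 -> 0 <= t' ->
  576 * M * (2 * K ^+ 2 + 1) * s%:R <= k%:R ->
  0 < alpha1 -> sb * (M * t) + 4 * (sb * K * t') + t * (1 + M) / 2 <= alpha1 / 2 ->
  0 <= alpha2 -> alpha2 * linfnorm beta <= alpha1 ->
  with_prob_at_least P (1 - 6 * expR (- (C' * L)))
    (fun w => forall bhat : 'cV[R]_p,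
       is_cenet (fun i => Z i w) (std_dev P (h \o y)) alpha1 alpha2 bhat ->
       l2norm (bhat - beta) ^+ 2 <=
         15488 * M ^+ 2 * s%:R * alpha1 ^+ 2 + 8 * M ^+ 3 * t ^+ 2).
Proof.
move=> lam01 nt theta01 nt' lam301 nk t0 tM t'0 ks a1 a1E a2 a2b.
have M0 : 0 < M := lt_trans ltr01 M1.
have Mi : 0 < M^-1 by rewrite invr_gt0.
have M2i : 0 < (2 * M)^-1 by rewrite invr_gt0 mulr_gt0.
have Sdelta (j : 'I_p) : 0 < S j j.
  have := Smin (delta_mx j 0); rewrite qformE mulmx_delta dotp_delta mxE !eqxx mulr1.
  exact: lt_le_trans.
have /choice[tau tauE] (j : 'I_p) :=
  kendall_identity model (Lfun2_coordrv K0 psi2x) (ell j) (Sdelta j).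
have nt1 : (1 + 1 + C') * L <= n%:R * (lam * t - dev_cst K * lam ^+ 2).
  by apply: le_trans nt; rewrite le_eqVlt; apply/orP; left; apply/eqP; ring.
have pI : #|'I_p|%:R <= expR (1 * L) by rewrite card_ord mul1r pL.
have [mB1 PB1] := union_dev_event (fun j => delta_mx j 0) lam01 pI nt1.
have [mB2 PB2] := union_dev_event (fun j => delta_mx j 0 + beta) lam01 pI nt1.
have [mB3 PB3] := union_dev_event (fun j => delta_mx j 0 - beta) lam01 pI nt1.
have uI : #|{: unit}|%:R <= expR (1 * L) by rewrite card_unit mul1r; have := two_le; lra.
have [mB4 PB4] := union_dev_event (fun=> beta) lam01 uI nt1.
(* There are [(2 * p) ^ k.+1] signed sums, at most [p ^ (2 * k.+1)] because [p >= 2]. *)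
have zI : #|{ffun 'I_k.+1 -> 'I_p * bool}|%:R <= expR (2 * k.+1%:R * L).
  rewrite card_ffun card_prod card_bool !card_ord.
  rewrite (_ : 2 * k.+1%:R * L = k.+1%:R * (L + L)); last by ring.
  rewrite expRM_natl natrX lerXn2r ?nnegrE ?expR_ge0//.
  by rewrite expRD natrM -pL ler_wpM2l// ler_nat.
have [mB6 PB6] := union_dev_event
  (fun z : {ffun 'I_k.+1 -> 'I_p * bool} => \sum_l signed_basis (z l)) lam301 zI nk.
have kj j : measurable (kendall_event Z t' j (tau j)) /\
  (P (kendall_event Z t' j (tau j)) <= (2 * expR (- ((C' + 2) * L)))%:E)%E.
  have [m5 P5] := kendall_event_le iidZ t' n1 theta01 (tauE j).1.
  split=> //; apply: le_trans P5 _; rewrite lee_fin ler_pM2l// ler_expR lerN2.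
  exact: nt'.
have [mB5 PB5] := union_bound (fun j => (kj j).1) (fun j => (kj j).2).
have {}PB5 : (P [set w | exists j, kendall_event Z t' j (tau j) w] <= (expR (- (C' * L)))%:E)%E.
  apply: le_trans PB5 _; rewrite lee_fin card_ord pL.
  apply: (@le_trans _ _ (expR L * (expR L * expR (- ((C' + 2) * L))))).
    by rewrite ler_pM2l ?expR_gt0// ler_pM2r ?expR_gt0.
  rewrite -!expRD ler_expR le_eqVlt; apply/orP; left; apply/eqP; ring.
have [m12 P12] := union_bound2 mB1 mB2 PB1 PB2.
have [m13 P13] := union_bound2 m12 mB3 P12 PB3.
have [m14 P14] := union_bound2 m13 mB4 P13 PB4.
have [m15 P15] := union_bound2 m14 mB5 P14 PB5.
have [m16 P16] := union_bound2 m15 mB6 P15 PB6.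
apply: with_prob_setC m16 _ _.
  apply: le_trans P16 _; rewrite lee_fin; lra.
move=> w /not_orP[/not_orP[/not_orP[/not_orP[/not_orP[B1 B2] B3] B4] B5] B6] b copt.
have dev u : ~ dev_event x Z t u w ->
    `|qform (Sigma_hat_xx (fun i => Z i w)) u - qform S u| <= t * dotp u u.
  by rewrite /dev_event/= => /negP; rewrite -leNgt.
apply: (@cenet_error_good_event R p n (fun i => Z i w) S beta b tau s k
  (std_dev P (h \o y)) sb K M t t' alpha1 alpha2) => //.
- exact: cov_mx_sym.
- exact: cov_diag_le.
- exact: identifiable model.
- by move=> j; apply: dev_event_diag => e; apply: B1; exists j.
- by apply: dev => e; apply: B4; exists tt.
- move=> j; apply: offdiag_deviation; [exact: cov_mx_sym|exact: Sigma_hat_sym|..].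
    by apply: dev => e; apply: B2; exists j.
  by apply: dev => e; apply: B3; exists j.
- by rewrite sqrtr_ge0.
- by move=> j; have [_] := tauE j.
- move=> j; rewrite leNgt; apply/negP => e; apply: B5; by exists j.
(* The deviation [(2 * M)^-1 * |u| ^ 2] is at most half of the population form, by the lower bound
   on its eigenvalues. *)
- move=> z; set u := \sum_l _.
  have : ~ dev_event x Z (2 * M)^-1 u w.
    move=> e; apply: B6; exists [ffun l => z l].
    by under eq_bigr do rewrite ffunE.
  rewrite /dev_event/= => /negP; rewrite -leNgt ler_norml => /andP[h1 _].
  have := Smin u; rewrite -/S invfM -mulrA in h1 *; lra.
Qed.

Lemma cenet_error_rate (ck : nat) (tau tau' c0 q C1 C3 T0 E gamma alpha1 alpha2 : R) :
  0 <= tau -> tau ^+ 2 = 4 * dev_cst K * (C' + 2) ->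
  0 <= tau' -> tau' ^+ 2 = 512 * (C' + 2) ->
  576 * M * (2 * K ^+ 2 + 1) <= ck%:R ->
  c0 = (16 * M ^+ 2 * dev_cst K)^-1 ->
  q = tau / (2 * dev_cst K * dev_max K) + 2 * (tau * M) + tau' ->
  C3 = q ^+ 2 + 2 * (C' + 1) / c0 ->
  8 * ck%:R / c0 <= C1 -> 4 <= C1 -> C1 * s%:R * L <= n%:R ->
  T0 = (C' + 2 + dev_cst K * dev_max K ^+ 2) / dev_max K ->
  E = sb * (M * tau) + 4 * (sb * K * tau') + tau * (1 + M) / 2 ->
  1 + 2 * E + (1 + C3) * (sb * (1 + 2 * K ^+ 2 + T0) + 1) <= gamma ->
  alpha1 = gamma * Num.sqrt (L / n%:R) -> 0 <= alpha2 -> alpha2 * linfnorm beta <= alpha1 ->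
  with_prob_at_least P (1 - 6 * expR (- (C' * L)))
    (fun w => forall bhat : 'cV[R]_p,
       is_cenet (fun i => Z i w) (std_dev P (h \o y)) alpha1 alpha2 bhat ->
       l2norm (bhat - beta) ^+ 2 <=
         (15488 * M ^+ 2 + 8 * M ^+ 3 * tau ^+ 2 + M) * s%:R * alpha1 ^+ 2).
Proof.
have A0 := dev_cst_gt0 K0.
have l0 := dev_max_gt0 K0.
have Al : 2 * (dev_cst K * dev_max K) >= 1.
  rewrite /dev_cst /dev_max; set e := expR 1.
  have e1 : 1 <= e by rewrite /e; have := expR_ge1Dx (1 : R); lra.
  have en : e != 0 by rewrite gt_eqF//; lra.
  have Kn : K != 0 by rewrite gt_eqF.
  rewrite (_ : 2 * _ = 128 * (e * K ^+ 2)); last by field; rewrite en Kn.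
  have : 1 <= e * K ^+ 2 by rewrite mulr_ege1// exprn_ege1.
  lra.
move=> tau0 tau2 tau'0 tau'2 ckE c0E qE C3E C1c C14 nC1 T0E EE gE aE a2 a2b.
have sR : 1 <= s%:R :> R by case/andP: bs => b1 b2; rewrite ler1n (leq_trans b1).
have sb0 : 0 <= sb by apply: le_trans sysb; exact: sqrtr_ge0.
have nR : 0 < n%:R :> R by rewrite ltr0n.
have M0 : 0 < M := lt_trans ltr01 M1.
pose a := Num.sqrt (L / n%:R).
have a0 : 0 <= a := sqrtr_ge0 _.
have a2n : n%:R * a ^+ 2 = L.
  by rewrite sqr_sqrtr ?divr_ge0 ?(ltW L0)// mulrC divfK// gt_eqF.
rewrite -/a in aE.
have [nC3|nC3] := leP (C3 * L) n%:R; last first.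
  have nL : 4 * L <= n%:R.
    apply: le_trans nC1; rewrite -mulrA; apply: ler_pM => //; first exact: ltW L0.
    by rewrite ler_peMl// ltW.
  have [nT sB T00 a1] := tuning_small_sample A0 l0 Al M1 K1 C'0 L0 sR sb0 nR tau0 tau'0
    c0E qE C3E T0E EE gE a0 a2n nC3 nL aE.
  have [B [mB PB BQ]] := cenet_zero_bound nT sB T00 a1 a2.
  exists B; split=> // w /BQ hw b /hw /le_trans; apply.
  apply: ler_wpM2r; first exact: sqr_ge0.
  apply: ler_wpM2r; first exact: le_trans ler01 sR.
  rewrite lerDr; apply: addr_ge0; apply: mulr_ge0; [exact: ler0n|exact: sqr_ge0| |exact: sqr_ge0].
  by apply: mulr_ge0; [exact: ler0n|exact/exprn_ge0/ltW].
have k1 : 1 <= (ck * s)%:R :> R.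
  rewrite ler1n muln_gt0; apply/andP; split; last by case/andP: bs => b1; exact: leq_trans.
  rewrite -(ltr0n R); apply: lt_le_trans ckE; apply: mulr_gt0.
    by apply: mulr_gt0; [rewrite ltr0n|exact: M0].
  by rewrite ltr_wpDl// mulr_ge0// sqr_ge0.
have [] := tuning_large_sample A0 l0 Al M1 K1 C'0 L0 sR sb0 nR tau0 tau'0
    c0E qE C3E T0E EE gE a0 a2n nC3 aE C1c nC1 tau2 tau'2 k1 (natrM R ck s).
set t := tau * a; set t' := tau' * a => -[lamB lamE] [thB thE] [lam3B lam3E] [t0 tM2 t'0] [a1p a1a a1E].
have ks : 576 * M * (2 * K ^+ 2 + 1) * s%:R <= (ck * s)%:R by rewrite natrM ler_wpM2r.
rewrite natr1 in lam3E.
have [B [mB PB BQ]] := cenet_oracle_bound lamB lamE thB thE lam3B lam3E t0 tM2 t'0 ks a1p a1E a2 a2b.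
exists B; split=> // w /BQ hw b /hw /le_trans; apply.
(* As [gamma >= 1], the level [t = tau * a] is at most [tau * alpha1]; the error of rescaling [beta]
   is therefore of the order of the main term. *)
have h1 : t ^+ 2 <= tau ^+ 2 * (s%:R * alpha1 ^+ 2).
  rewrite exprMn ler_wpM2l ?sqr_ge0// (@le_trans _ _ (alpha1 ^+ 2))//.
    by rewrite ler_sqr// nnegrE ltW.
  by rewrite ler_peMl// sqr_ge0.
have h2 : 0 <= M ^+ 3 * (tau ^+ 2 * (s%:R * alpha1 ^+ 2) - t ^+ 2).
  by apply: mulr_ge0; [rewrite exprn_ge0// ltW|rewrite subr_ge0].
have h3 : 0 <= M * (s%:R * alpha1 ^+ 2).
  by rewrite !mulr_ge0 ?sqr_ge0// ltW.
rewrite -subr_ge0 (_ : _ - _ = 8 * (M ^+ 3 * (tau ^+ 2 * (s%:R * alpha1 ^+ 2) - t ^+ 2)) +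
  M * (s%:R * alpha1 ^+ 2)); last by ring.
by apply: addr_ge0 => //; rewrite pmulr_rge0.
Qed.

End probability_bounds.

Theorem theorem1 (R : realType) (K M : R) (M_gt1 : 1 < M) :
  exists C0 : R, 0 < C0 /\
  forall C1 : R, C0 <= C1 ->
  forall C' sigma_bar : R, 0 < C' ->
  exists gamma1 gamma2 C : R,
    [/\ 0 < gamma1, gamma1 < gamma2, 0 < C &
    forall (d : measure_display) (T : measurableType d) (P : probability T R)
      (n p s : nat)
      (x : {RV P >-> p.-tuple R}) (y eps : {RV P >-> R})
      (h : R -> R) (beta : 'cV[R]_p)
      (Z : 'I_n -> {RV P >-> (p.-tuple R * R)%type})
      (gamma alpha1 alpha2 : R),
      transformation_model x y eps h beta ->
      std_dev P (h \o y) <= sigma_bar ->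
      (0 < l0norm beta <= s)%N ->
      iid_copies P Z (fun w => (x w, y w)) ->
      (forall j : 'I_p, bivariate_elliptical P (coordrv x j) (h \o y)) ->
      (psi2norm_vec P x <= K%:E)%E ->
      M^-1 <= lambda_min (cov_mx P x) ->
      lambda_min (cov_mx P x) < lambda_max (cov_mx P x) ->
      lambda_max (cov_mx P x) <= M ->
      C1 * s%:R * ln p%:R <= n%:R ->
      gamma1 <= gamma <= gamma2 ->
      alpha1 = gamma * Num.sqrt (ln p%:R / n%:R) ->
      0 <= alpha2 ->
      alpha2 * linfnorm beta <= alpha1 ->
      with_prob_at_least P (1 - 6 * expR (- (C' * ln p%:R)))
        (fun w => forall bhat : 'cV[R]_p,
          is_cenet (fun i => Z i w) (std_dev P (h \o y)) alpha1 alpha2 bhat ->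
          l2norm (bhat - beta) ^+ 2 <= C * s%:R * alpha1 ^+ 2)].
Proof.
(* [K] is an arbitrary real; raising it to at least 1 weakens the moment bound and makes the
   constants positive. *)
pose K' := Num.max K 1; pose A := dev_cst K'; pose l := dev_max K'.
pose c0 := (16 * M ^+ 2 * A)^-1.
pose ck := Num.bound (576 * M * (2 * K' ^+ 2 + 1)).
have M0 : 0 < M := lt_trans ltr01 M_gt1.
have K'1 : 1 <= K' by rewrite le_max lexx orbT.
have K'0 : 0 < K' := lt_le_trans ltr01 K'1.
have ckE : 576 * M * (2 * K' ^+ 2 + 1) <= ck%:R.
  apply/ltW/archi_boundP; apply: mulr_ge0.
    by apply: mulr_ge0; [exact: ler0n|exact: ltW].
  by rewrite addr_ge0// mulr_ge0// sqr_ge0.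
have c00 : 0 <= c0.
  rewrite /c0 invr_ge0; apply: mulr_ge0; last exact/ltW/dev_cst_gt0.
  by apply: mulr_ge0; [exact: ler0n|exact: sqr_ge0].
have C00 : 0 <= 8 * ck%:R / c0 by rewrite divr_ge0// mulr_ge0.
(* This threshold depends on [K] and [M] only, being chosen before [C']. The first summand pays for
   the union over signed sums; the [4] yields [n >= 2] and [4 * L <= n]. *)
exists (8 * ck%:R / c0 + 4); split; first by rewrite ltr_wpDl.
move=> C1 C0C1 C' sigma_bar C'0.
have C1c : 8 * ck%:R / c0 <= C1 by apply: le_trans C0C1; rewrite lerDl.
have C14 : 4 <= C1 by apply: le_trans C0C1; rewrite lerDr.
(* The absolute value provides a nonnegative bound on the standard deviation before any model is
   given. *)
pose sb := `|sigma_bar|.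
pose tau := Num.sqrt (4 * A * (C' + 2)); pose tau' := Num.sqrt (512 * (C' + 2)).
have C2 : 0 <= C' + 2 by rewrite addr_ge0// ltW.
have tau2 : tau ^+ 2 = 4 * A * (C' + 2).
  by rewrite sqr_sqrtr// mulr_ge0// mulr_ge0// ltW// dev_cst_gt0.
have tau'2 : tau' ^+ 2 = 512 * (C' + 2) by apply: sqr_sqrtr; apply: mulr_ge0; [exact: ler0n|].
pose q := tau / (2 * A * l) + 2 * (tau * M) + tau'.
pose C3 := q ^+ 2 + 2 * (C' + 1) / c0.
pose T0 := (C' + 2 + A * l ^+ 2) / l.
pose E := sb * (M * tau) + 4 * (sb * K' * tau') + tau * (1 + M) / 2.
pose gamma1 := 1 + 2 * E + (1 + C3) * (sb * (1 + 2 * K' ^+ 2 + T0) + 1).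
have gamma10 : 0 < gamma1.
  have tau0 : 0 <= tau := sqrtr_ge0 _.
  have tau'0 : 0 <= tau' := sqrtr_ge0 _.
  have sb0 : 0 <= sb := normr_ge0 _.
  have E0 : 0 <= E.
    have M10 : 0 <= 1 + M by rewrite addr_ge0// ltW.
    by rewrite /E !addr_ge0 ?divr_ge0 ?mulr_ge0// ltW.
  have T00 : 0 <= T0.
    by rewrite /T0 divr_ge0 ?(ltW (dev_max_gt0 K'0))// addr_ge0// mulr_ge0 ?sqr_ge0//
      ltW// dev_cst_gt0.
  have C30 : 0 <= C3.
    by rewrite /C3 addr_ge0 ?sqr_ge0// divr_ge0// mulr_ge0// addr_ge0// ltW.
  rewrite /gamma1 ltr_pwDl//; first by rewrite ltr_pwDl// mulr_ge0.
  apply: mulr_ge0; apply: addr_ge0 => //; apply: mulr_ge0 => //.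
  by rewrite !addr_ge0// mulr_ge0// sqr_ge0.
exists gamma1, (gamma1 + 1), (15488 * M ^+ 2 + 8 * M ^+ 3 * tau ^+ 2 + M); split.
- exact: gamma10.
- by rewrite ltrDl.
- apply: ltr_wpDl; last exact: M0.
  apply: addr_ge0; apply: mulr_ge0; [exact: ler0n|exact: sqr_ge0| |exact: sqr_ge0].
  by apply: mulr_ge0; [exact: ler0n|exact/exprn_ge0/ltW].
move=> d T P n p s x y eps h beta Z gamma alpha1 alpha2 model std_le bs iidZ ell psi2x lmin _ _ nC1
  /andP[gE _] aE a2 a2b.
(* For [p <= 1] the logarithm is 0, with [ln 0 = 0] by convention, so the required probability is
   [1 - 6] and the empty event will do. *)
have [p1|p1] := leqP p 1.
  exists set0; split; [exact: measurable0| |exact: sub0set].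
  have ln_le1 m : (m <= 1)%N -> ln m%:R = 0 :> R.
    by case: m => [|[|//]] _; [exact: ln0|exact: ln1].
  rewrite ln_le1//.
  by rewrite mulr0 oppr0 expR0 mulr1 measure0 lee_fin; lra.
have psi2x' : (psi2norm_vec P x <= K'%:E)%E.
  by apply: le_trans psi2x _; rewrite lee_fin le_max lexx.
have Smin u : M^-1 * dotp u u <= qform (cov_mx P x) u.
  apply: le_trans (lambda_min_le_qform u (cov_mx_sym _)).
  by rewrite ler_wpM2r// dotp_ge0.
(* Here [ln p >= 1 / 2], so [C1 * s * ln p >= 4 * 1 / 2 = 2]. *)
have n1 : (1 < n)%N.
  rewrite -(ltr_nat R); apply: lt_le_trans nC1.
  have L2 := @ln_nat_ge_half R p p1.
  have sR : 1 <= s%:R :> R by case/andP: bs => b1 b2; rewrite ler1n (leq_trans b1).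
  have : 4 * 1 * 2^-1 <= C1 * s%:R * ln p%:R :> R by rewrite !ler_pM ?mulr_ge0.
  by lra.
have sysb : std_dev P (h \o y) <= sb by apply: le_trans std_le _; exact: ler_norm.
exact: (cenet_error_rate model K'1 psi2x' iidZ M_gt1 Smin sysb bs n1 p1 C'0 ell
  (sqrtr_ge0 _) tau2 (sqrtr_ge0 _) tau'2 ckE erefl erefl erefl C1c C14 nC1 erefl erefl gE aE a2 a2b).
Qed.
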